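(* Let $d\ge2$ and $\beta\ge0$. Let $\eta:[0,\infty)\to\mathbb{R}$ be continuous, $k$ times differentiable on $(0,\infty)$, where $k$ is an integer with $k>(d+3)/2+\beta$, and suppose that \[\liminf_{r\to\infty}\frac{\eta(r)}{\log r}=\infty\] and that for some $0<\alpha<2$, \[\sup_{0\le m\le k}\ \sup_{r>0}\ \big|r^{-\alpha+m}D^m\eta(r)\big|=A<\infty,\] where $D$ denotes differentiation in $r$. For $t>0$, $x\in\mathbb{R}^d$ let \[K^\beta(t,x)=(2\pi)^{-d}\int_{\mathbb{R}^d}e^{-ix\cdot\xi}|\xi|^\beta e^{-t\eta(|\xi|)}\,d\xi .\] If $\beta\notin\{0,2,4,\dots\}$, then for each $t>0$, \[K^\beta(t,x)\sim\frac{2^\beta\,\Gamma(\frac{d+\beta}{2})}{\pi^{d/2}\,\Gamma(\frac{-\beta}{2})}\,\frac{e^{-t\eta(0)}}{|x|^{d+\beta}}\qquad\text{as }|x|\to\infty.\]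
   Context: $\Gamma$ is the Euler gamma function. $f(x)\sim g(x)$ as $|x|\to\infty$ means $f(x)/g(x)\to 1$. *)

(* Defs.v *)
From HB Require Import structures.
From mathcomp Require Import all_boot all_order all_algebra.
From mathcomp Require Import all_classical all_reals all_analysis.
Set Implicit Arguments. Unset Strict Implicit. Unset Printing Implicit Defensive.
Import Order.TTheory GRing.Theory Num.Theory.
Import numFieldNormedType.Exports.
Local Open Scope classical_set_scope.
Local Open Scope ring_scope.

Section Defs.
Variable R : realType.

Definition Gamma_pos (s : R) : R :=
  Rintegral (@lebesgue_measure R) `]0%R, +oo[%classic
    (fun t => t `^ (s - 1) * expR (- t)).

(* Euler Gamma on R \ {0,-1,-2,...}, by the functional equation:
   Gamma s = Gamma(s+n) / (s (s+1) ... (s+n-1)) with n = floor(-s)+1,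
   so that s + n > 0. (For s > 0, n = 1 and this is Gamma_pos s.) *)
Definition Gamma (s : R) : R :=
  let n := (Num.truncn (- s)).+1 in
  Gamma_pos (s + n%:R) / \prod_(j < n) (s + j%:R).

Definition dotR (d : nat) (x y : d.-tuple R) : R :=
  \sum_(i < d) tnth x i * tnth y i.
Definition enorm (d : nat) (x : d.-tuple R) : R := Num.sqrt (dotR x x).

(* Lebesgue integral over R^d, written as the iterated integral
   int_R ... int_R f(x_1,...,x_d) dx_d ... dx_1 (Fubini; all integrands
   used below are absolutely integrable). *)
Fixpoint integral_Rd (d : nat) : (d.-tuple R -> R) -> R :=
  match d with
  | 0 => fun f => f [tuple]
  | n.+1 => fun f => Rintegral (@lebesgue_measure R) setT
              (fun x : R => integral_Rd (fun v : n.-tuple R => f [tuple of x :: v]))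
  end.

(* K^beta(t,x) = (2 pi)^(-d) int e^(-i x.xi) |xi|^beta e^(-t eta(|xi|)) dxi,
   split into real part Kre and imaginary part Kim:
   e^(-i x.xi) = cos(x.xi) - i sin(x.xi). *)
Definition Kre (d : nat) (beta : R) (eta : R -> R) (t : R) (x : d.-tuple R) : R :=
  (2 * pi) `^ (- d%:R) *
  integral_Rd (fun xi : d.-tuple R =>
    cos (dotR x xi) * (enorm xi `^ beta * expR (- t * eta (enorm xi)))).

Definition Kim (d : nat) (beta : R) (eta : R -> R) (t : R) (x : d.-tuple R) : R :=
  (2 * pi) `^ (- d%:R) *
  integral_Rd (fun xi : d.-tuple R =>
    - sin (dotR x xi) * (enorm xi `^ beta * expR (- t * eta (enorm xi)))).

End Defs.

(* Main.v *)
Require Import Defs.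
From HB Require Import structures.
From mathcomp Require Import all_boot all_order all_algebra.
From mathcomp Require Import all_classical all_reals all_analysis.
From mathcomp Require Import measurable_realfun ring lra.
Import Order.TTheory GRing.Theory Num.Theory.
Import numFieldNormedType.Exports.
Local Open Scope classical_set_scope.
Local Open Scope ring_scope.
Set Implicit Arguments. Unset Strict Implicit. Unset Printing Implicit Defensive.

(* Write the integrand as a radial function [H1 w], [w = |xi|^2].  Taylor's
   formula at infinity gives [H1 w = (-1)^k / m! \int h v (v - w)_+^m dv] with
   [k = m + 1] and [h] the [k]-th derivative of [H1]; by Fubini the Fourier integral becomes
   [\int h v Psi_x v dv], where [Psi_x] is the Fourier transform of
   [(v - |xi|^2)_+^m].  Integrating out one coordinate at a time shows that
   [Psi_x v] is a constant times [v^(l + 1/2) I_l (|x| sqrt v)] with [l = m + (d - 1) / 2]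
   and [I_l r = \int cos (r u) (1 - u^2)_+^l du = O(r^-l)].

   Since [H1 w = w^(beta/2) (1 + O(w^(alpha/2)))] at [0], with the matching bounds on
   derivatives, [h] is [c v^(beta/2 - k)] plus a term smaller by [min 1 (v^(alpha/2))].
   The first part contributes an exact multiple of [|x|^-(d + beta)], a Mellin
   transform of [I_l]; the second is [O(|x|^-(d + beta + delta))] because
   [k > (d + 3) / 2 + beta] means [l > d + beta].  The Mellin transform is evaluated by running the
   same formula on [expR (- w)], whose Fourier transform is known. *)

(** * Integration on the real line *)

(** The obstacle is that the two pieces [v^b] and [v^b (expR (- t E v) - 1)] of the symbol, with
    [b = beta / 2], both grow at infinity: their Fourier integrals diverge and neither has a Taylor
    formula at infinity. The splitting is therefore made only after Fubini, on the derivative of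
    order [m + 1], where both pieces are integrable against the decaying [Icos]. The variable
    [w = |xi|^2] is chosen because integrating out a coordinate [u] becomes the shift
    [w -> w + u^2]: an iterated integral is then handled on the line, and rotation invariance
    reduces to a change of variables for two frequencies. The Gaussian is a good test function
    because its density is again exponential: the comparison yields a Laplace transform of [Icos],
    and integrating it against a power isolates the Mellin transform times a Gamma value. The
    derivative of order [m + 1] of [v^b] carries the factor [b (b - 1) ... (b - m)], which turns
    into [1 / Gamma (- b)]; this is where [beta] being no even integer enters. *)

Section integral_toolbox.
Context {R : realType}.
Local Notation mu := (@lebesgue_measure R).
Implicit Types (f g h : R -> R).

Definition itg f := mu.-integrable setT (EFin \o f).
Local Notation intR f := (Rintegral mu setT f).

Lemma itg_measurable f : itg f -> measurable_fun setT f.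
Proof. by move=> /measurable_int /measurable_EFinP. Qed.

Lemma itg_le f g : measurable_fun setT f -> (forall x, `|f x| <= g x) ->
  itg g -> itg f.
Proof.
move=> mf fg ig; apply: (le_integrable _ _ _ ig) => //.
  exact/measurable_EFinP.
by move=> x _ /=; rewrite lee_fin (le_trans (fg x))// ler_norm.
Qed.

Lemma itgD f g : itg f -> itg g -> itg (fun x => f x + g x).
Proof. by move=> f_ g_; apply: (integrableD measurableT f_ g_). Qed.

Lemma itgZ c f : itg f -> itg (fun x => c * f x).
Proof. by move=> f_; apply: (integrableZl measurableT c f_). Qed.

Lemma itg_norm f : itg f -> itg (fun x => `|f x|).
Proof. exact: integrable_norm. Qed.

Lemma itg_bounded f g : measurable_fun setT f -> (forall x, `|f x| <= 1) ->
  itg g -> itg (fun x => f x * g x).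
Proof.
move=> mf f1 ig; apply: (itg_le _ _ (itg_norm ig)).
  by apply: measurable_funM => //; exact: itg_measurable.
by move=> x; rewrite normrM ler_piMl.
Qed.

Lemma intRD f g : itg f -> itg g ->
  intR (fun x => f x + g x) = intR f + intR g.
Proof. by move=> *; rewrite RintegralD. Qed.

Lemma intRZ c f : itg f -> intR (fun x => c * f x) = c * intR f.
Proof. by move=> *; rewrite RintegralZl. Qed.

Lemma le_intR f g : itg f -> itg g -> (forall x, f x <= g x) ->
  intR f <= intR g.
Proof. by move=> *; apply: le_Rintegral. Qed.

Lemma normr_intR_le f g : itg f -> itg g -> (forall x, `|f x| <= g x) ->
  `|intR f| <= intR g.
Proof.
move=> f_ g_ fg; apply: le_trans (le_normr_Rintegral _ f_) _ => //.
by apply: le_intR => //; exact: itg_norm.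
Qed.

Lemma EFin_intR f : itg f -> (intR f)%:E = (\int[mu]_x (f x)%:E)%E.
Proof. by move=> f_; rewrite fineK//; exact: integrable_fin_num. Qed.

Lemma ge0_itg f : measurable_fun setT f -> (forall x, 0 <= f x) ->
  (\int[mu]_x (f x)%:E < +oo)%E -> itg f.
Proof.
move=> mf f0 fy; apply/integrableP; split; first exact/measurable_EFinP.
by under eq_integral do rewrite /= ger0_norm//.
Qed.

(** The single exceptional point 0 is enough: the Taylor representation of the symbol is available
    only for [w > 0], and [w + u^2 = 0] forces [u = 0]. *)
Lemma ae_intR f g : measurable_fun setT f -> measurable_fun setT g ->
  (forall x, x != 0 -> f x = g x) -> intR f = intR g.
Proof.
move=> mf mg fg; congr fine; apply: ae_eq_integral => //.
- exact/measurable_EFinP.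
- exact/measurable_EFinP.
exists [set 0]; split => //; first exact: lebesgue_measure_set1.
by move=> x /=; apply: contra_notP => x0 _ /=; rewrite fg//; exact/eqP.
Qed.

(** Fubini produces partial integrals in [\bar R] that are finite only almost everywhere; this moves
    them to real-valued functions. *)
Lemma itg_fine (g : R -> \bar R) : mu.-integrable setT g ->
  itg (fun x => fine (g x)) /\
  intR (fun x => fine (g x)) = fine (\int[mu]_x g x)%E.
Proof.
move=> ig; have mg := measurable_int _ ig.
have mfg : measurable_fun setT (fun x => fine (g x)) by exact: measurableT_comp.
have aefg : ae_eq mu setT (EFin \o (fun x => fine (g x))) g.
  have := integrable_ae measurableT ig; apply: filterS => x /= /(_ I) gx _ /=.
  by rewrite fineK.
split.
  apply/integrableP; split; first exact/measurable_EFinP.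
  rewrite (_ : (\int[mu]_x _)%E = (\int[mu]_x `|g x|)%E).
    by have /integrableP[] := ig.
  apply: ae_eq_integral => //.
  - by apply: measurableT_comp => //; exact/measurable_EFinP.
  - by apply: measurableT_comp.
  by move: aefg; apply: filterS => x /= /(_ I) gx _; rewrite -gx.
by congr fine; apply: ae_eq_integral => //; exact/measurable_EFinP.
Qed.

Lemma measurable_intR (f : R -> R -> R) :
  measurable_fun setT (fun p : R * R => f p.1 p.2) ->
  measurable_fun setT (fun x => intR (f x)).
Proof.
move=> mf.
pose F := (fun p : measurableTypeR R * measurableTypeR R => (f p.1 p.2)%:E).
have mF : measurable_fun setT F by exact/measurable_EFinP.
apply: (measurableT_comp (f := fine)) => //.
rewrite (_ : (fun x => _) = ((fun x => \int[mu]_y F^\+ (x, y)) \-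
    (fun x => \int[mu]_y F^\- (x, y)))%E); last first.
  apply/funext => x; rewrite [LHS]integralE; congr (_ - _)%E.
    by apply: eq_integral => y _; rewrite funepos.unlock.
  by apply: eq_integral => y _; rewrite funeneg.unlock.
apply: emeasurable_funB.
  have mFp := measurable_funepos mF.
  exact: (measurable_fun_fubini_tonelli_F _ mFp (fun=> funepos_ge0 _ _)).
have mFn := measurable_funeneg mF.
exact: (measurable_fun_fubini_tonelli_F _ mFn (fun=> funeneg_ge0 _ _)).
Qed.

(** By Tonelli, an integrable bound [g] on the inner absolute integrals makes [f] integrable over
    the plane. The other partial integral is that of the transposed function [F']. *)
Lemma fubiniR (f : R -> R -> R) g :
  measurable_fun setT (fun p : R * R => f p.1 p.2) ->
  (forall x, itg (f x)) ->
  itg g -> (forall x, intR (fun y => `|f x y|) <= g x) ->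
  [/\ itg (fun x => intR (f x)), itg (fun y => intR (f^~ y)) &
      intR (fun x => intR (f x)) = intR (fun y => intR (f^~ y))].
Proof.
move=> mf f_ g_ fg.
pose F := (fun p : measurableTypeR R * measurableTypeR R => (f p.1 p.2)%:E).
have iF : (mu \x mu)%E.-integrable setT F.
  apply/integrable12ltyP; first exact/measurable_EFinP.
  have /integrableP[_] := g_; apply: le_lt_trans; apply: ge0_le_integral => //=.
  - by move=> x _; exact: integral_ge0.
  - have mF : measurable_fun setT (fun p => `|F p|%E).
      by apply: measurableT_comp => //; exact/measurable_EFinP.
    exact: (measurable_fun_fubini_tonelli_F _ mF (fun=> abse_ge0 _)).
  - by apply/measurable_EFinP/measurableT_comp => //; exact: itg_measurable.
  move=> x _; rewrite -(EFin_intR (itg_norm (f_ x))) lee_fin.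
  exact: le_trans (fg x) (ler_norm _).
have [i1 e1] := itg_fine (integrable_fubini_F iF).
pose F' := (fun p : measurableTypeR R * measurableTypeR R => (f p.2 p.1)%:E).
have mF' : measurable_fun setT F'.
  apply/measurable_EFinP.
  apply: (measurableT_comp mf (g := fun p : R * R => (p.2, p.1))).
  by apply: measurable_fun_pair; [exact: measurable_snd|exact: measurable_fst].
have iF' : (mu \x mu)%E.-integrable setT F'.
  apply/integrable12ltyP => //.
  exact: (integrable21ltyP _ _ (measurable_int _ iF)).1.
have [i2 e2] := itg_fine (integrable_fubini_F iF').
split => //; rewrite e1 [RHS]e2; congr fine.
by rewrite integral12_prod_meas1// -integral21_prod_meas1.
Qed.

Lemma itg_oneDsqrV : itg (fun x => (1 + x ^+ 2)^-1).
Proof.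
have c := @continuous_oneDsqrV R.
apply: ge0_itg.
- exact: continuous_measurable_fun.
- by move=> x; rewrite invr_ge0 addr_ge0// sqr_ge0.
rewrite (@ge0_symfun_integralT _ (fun x => (1 + x ^+ 2)^-1))//.
- rewrite (_ : [set x | _] = `[0, +oo[%classic); last first.
    by apply/seteqP; split => x/=; rewrite in_itv/= andbT.
  by rewrite integral0y_oneDsqr ltry.
- by move=> x; rewrite invr_ge0 addr_ge0// sqr_ge0.
- by move=> x /=; rewrite sqrrN.
Qed.

Lemma itg_oneDsqrP f C : measurable_fun setT f ->
  (forall x, `|f x| <= C / (1 + x ^+ 2)) -> itg f.
Proof. by move=> mf fC; apply: (itg_le mf fC); exact: itgZ itg_oneDsqrV. Qed.

Lemma dominated_cvgR (f_ : nat -> R -> R) f g :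
  (forall n, measurable_fun setT (f_ n)) -> itg g ->
  (forall n x, `|f_ n x| <= g x) -> (forall x, f_ n x @[n --> \oo] --> f x) ->
  itg f /\ intR (f_ n) @[n --> \oo] --> intR f.
Proof.
move=> mf_ g_ fg ff.
have mf : measurable_fun setT f.
  by apply: (measurable_fun_cvg (h := f_)) => // x _; exact: ff.
have f_itg : itg f.
  apply: (itg_le mf _ g_) => x.
  have : `|f_ n x| @[n --> \oo] --> `|f x| by exact: cvg_norm.
  by move=> /cvgr_to_le; apply; exact: nearW.
split => //; apply: fine_cvg; rewrite EFin_intR//.
apply: (@dominated_cvg _ _ _ mu _ measurableT (fun n => EFin \o f_ n) _ (EFin \o g)) => //.
- by move=> n; exact: (measurable_EFinP _ _).2 (mf_ n).
- move=> x _; apply: cvg_EFin; first exact: nearW.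
  exact: ff.
- by move=> n x _ /=; rewrite lee_fin.
Qed.

Let affine_measurable a b : measurable_fun setT
  ((fun x : R => a * x + b) : measurableTypeR R -> measurableTypeR R).
Proof. by apply: measurable_funD => //; apply: measurable_funM. Qed.

Let opp_measurable : measurable_fun setT
  ((-%R : R -> R) : measurableTypeR R -> measurableTypeR R).
Proof.
rewrite (_ : (-%R : R -> R) = (fun x => (-1) * x + 0)); first exact: affine_measurable.
by apply/funext => x; rewrite mulN1r addr0.
Qed.

Local Notation push_mu mf :=
  (measure_function_pushforward__canonical__measure_function_Measure mu mf).

(** Lebesgue measure is determined by its values on half-open intervals, and for [a > 0] the
    preimage of such an interval is again open on the left and closed on the right. Negative [a] is
    reached by reflection. *)
Let lebesgue_affine_pos a b (a0 : 0 < a) (A : set (measurableTypeR R)) :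
  measurable A ->
  mu A = mscale (NngNum (ltW a0)) (push_mu (affine_measurable a b)) A.
Proof.
apply: lebesgue_measure_unique => _ [[p q]] _ <- /=.
rewrite /mscale/= /pushforward.
rewrite (_ : _ @^-1` _ = `](p - b) / a, (q - b) / a]%classic); last first.
  apply/seteqP; split => x /=; rewrite !in_itv/= ltr_pdivrMr// ler_pdivlMr//;
  by rewrite ltrBlDr lerBrDr (mulrC x).
rewrite !lebesgue_measure_itv/= !lte_fin ltr_pM2r ?invr_gt0// ltrD2r.
case: ifP => _; last by rewrite mule0.
rewrite -!EFinB -EFinM; congr EFin; field; exact: lt0r_neq0.
Qed.

Let integral_affine_pos a b (f : R -> \bar R) : 0 < a ->
  measurable_fun setT f -> (forall x, 0 <= f x)%E ->
  (\int[mu]_x f x = a%:E * \int[mu]_x f (a * x + b)%R)%E.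
Proof.
move=> a0 mf f0.
rewrite (@eq_measure_integral _ _ _ _
  (mscale (NngNum (ltW a0)) (push_mu (affine_measurable a b)))); last first.
  by move=> A mA _; exact: lebesgue_affine_pos.
rewrite ge0_integral_mscale//=; congr (_ * _)%E.
by rewrite ge0_integral_pushforward//=; move=> x _; exact: f0.
Qed.

Let integral_opp (f : R -> \bar R) :
  measurable_fun setT f -> (forall x, 0 <= f x)%E ->
  (\int[mu]_x f x = \int[mu]_x f (- x)%R)%E.
Proof.
move=> mf f0.
rewrite (@eq_measure_integral _ _ _ _ (push_mu opp_measurable)); last first.
  by move=> A mA _; exact/esym/lebesgue_measureN.
by rewrite ge0_integral_pushforward//=; move=> x _; exact: f0.
Qed.

Let ge0_integral_affine a b (f : R -> \bar R) : a != 0 ->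
  measurable_fun setT f -> (forall x, 0 <= f x)%E ->
  (\int[mu]_x f x = `|a|%:E * \int[mu]_x f (a * x + b)%R)%E.
Proof.
move=> a0 mf f0; case: (ltrgt0P a) a0 => // a0 _.
  exact: integral_affine_pos.
rewrite (@integral_affine_pos (- a) b) ?oppr_gt0//; congr (_ * _)%E.
rewrite [RHS]integral_opp//.
- by apply: eq_integral => x _; rewrite mulrN mulNr.
- apply: measurableT_comp => //; exact: affine_measurable.
Qed.

Lemma itg_affine a b f : a != 0 -> itg f -> itg (fun x => f (a * x + b)).
Proof.
move=> a0 f_; have mf := itg_measurable f_.
have ma := affine_measurable a b.
apply/integrableP; split.
  by apply/measurable_EFinP; exact: (measurableT_comp mf).
have /integrableP[_] := f_.
rewrite (@ge0_integral_affine a b (fun x => `|(f x)%:E|)%E)//; last first.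
  by apply: measurableT_comp => //; exact/measurable_EFinP.
set I := (\int[mu]_x _)%E => Iy; rewrite ltNge leye_eq; apply/negP => /eqP Iy'.
by move: Iy; rewrite Iy' mulry gtr0_sg ?mul1e ?normr_gt0// ltxx.
Qed.

Lemma intR_affine a b f : a != 0 -> itg f ->
  intR (fun x => f (a * x + b)) = `|a|^-1 * intR f.
Proof.
move=> a0 f_; have mf := itg_measurable f_.
have fab := itg_affine b a0 f_.
pose fp x := Num.max (f x) 0; pose fn x := Num.max (- f x) 0.
have mfp : measurable_fun setT fp by exact: measurable_maxr.
have mfn : measurable_fun setT fn.
  by apply: measurable_maxr => //; exact: measurableT_comp.
have fE x : f x = fp x + (-1) * fn x.
  by rewrite /fp /fn; case: (leP 0 (f x)) => f0; case: leP => f1; lra.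
have fp_ : itg fp.
  apply: (itg_le mfp _ (itg_norm f_)) => x; rewrite /fp.
  by case: (leP (f x) 0) => f0; rewrite ?normr0.
have fn_ : itg fn.
  apply: (itg_le mfn _ (itg_norm f_)) => x; rewrite /fn.
  by case: (leP (- f x) 0) => f0; rewrite ?normr0// normrN.
have key g : itg g -> (forall x, 0 <= g x) ->
    intR (fun x => g (a * x + b)) = `|a|^-1 * intR g.
  move=> g_ g0; have gab := itg_affine b a0 g_.
  have := @ge0_integral_affine a b (EFin \o g) a0 (measurable_int _ g_) g0.
  rewrite -(EFin_intR g_) -(EFin_intR gab) -EFinM => -[->].
  by rewrite mulKf// normr_eq0.
rewrite (_ : (fun x => f (a * x + b)) =
  (fun x => fp (a * x + b) + (-1) * fn (a * x + b))); last first.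
  by apply/funext => x.
rewrite intRD; last 2 first.
  exact: (itg_affine b a0 fp_).
  exact/itgZ/(itg_affine b a0 fn_).
rewrite intRZ; last exact: (itg_affine b a0 fn_).
rewrite (_ : intR f = intR (fun x => fp x + (-1) * fn x)); last first.
  by apply: eq_Rintegral => x _.
rewrite intRD//; last exact: itgZ.
rewrite intRZ// !key//; last 2 first.
  by move=> x; rewrite /fn le_max lexx orbT.
  by move=> x; rewrite /fp le_max lexx orbT.
by rewrite mulrDr mulrCA.
Qed.

Lemma intR_odd f : itg f -> (forall x, f (- x) = - f x) -> intR f = 0.
Proof.
move=> f_ fN; have N1 : (-1 : R) != 0 by rewrite oppr_eq0 oner_eq0.
have := intR_affine 0 N1 f_.
rewrite normrN normr1 invr1 mul1r.
rewrite (_ : (fun x => f _) = (fun x => (-1) * f x)); last first.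
  by apply/funext => x; rewrite addr0 !mulN1r fN.
by rewrite intRZ// mulN1r => ?; lra.
Qed.

(** A density of mass one: it expresses short averages in the fundamental theorem below and bounds
    the Gamma integral from below. *)
Lemma itg_box : itg (fun s => if 0 < s <= 1 then 1 : R else 0) /\
  intR (fun s => if 0 < s <= 1 then 1 : R else 0) = 1.
Proof.
have E : (fun s : R => if 0 < s <= 1 then 1 : R else 0) = \1_(`]0%R, 1%R]%classic).
  by apply/funext => s; rewrite indicE mem_setE in_itv/=; case: ifP.
rewrite E; split; first exact: (integrable_indic_itv 0 1 false false).
rewrite /Rintegral integral_indic//= setIT lebesgue_measure_itv/= lte_fin ltr01.
by rewrite -EFinB/= subr0.
Qed.

End integral_toolbox.

Local Opaque Rintegral powR expR cos sin lebesgue_measure Num.Def.sqrtr.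

(** * The iterated kernel and its rotation invariance *)

Section pospow.
Context {R : realType}.
Local Notation mu := (@lebesgue_measure R).
Local Notation intR f := (Rintegral mu setT f).
Implicit Types (a b c k l p q r s u v x y z : R) (psi phi : R -> R).

Lemma measurable_compR d (T : measurableType d) (f : R -> R) (g : T -> R) :
  measurable_fun setT f -> measurable_fun setT g ->
  measurable_fun setT (fun t : T => f (g t)).
Proof. exact: measurableT_comp. Qed.

Lemma measurable_cos : measurable_fun setT (@cos R).
Proof. by apply: continuous_measurable_fun; exact: continuous_cos. Qed.

Lemma measurable_sin : measurable_fun setT (@sin R).
Proof. by apply: continuous_measurable_fun; exact: continuous_sin. Qed.

(** The truncated power [s_+^l]. The exponent is real because each integration over a coordinate
    raises it by 1/2; for [l > 0] it vanishes on the negative half-line. *)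
Definition pospow l s := (Num.max 0 s) `^ l.

Lemma measurable_pospow l : measurable_fun setT (pospow l).
Proof.
apply: (measurable_compR (f := @powR R ^~ l)); first exact: measurable_powR.
exact: measurable_maxr.
Qed.

Lemma pospow_ge0 l s : 0 <= pospow l s.
Proof. exact: powR_ge0. Qed.

Lemma pospow_pos l s : 0 <= s -> pospow l s = s `^ l.
Proof. by move=> s0; rewrite /pospow max_r. Qed.

Lemma pospow_neg l s : 0 < l -> s <= 0 -> pospow l s = 0.
Proof. by move=> l0 s0; rewrite /pospow max_l// powR0// gt_eqF. Qed.

Lemma ler_pospow l s u : 0 < l -> s <= u -> pospow l s <= pospow l u.
Proof.
move=> l0 su; have [s0|/ltW s0] := leP s 0.
  by rewrite pospow_neg// pospow_ge0.
have u0 := le_trans s0 su.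
by rewrite !pospow_pos// ge0_ler_powR// ?nnegrE// ltW.
Qed.

Lemma pospowM l c s : 0 < l -> 0 < c ->
  pospow l (c * s) = c `^ l * pospow l s.
Proof.
move=> l0 c0; have [s0|/ltW s0] := leP s 0.
  by rewrite !pospow_neg ?mulr0// pmulr_rle0.
by rewrite !pospow_pos ?mulr_ge0 ?powRM// ltW.
Qed.

Lemma measurable_sBsqr psi s : measurable_fun setT psi ->
  measurable_fun setT (fun u => psi (s - u ^+ 2)).
Proof.
move=> mpsi; apply: (measurable_compR mpsi).
by apply: measurable_funB => //; exact: measurable_funX.
Qed.

Lemma measurable_cosM c : measurable_fun setT (fun u : R => cos (c * u)).
Proof. by apply: (measurable_compR measurable_cos); exact: measurable_funM. Qed.

Lemma measurable_sinM c : measurable_fun setT (fun u : R => sin (c * u)).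
Proof. by apply: (measurable_compR measurable_sin); exact: measurable_funM. Qed.

Lemma normr_cos_le1 u : `|cos u| <= 1.
Proof. by rewrite ler_norml cos_geN1 cos_le1. Qed.

Lemma normr_sin_le1 u : `|sin u| <= 1.
Proof. by rewrite ler_norml sin_geN1 sin_le1. Qed.

Lemma itg_pospow l s : 0 < l -> itg (fun u => pospow l (s - u ^+ 2)).
Proof.
move=> l0; apply: (@itg_oneDsqrP _ _ (pospow l s * (1 + Num.max 0 s))).
  by apply: measurable_sBsqr; exact: measurable_pospow.
move=> u; rewrite ger0_norm ?pospow_ge0//.
have u0 : 0 <= u ^+ 2 by exact: sqr_ge0.
have v0 : 0 < 1 + u ^+ 2 by rewrite ltr_pwDl.
rewrite ler_pdivlMr//.
have [us|us] := leP s (u ^+ 2).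
  rewrite (pospow_neg l0) ?subr_le0// mul0r mulr_ge0 ?pospow_ge0//.
  by rewrite addr_ge0// le_max lexx.
rewrite ler_pM ?pospow_ge0//; first exact: ltW.
  by rewrite ler_pospow// gerBl.
by rewrite lerD2l le_max (ltW us) orbT.
Qed.

(** Fourier transform in one coordinate; iterated over the coordinates it gives the transform of
    [xi -> psi (s - |xi|^2)] as a function of [s]. *)
Definition Vop c psi s := intR (fun u => cos (c * u) * psi (s - u ^+ 2)).

(** For [l > 0] this bound also forces [psi] to vanish on the negative half-line, so every integrand
    below has compact support in [u]. *)
Definition dominated l psi :=
  measurable_fun setT psi /\ exists C, forall s, `|psi s| <= C * pospow l s.

Lemma dominated_pospow l : dominated l (pospow l).
Proof.
split; first exact: measurable_pospow.
by exists 1 => s; rewrite mul1r ger0_norm ?pospow_ge0.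
Qed.

Lemma itg_dominated l psi s : 0 < l -> dominated l psi ->
  itg (fun u => psi (s - u ^+ 2)).
Proof.
move=> l0 [mpsi [C psiC]].
apply: (itg_le _ _ (itgZ C (itg_pospow s l0))).
  exact: measurable_sBsqr.
by move=> u.
Qed.

Lemma itg_cosM_dominated l c psi s : 0 < l -> dominated l psi ->
  itg (fun u => cos (c * u) * psi (s - u ^+ 2)).
Proof.
move=> l0 dpsi; apply: itg_bounded.
- exact: measurable_cosM.
- by move=> u; exact: normr_cos_le1.
- exact: itg_dominated dpsi.
Qed.

Lemma itg_sinM_dominated l c psi s : 0 < l -> dominated l psi ->
  itg (fun u => sin (c * u) * psi (s - u ^+ 2)).
Proof.
move=> l0 dpsi; apply: itg_bounded.
- exact: measurable_sinM.
- by move=> u; exact: normr_sin_le1.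
- exact: itg_dominated dpsi.
Qed.

Lemma powR_half s : 0 <= s -> s `^ 2^-1 = Num.sqrt s.
Proof. exact: powR12_sqrt. Qed.

Lemma powRDp x a b : 0 < x -> x `^ (a + b) = x `^ a * x `^ b :> R.
Proof. by move=> x0; rewrite powRD// (gt_eqF x0) implybT. Qed.

Lemma VopZ k l c psi s : 0 < l -> dominated l psi ->
  Vop c (fun x => k * psi x) s = k * Vop c psi s.
Proof.
move=> l0 dpsi; rewrite /Vop -intRZ; last exact: itg_cosM_dominated dpsi.
by apply: eq_Rintegral => u _; rewrite mulrCA.
Qed.

Lemma Vop_neg c l s : 0 < l -> s <= 0 -> Vop c (pospow l) s = 0.
Proof.
move=> l0 s0; rewrite /Vop [LHS](_ : _ = intR (fun=> 0)).
  by rewrite Rintegral_cst// mul0r.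
apply: eq_Rintegral => u _; rewrite pospow_neg ?mulr0//.
by rewrite subr_le0 (le_trans s0)// sqr_ge0.
Qed.

Lemma Vop_scale c l s : 0 < l -> 0 < s ->
  Vop c (pospow l) s = s `^ (l + 2^-1) * Vop (c * Num.sqrt s) (pospow l) 1.
Proof.
move=> l0 s0; have r0 : 0 < Num.sqrt s by rewrite sqrtr_gt0.
have fE := intR_affine 0 (lt0r_neq0 r0)
  (itg_cosM_dominated c s l0 (dominated_pospow l)).
rewrite (gtr0_norm r0) in fE.
rewrite [LHS]/Vop -[LHS](mulVKf (lt0r_neq0 r0)) -fE (powRDp _ _ s0).
rewrite (powR_half (ltW s0)) mulrAC [RHS]mulrC; congr (_ * _).
rewrite -intRZ; last exact: itg_cosM_dominated (dominated_pospow l).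
apply: eq_Rintegral => u _; rewrite addr0 mulrA mulrCA -pospowM//.
congr (_ * pospow _ _).
by rewrite exprMn sqr_sqrtr ?(ltW s0)// mulrBr mulr1.
Qed.

(** The Beta integral of [(1 - u^2)^l] over [[-1, 1]]. Its value is never computed: the same product
    of such factors appears for the kernel and for the Gaussian. *)
Definition cpow l := Vop 0 (pospow l) 1.

Lemma cpow_ge0 l : 0 <= cpow l.
Proof.
apply: Rintegral_ge0 => u _.
by rewrite mul0r cos0 mul1r pospow_ge0.
Qed.

Lemma Vop0 l s : 0 < l -> Vop 0 (pospow l) s = cpow l * pospow (l + 2^-1) s.
Proof.
move=> l0; have l20 : 0 < l + 2^-1 by rewrite addr_gt0.
have [s0|s0] := leP s 0; first by rewrite Vop_neg// pospow_neg// mulr0.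
by rewrite Vop_scale// mul0r mulrC pospow_pos// ltW.
Qed.

Lemma intR_pospow l s : 0 < l ->
  intR (fun u => pospow l (s - u ^+ 2)) = cpow l * pospow (l + 2^-1) s.
Proof.
move=> l0; rewrite -Vop0//; apply: eq_Rintegral => u _.
by rewrite mul0r cos0 mul1r.
Qed.

Lemma dominated_Vop l c psi : 0 < l -> dominated l psi ->
  dominated (l + 2^-1) (Vop c psi).
Proof.
move=> l0 dpsi; have [mpsi [C psiC]] := dpsi; split.
  apply: (measurable_intR (f := fun s u => cos (c * u) * psi (s - u ^+ 2))).
  apply: measurable_funM.
    apply: (measurable_compR (measurable_cosM c)); exact: measurable_snd.
  apply: (measurable_compR mpsi); apply: measurable_funB => //.
  by apply: measurable_funX.
exists (C * cpow l) => s; rewrite -mulrA -intR_pospow// -intRZ; last exact: itg_pospow.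
apply: normr_intR_le.
- exact: itg_cosM_dominated dpsi.
- exact/itgZ/itg_pospow.
move=> u; apply: le_trans (psiC _).
by rewrite normrM ler_piMl// normr_cos_le1.
Qed.

Lemma VopN c psi s : Vop (- c) psi s = Vop c psi s.
Proof. by apply: eq_Rintegral => u _; rewrite mulNr cosN. Qed.

Lemma Vop_norm c psi s : Vop `|c| psi s = Vop c psi s.
Proof. by case: (ger0P c) => // _; rewrite VopN. Qed.

Let rot_quadratic a b r s u p : b != 0 -> r != 0 -> r ^+ 2 = a ^+ 2 + b ^+ 2 ->
  s - u ^+ 2 - ((p - a * u) / b) ^+ 2 =
  s - (r^-1 * p + 0) ^+ 2 - (r / b * u + - (a * p) / (r * b)) ^+ 2.
Proof.
move=> b0 r0 rE.
(* The difference of the two sides is a multiple of [r^2 - (a^2 + b^2)]. *)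
apply/eqP; rewrite -subr_eq0 (_ : _ - _ =
  (r ^+ 2 - (a ^+ 2 + b ^+ 2)) * (u ^+ 2 / b ^+ 2 - p ^+ 2 / (b ^+ 2 * r ^+ 2))).
  by rewrite rE subrr mul0r.
by field; rewrite r0 b0.
Qed.

(* With [p = a u + b v] and [q = (r u - a p / r) / b], the form [u^2 + v^2]
   becomes [p^2 / r^2 + q^2]; both substitutions are affine in one variable. *)
Lemma Vop_rot a b l s : 0 < l ->
  Vop a (Vop b (pospow l)) s =
  Vop (Num.sqrt (a ^+ 2 + b ^+ 2)) (Vop 0 (pospow l)) s.
Proof.
(* The substitution divides by [b]; for [b = 0] the frequencies are already in the rotated
   position. *)
move=> l0; have [->|b0] := eqVneq b 0.
  by rewrite expr0n addr0 sqrtr_sqr Vop_norm.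
set r := Num.sqrt _.
have ab0 : 0 < a ^+ 2 + b ^+ 2 by rewrite ltr_wpDl ?sqr_ge0// exprn_even_gt0.
have r0 : 0 < r by rewrite sqrtr_gt0.
have rE : r ^+ 2 = a ^+ 2 + b ^+ 2 by rewrite sqr_sqrtr// ltW.
have r_neq0 := lt0r_neq0 r0.
have dP := dominated_pospow l.
have l20 : 0 < l + 2^-1 by rewrite addr_gt0.
pose f u p := cos p * pospow l (s - u ^+ 2 - ((p - a * u) / b) ^+ 2).
pose g u v := cos (a * u + b * v) * pospow l (s - u ^+ 2 - v ^+ 2).
have g_ u : itg (g u).
  apply: itg_bounded; last exact: itg_pospow.
    apply: (measurable_compR measurable_cos).
    by apply: measurable_funD => //; exact: measurable_funM.
  by move=> v; exact: normr_cos_le1.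
have ib0 : b^-1 != 0 by rewrite invr_eq0.
have fg u p : f u p = g u (b^-1 * p + (- (a * u) / b)).
  rewrite /f /g; congr (cos _ * pospow _ (_ - _ ^+ 2)); field => //.
have f_ u : itg (f u).
  have := itg_affine (- (a * u) / b) ib0 (g_ u).
  by rewrite /itg; congr (mu.-integrable _ _); apply/funext => p /=; rewrite fg.
have fgI u : intR (f u) = `|b| * intR (g u).
  rewrite -[X in X * _]invrK -normfV -(intR_affine (- (a * u) / b) ib0 (g_ u)).
  by apply: eq_Rintegral => p _; exact: fg.
have gI u : intR (g u) = cos (a * u) * Vop b (pospow l) (s - u ^+ 2).
  have cc := itg_cosM_dominated b (s - u ^+ 2) l0 dP.
  have ss := itg_sinM_dominated b (s - u ^+ 2) l0 dP.
  transitivity (intR (fun v => cos (a * u) * (cos (b * v) * pospow l (s - u ^+ 2 - v ^+ 2)) +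
     (- sin (a * u)) * (sin (b * v) * pospow l (s - u ^+ 2 - v ^+ 2)))).
    by apply: eq_Rintegral => v _; rewrite /g cosD; ring.
  rewrite intRD; [|exact: itgZ|exact: itgZ].
  rewrite !intRZ// (intR_odd ss) ?mulr0 ?addr0//.
  by move=> v; rewrite mulrN sinN sqrrN mulNr.
have normfI u : intR (fun p => `|f u p|) <= `|b| * (cpow l * pospow (l + 2^-1) (s - u ^+ 2)).
  rewrite -intR_pospow//.
  have := intR_affine (- (a * u) / b) ib0 (itg_pospow (s - u ^+ 2) l0).
  rewrite normfV invrK => <-; apply: le_intR.
  - exact/itg_norm/f_.
  - exact: (itg_affine _ ib0 (itg_pospow (s - u ^+ 2) l0)).
  move=> p; rewrite fg /g normrM (ger0_norm (pospow_ge0 _ _)).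
  by rewrite ler_piMl ?pospow_ge0// normr_cos_le1.
have mf : measurable_fun setT (fun p : R * R => f p.1 p.2).
  apply: measurable_funM.
    by apply: (measurable_compR measurable_cos); exact: measurable_snd.
  apply: (measurable_compR (measurable_pospow l)).
  apply: measurable_funB.
    by apply: measurable_funB => //; apply: measurable_funX.
  apply: measurable_funX; apply: measurable_funM => //.
  by apply: measurable_funB => //; apply: measurable_funM.
have [_ _ fub] := fubiniR mf f_ (itgZ `|b| (itgZ (cpow l) (itg_pospow s l20))) normfI.
have nb0 : `|b| != 0 by rewrite normr_eq0.
transitivity (`|b|^-1 * intR (fun u => intR (f u))).
  rewrite /Vop (_ : intR (fun u => intR (f u)) =
      intR (fun u => `|b| * (cos (a * u) * Vop b (pospow l) (s - u ^+ 2)))).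
    rewrite intRZ; first by rewrite (mulKf nb0).
    exact: (itg_cosM_dominated a s l20 (dominated_Vop b l0 dP)).
  by apply: eq_Rintegral => u _; rewrite fgI gI.
rewrite fub.
have inner p : intR (f^~ p) =
    `|b| / r * (cos p * Vop 0 (pospow l) (s - (r^-1 * p + 0) ^+ 2)).
  have rb0 : r / b != 0 by rewrite mulf_neq0.
  rewrite (Vop0 _ l0) -(intR_pospow _ l0).
  have := intR_affine (- (a * p) / (r * b)) rb0 (itg_pospow (s - (r^-1 * p + 0) ^+ 2) l0).
  rewrite normf_div invf_div (gtr0_norm r0) => e.
  rewrite mulrCA -e -intRZ; last exact: (itg_affine _ rb0 (itg_pospow _ l0)).
  apply: eq_Rintegral => u _; rewrite /f; congr (_ * pospow _ _).
  exact: rot_quadratic.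
pose G u := cos (r * u) * Vop 0 (pospow l) (s - u ^+ 2).
have G_ : itg G := itg_cosM_dominated r s l20 (dominated_Vop 0 l0 dP).
have ir0 : r^-1 != 0 by rewrite invr_eq0.
have -> : intR (fun p => intR (f^~ p)) =
    intR (fun p => `|b| / r * G (r^-1 * p + 0)).
  apply: eq_Rintegral => p _; rewrite inner /G; congr (_ * (cos _ * _)).
  by rewrite addr0 mulVKf.
rewrite intRZ; last exact: itg_affine.
rewrite (intR_affine 0 ir0 G_) normfV invrK (gtr0_norm r0).
by rewrite -mulrA (mulKf r_neq0) (mulKf nb0).
Qed.

Fixpoint Viter (xs : seq R) psi : R -> R :=
  if xs is x :: xs' then Vop x (Viter xs' psi) else psi.

Lemma dominated_Viter l xs psi : 0 < l -> dominated l psi ->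
  dominated (l + (size xs)%:R / 2) (Viter xs psi).
Proof.
move=> l0 dpsi; elim: xs => [|x xs IH] /=; first by rewrite mul0r addr0.
rewrite -natr1 mulrDl mul1r addrA.
by apply: dominated_Vop IH; rewrite ltr_wpDr// divr_ge0.
Qed.

Definition cpows l n := \prod_(j < n) cpow (l + j%:R / 2).

Lemma eq_Vop c psi phi s : psi =1 phi -> Vop c psi s = Vop c phi s.
Proof. by move=> e; apply: eq_Rintegral => u _; rewrite e. Qed.

Lemma sumsq_ge0 (xs : seq R) : 0 <= \sum_(y <- xs) y ^+ 2.
Proof. by rewrite sumr_ge0// => y _; exact: sqr_ge0. Qed.

(** By induction the inner frequencies are gathered into one. [Vop_rot] replaces the remaining pair
    by its Euclidean norm and 0, and the transform at frequency 0 only raises the exponent by 1/2 at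
    the cost of one factor [cpow]. *)
Lemma Viter_rot l x xs : 0 < l -> Viter (x :: xs) (pospow l) =1
  (fun s => cpows l (size xs) *
    Vop (Num.sqrt (\sum_(y <- x :: xs) y ^+ 2)) (pospow (l + (size xs)%:R / 2)) s).
Proof.
move=> l0; elim: xs x => [|y xs IH] x s /=.
  rewrite /cpows big_ord0 mul1r big_seq1 sqrtr_sqr mul0r addr0.
  by rewrite Vop_norm.
have ln0 : 0 < l + (size xs)%:R / 2 by rewrite ltr_wpDr// divr_ge0.
have ln0' : 0 < l + (size xs)%:R / 2 + 2^-1 by rewrite addr_gt0.
have dP := dominated_pospow (l + (size xs)%:R / 2).
rewrite (eq_Vop _ _ (IH y)) (VopZ _ _ _ ln0' (dominated_Vop _ ln0 dP)).
rewrite Vop_rot// (eq_Vop _ _ (fun s => Vop0 s ln0)).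
rewrite (VopZ _ _ _ ln0' (dominated_pospow _)) mulrA /cpows big_ord_recr /=.
rewrite -[(size xs).+1%:R]natr1 mulrDl mul1r addrA (sqr_sqrtr (sumsq_ge0 _)).
by rewrite [in RHS]big_cons.
Qed.

End pospow.

(** * Derivatives and the fundamental theorem on a half-line *)

Section derivatives.
Context {R : realType}.
Implicit Types (a b c l r s u v w x y z : R) (f g df : R -> R).

Definition drv f x a := is_derive (x : R^o) (1 : R^o) (f : R^o -> R^o) a.

Lemma drv_eq f x a b : drv f x a -> a = b -> drv f x b.
Proof. by move=> + <-. Qed.

Lemma drvD f g x a b : drv f x a -> drv g x b ->
  drv (fun y => f y + g y) x (a + b).
Proof. exact: is_deriveD. Qed.

Lemma drvM f g x a b : drv f x a -> drv g x b ->
  drv (fun y => f y * g y) x (a * g x + f x * b).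
Proof.
move=> fx gx; have := is_deriveM fx gx.
by move/drv_eq; apply; rewrite /GRing.scale/= addrC mulrC.
Qed.

Lemma drv_cst c x : drv (fun=> c) x 0.
Proof. exact: is_derive_cst. Qed.

Lemma drv_id x : drv (fun y => y) x 1.
Proof. exact: is_derive_id. Qed.

Lemma drvZ c f x a : drv f x a -> drv (fun y => c * f y) x (c * a).
Proof.
move=> fx; apply: (drv_eq (drvM (drv_cst c x) fx)).
by rewrite mul0r add0r.
Qed.

Lemma drv_comp f g x a b : drv f (g x) a -> drv g x b ->
  drv (fun y => f (g y)) x (a * b).
Proof. exact: is_derive1_comp. Qed.

Lemma drv_sqr x : drv (fun y => y ^+ 2) x (2 * x).
Proof.
have /drv_eq -/(_ (2 * x)) := drvM (drv_id x) (drv_id x).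
by rewrite mul1r mulr1 mulr_natl mulr2n; apply.
Qed.

Lemma drv_near f g x a : (\forall y \near x, f y = g y) -> drv f x a ->
  drv g x a.
Proof. exact: near_eq_is_derive. Qed.

Lemma drv_unique f x a b : drv f x a -> drv f x b -> a = b.
Proof. by move=> fa fb; rewrite -(@derive_val _ _ _ _ _ _ _ fa) -(@derive_val _ _ _ _ _ _ _ fb). Qed.

Lemma drv_continuous f x a : drv f x a -> {for x, continuous f}.
Proof. by move=> fx; apply/differentiable_continuous/derivable1_diffP; case: fx. Qed.

(** Increments [1 / (n + 1)] are used because dominated convergence is applied along sequences. *)
Lemma drv_quotient_cvg f x a : drv f x a ->
  n.+1%:R * (f (x + n.+1%:R^-1) - f x) @[n --> \oo] --> a.
Proof.
move=> /is_derive1_caratheodory[g [fg cg <-]].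
rewrite (_ : (fun n => _) = (fun n : nat => g (x + n.+1%:R^-1))); last first.
  apply/funext => n; rewrite fg addrAC subrr add0r mulrCA divff ?mulr1//.
have cx : x + n.+1%:R^-1 @[n --> \oo] --> x.
  rewrite -[X in _ --> X]addr0.
  by apply: cvgD; [exact: cvg_cst|exact: cvg_harmonic].
exact: (cvg_comp _ _ cx cg).
Qed.

Lemma mvt f df a b : a < b -> (forall x, a <= x -> x <= b -> drv f x (df x)) ->
  exists2 c, a < c < b & f b - f a = df c * (b - a).
Proof.
move=> ab fdf.
have [||c cab e] := @MVT R f df a b ab.
- by move=> x; rewrite in_itv/= => /andP[ax xb]; apply: fdf; exact: ltW.
- apply: derivable_within_continuous => x.
  by rewrite in_itv/= => /andP[ax xb]; have [] := fdf x ax xb.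
by exists c => //; rewrite in_itv/= in cab.
Qed.

(** Half-line integrals are written over the whole line, so that one Fubini theorem and one
    substitution rule serve for all of them. *)
Definition above w f u := if w < u then f u else 0.

Lemma measurable_above w f : (forall u, w < u -> {for u, continuous f}) ->
  measurable_fun setT (above w f).
Proof.
move=> cf.
have mD : measurable (`]w, +oo[%classic : set R) by [].
have : measurable_fun `]w, +oo[%classic f.
  apply: open_continuous_measurable_fun; first exact: interval_open.
  by move=> u; rewrite inE/= in_itv/= andbT => /cf.
move/(measurable_restrictT f mD); congr (measurable_fun _ _).
apply/funext => u; rewrite patchE /above.
by rewrite mem_setE in_itv/= andbT.
Qed.

Lemma aboveM w f g u : above w (fun x => f x * g x) u = above w f u * g u.
Proof. by rewrite /above; case: ifP => // _; rewrite mul0r. Qed.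

End derivatives.

Section half_line_ftc.
Context {R : realType}.
Local Notation mu := (@lebesgue_measure R).
Local Notation intR f := (Rintegral mu setT f).
Implicit Types (a b c l r s u v w x y z : R) (f g df : R -> R).

Lemma oneDsqr_pos u : 0 < 1 + u ^+ 2.
Proof. by rewrite ltr_pwDl// sqr_ge0. Qed.

Let oneDsqr_gt0 u : 0 < 1 + u ^+ 2 := oneDsqr_pos u.

Let shift_bound C u v : 0 <= C -> u <= v <= u + 1 ->
  C / (1 + v ^+ 2) <= C * 3 / (1 + u ^+ 2).
Proof.
move=> C0 /andP[uv vu]; rewrite -mulrA ler_wpM2l// -[leLHS]mul1r.
rewrite ler_pdivlMr// mulrAC ler_pdivrMr// mul1r.
have : 0 <= (v - u) * (u + 1 - v) by rewrite mulr_ge0 ?subr_ge0.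
(* This is [u^2 <= 2 v^2 + 2 (v - u)^2]; with [|v - u| <= 1] it gives [1 + u^2 <= 3 (1 + v^2)],
   hence the constant 3. *)
have : 0 <= (v + (v - u)) ^+ 2 by exact: sqr_ge0.
have : (v - u) ^+ 2 <= 1 by rewrite sqr_ge0 || rewrite expr_le1 ?subr_ge0// lerBlDl.
nra.
Qed.

(** The derivative is not assumed continuous, since the last derivative of [eta] need not be.
    Difference quotients converge to [df] and, by the mean value theorem, inherit its bound, so
    dominated convergence applies. Their integrals are minus the averages of [f] over
    [(w, w + d n)], which tend to [- f w]. *)
Lemma ftc_half_bnd w f df C : (forall u, w <= u -> drv f u (df u)) ->
  (forall u, w <= u -> `|f u| <= C / (1 + u ^+ 2)) ->
  (forall u, w <= u -> `|df u| <= C / (1 + u ^+ 2)) ->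
  itg (above w df) /\ intR (above w df) = - f w.
Proof.
move=> fdf fC dfC.
have C0 : 0 <= C.
  have := le_trans (normr_ge0 _) (fC w (lexx w)).
  by rewrite pmulr_lge0// invr_gt0.
have mf : measurable_fun setT (above w f).
  by apply: measurable_above => u /ltW/fdf/drv_continuous.
have f_ : itg (above w f).
  apply: (itg_oneDsqrP (C := C)) => // u; rewrite /above; case: ifP => [/ltW/fC//|_].
  by rewrite normr0 divr_ge0// ltW.
pose d (n : nat) : R := n.+1%:R^-1.
have d0 n : 0 < d n by rewrite invr_gt0.
have d1 n : d n <= 1 by rewrite invf_le1// ler1n.
have dK n : n.+1%:R * d n = 1 by rewrite divff// pnatr_eq0.
pose fd n u := f (u + d n).
have fd_ n : itg (above w (fd n)).
  apply: (itg_oneDsqrP (C := C * 3)) => [|u].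
    apply: measurable_above => u wu.
    have wud : w <= u + d n by rewrite ltW// ltr_wpDr// ltW.
    exact: drv_continuous (drv_comp (g := fun u => u + d n) (fdf _ wud)
      (drvD (drv_id u) (drv_cst (d n) u))).
  rewrite /above; case: ifP => [wu|_]; last first.
    by rewrite normr0 !(divr_ge0, mulr_ge0)// ltW.
  apply: le_trans (fC _ _) _; first by rewrite (le_trans (ltW wu))// lerDl ltW.
  by apply: shift_bound => //; rewrite lerDl (ltW (d0 n)) lerD2l d1.
pose q n u := n.+1%:R * (above w (fd n) u + (-1) * above w f u).
have q_ n : itg (q n) by apply: itgZ; apply: itgD => //; exact: itgZ.
have [] := @dominated_cvgR R q (above w df) (fun u => C * 3 / (1 + u ^+ 2)).
- by move=> n; exact: itg_measurable.
- exact: itgZ itg_oneDsqrV.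
- move=> n u; rewrite /q /above; case: ifP => [wu|_]; last first.
    by rewrite mulr0 addr0 mulr0 normr0 !(divr_ge0, mulr_ge0)// ltW.
  rewrite mulN1r /fd.
  have udu : u < u + d n by rewrite ltrDl.
  have [z zW|c /andP[uc cu] ->] := @mvt R f df u (u + d n) udu.
    by move=> _; apply: fdf; exact: le_trans (ltW wu) zW.
  rewrite addrAC subrr add0r mulrCA dK mulr1.
  apply: le_trans (dfC _ _) _; first by rewrite (le_trans (ltW wu))// ltW.
  apply: shift_bound => //; rewrite (ltW uc) (le_trans (ltW cu))// lerD2l.
  exact: d1.
- move=> u; rewrite /q /above; case: ifP => [wu|_]; last first.
    rewrite mulr0 addr0; under eq_fun do rewrite mulr0.
    exact: cvg_cst.
  under eq_fun do rewrite mulN1r.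
  exact: drv_quotient_cvg (fdf u (ltW wu)).
move=> df_ lim1; split => //.
pose box (s : R) : R := if 0 < s <= 1 then 1 else 0.
have [box_ Ibox] := @itg_box R.
(* Shifting the first term by [d n] cancels everything beyond [w + d n]; the remaining interval is
   rescaled to [(0, 1]]. *)
have qI n : intR (q n) = intR (fun s => (- 1) * (box s * above w f (d n * s + w))).
  rewrite intRZ; last by apply: itgD => //; exact: itgZ.
  rewrite intRD//; last exact: itgZ.
  rewrite intRZ//.
  have dn0 : d n != 0 by rewrite gt_eqF.
  have n1 : (1 : R) != 0 by rewrite oner_eq0.
  pose F u := (if w + d n < u then f u else 0) + (-1) * above w f u.
  have F1_ : itg (fun u => if w + d n < u then f u else 0).
    have := itg_affine (- d n) n1 (fd_ n); rewrite /itg.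
    congr (mu.-integrable _ _); apply/funext => u /=; congr EFin.
    by rewrite /above mul1r ltrBrDr /fd subrK.
  have F_ : itg F by apply: itgD => //; exact: itgZ.
  have -> : intR (above w (fd n)) = intR (fun u => if w + d n < u then f u else 0).
    have := intR_affine (- d n) n1 (fd_ n); rewrite normr1 invr1 mul1r => <-.
    by apply: eq_Rintegral => u _; rewrite /above mul1r ltrBrDr /fd subrK.
  rewrite -(intRZ (-1) f_) -intRD//; last exact: itgZ.
  have := intR_affine w dn0 F_; rewrite (gtr0_norm (d0 n)) invrK => <-.
  apply: eq_Rintegral => s _; rewrite /F /above /box.
  rewrite (addrC (d n * s)) ltrD2l -[ltLHS]mulr1 (ltr_pM2l (d0 n)) ltrDl.
  rewrite (pmulr_rgt0 _ (d0 n)).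
  by case: (ltP 0 s) => s0; case: (ltP 1 s) => s1 /=; lra.
have [] := @dominated_cvgR R
    (fun n s => (- 1) * (box s * above w f (d n * s + w)))
    (fun s => (- 1) * (box s * f w)) (fun s => C * box s).
- move=> n; apply: measurable_funM => //; apply: measurable_funM.
    exact: itg_measurable box_.
  exact: itg_measurable (itg_affine w (lt0r_neq0 (d0 n)) f_).
- exact: itgZ.
- move=> n s; rewrite mulN1r normrN /box; case: ifP => [/andP[s0 s1]|_]; last first.
    by rewrite mul0r normr0 mulr0.
  rewrite mul1r mulr1 /above; case: ifP => [/ltW wu|_]; last by rewrite normr0.
  apply: le_trans (fC _ wu) _; rewrite ler_pdivrMr// ler_peMr// lerDl.
  exact: sqr_ge0.
- move=> s; rewrite /box; case: ifP => [/andP[s0 s1]|_]; last first.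
    under eq_fun do rewrite mul0r.
    by rewrite mul0r; exact: cvg_cst.
  apply: cvgM; first exact: cvg_cst.
  apply: cvgM; first exact: cvg_cst.
  rewrite /above; under eq_fun => n do rewrite ltrDr (mulr_gt0 (d0 n) s0).
  have dw : d n * s + w @[n --> \oo] --> w.
    rewrite -[X in _ --> X]add0r -[X in X + _](mul0r s).
    apply: cvgD; last exact: cvg_cst.
    by apply: cvgM; [exact: cvg_harmonic|exact: cvg_cst].
  exact: (cvg_comp _ _ dw (drv_continuous (fdf w (lexx w)))).
move=> _ lim2.
have IboxE : intR (fun s => (- 1) * (box s * f w)) = - f w.
  rewrite intRZ; last first.
    have := itgZ (f w) box_; rewrite /itg; congr (mu.-integrable _ _).
    by apply/funext => s /=; rewrite mulrC.
  rewrite mulN1r (_ : intR _ = intR (fun s => f w * box s)).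
    by rewrite intRZ// Ibox mulr1.
  by apply: eq_Rintegral => s _; rewrite mulrC.
rewrite IboxE in lim2.
have lim3 : intR (q n) @[n --> \oo] --> - f w.
  by under eq_fun do rewrite qI.
exact: cvg_unique lim1 lim3.
Qed.

Definition qdecay w f := exists C, forall u, w <= u -> `|f u| <= C / (1 + u ^+ 2).

Lemma qdecayD w f g : qdecay w f -> qdecay w g -> qdecay w (fun u => f u + g u).
Proof.
move=> [C fC] [D gD]; exists (C + D) => u wu; rewrite mulrDl.
exact: le_trans (ler_normD _ _) (lerD (fC u wu) (gD u wu)).
Qed.

Lemma qdecayZ w c f : qdecay w f -> qdecay w (fun u => c * f u).
Proof.
by move=> [C fC]; exists (`|c| * C) => u wu; rewrite normrM -mulrA ler_wpM2l// fC.
Qed.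

Lemma eq_qdecay w f g : f =1 g -> qdecay w f -> qdecay w g.
Proof. by move=> fg [C fC]; exists C => u wu; rewrite -fg fC. Qed.

Lemma ftc_half w f df : (forall u, w <= u -> drv f u (df u)) ->
  qdecay w f -> qdecay w df -> itg (above w df) /\ intR (above w df) = - f w.
Proof.
move=> fdf [C fC] [D dfD]; apply: (ftc_half_bnd (C := `|C| + `|D|)) => // u wu.
  apply: le_trans (fC u wu) _; rewrite ler_wpM2r ?invr_ge0 ?(ltW (oneDsqr_gt0 _))//.
  by rewrite (le_trans (ler_norm _))// lerDl.
apply: le_trans (dfD u wu) _; rewrite ler_wpM2r ?invr_ge0 ?(ltW (oneDsqr_gt0 _))//.
by rewrite (le_trans (ler_norm _))// lerDr.
Qed.

End half_line_ftc.

(** * Decay of the cosine transform *)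

Section decay.
Context {R : realType}.
Local Notation mu := (@lebesgue_measure R).
Local Notation intR f := (Rintegral mu setT f).
Implicit Types (a b c e h k l p q r s u v w x y z : R) (f g df : R -> R).

Lemma powR_subadd x y l : 0 <= x -> 0 <= y -> 0 < l <= 1 ->
  (x + y) `^ l <= x `^ l + y `^ l.
Proof.
move=> x0 y0 /andP[l0 l1].
have [xy0|xy0] := eqVneq (x + y) 0.
  by rewrite xy0 powR0 ?gt_eqF// addr_ge0// powR_ge0.
have xy : 0 < x + y by rewrite lt0r xy0 addr_ge0.
(* A ratio in [[0, 1]] is at most its power of order [l <= 1]; the cases [z = x] and [z = y] add up
   to the claim. *)
have key z : 0 <= z -> z <= x + y -> (x + y) `^ l * (z / (x + y)) <= z `^ l.
  move=> z0 zxy; have -> : z `^ l = (x + y) `^ l * (z / (x + y)) `^ l.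
    by rewrite -powRM ?divr_ge0 ?(ltW xy)// mulrCA divff// mulr1.
  rewrite ler_wpM2l ?powR_ge0//; move: z0; rewrite le_eqVlt => /predU1P[<-|z0].
    by rewrite mul0r powR_ge0.
  by rewrite ger1_powR// divr_gt0//= ler_pdivrMr// mul1r.
apply: le_trans (lerD (key _ x0 _) (key _ y0 _)); last 2 first.
  by rewrite lerDl.
  by rewrite lerDr.
by rewrite -mulrDr -mulrDl divff// mulr1.
Qed.

Lemma pospow_holder l a b : 0 < l <= 1 ->
  `|pospow l a - pospow l b| <= `|a - b| `^ l.
Proof.
move=> l01; have /andP[l0 l1] := l01; wlog ab : a b / b <= a.
  move=> H; have [|/ltW] := leP b a; first exact: H.
  by move=> /H; rewrite distrC [X in X `^ _]distrC.
rewrite ger0_norm ?subr_ge0 ?ler_pospow// ger0_norm ?subr_ge0//.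
rewrite lerBlDr; have [b0|/ltW b0] := leP b 0.
  rewrite [X in _ + X]pospow_neg// addr0; have [a0|/ltW a0] := leP a 0.
    by rewrite pospow_neg// powR_ge0.
  by rewrite pospow_pos// ge0_ler_powR ?nnegrE ?subr_ge0 ?(ltW l0)//; lra.
rewrite !pospow_pos//; last exact: le_trans b0 ab.
by apply: le_trans (powR_subadd _ _ l01); rewrite ?subrK ?subr_ge0.
Qed.

Lemma cvg_pospow0 l : 0 < l -> {for 0, continuous (pospow l : R -> R)}.
Proof.
move=> l0; apply/cvgrPdist_lt => e e0; rewrite (pospow_neg l0 (lexx 0)).
have d0 : 0 < e `^ l^-1 by rewrite powR_gt0.
near=> z; rewrite sub0r normrN ger0_norm ?pospow_ge0//.
have [z0|z0] := leP z 0; first by rewrite pospow_neg.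
rewrite pospow_pos ?(ltW z0)//.
have -> : e = (e `^ l^-1) `^ l.
  by rewrite -powRrM mulVf ?gt_eqF// powRr1 ?(ltW e0).
rewrite gt0_ltr_powR ?nnegrE ?(ltW z0) ?(ltW d0)//.
rewrite -[ltLHS](gtr0_norm z0) -[z]subr0 distrC; near: z.
by apply/nbhs_normP; exists (e `^ l^-1).
Unshelve. all: by end_near. Qed.

Lemma pospow_mul l s : 1 < l -> s * pospow (l - 1) s = pospow l s.
Proof.
move=> l1; have [s0|s0] := leP s 0.
  by rewrite !pospow_neg ?mulr0//; lra.
by rewrite !pospow_pos ?(ltW s0)// mulr_powRB1 ?(ltW s0)//; lra.
Qed.

Lemma drv_pospow l s : 1 < l -> drv (pospow l) s (l * pospow (l - 1) s).
Proof.
move=> l1; have l0 : 0 < l by lra.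
have l10 : 0 < l - 1 by lra.
have [s0|s0|->] := ltgtP s 0.
- rewrite pospow_neg ?(ltW s0)// mulr0.
  apply: drv_near (drv_cst 0 s).
  near=> z; rewrite pospow_neg// ltW//; near: z; exact: lt_nbhsl.
- rewrite pospow_pos ?(ltW s0)//.
  apply: drv_near (is_derive1_powR l s0).
  near=> z; rewrite pospow_pos// ltW//; near: z; exact: lt_nbhsr.
rewrite (pospow_neg l10 (lexx 0)) mulr0.
(* At the kink the slope function is [pospow (l - 1)] itself, continuous at 0 because [l > 1]. *)
apply/is_derive1_caratheodory; exists (pospow (l - 1)); split.
- by move=> z; rewrite (pospow_neg l0 (lexx 0)) !subr0 mulrC pospow_mul.
- exact: cvg_pospow0.
- by rewrite pospow_neg.
Unshelve. all: by end_near. Qed.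

Lemma pospow_le1 l u : 0 < l -> pospow l (1 - u ^+ 2) <= 1.
Proof.
move=> l0; apply: le_trans (ler_pospow l0 (_ : _ <= 1)) _.
  by rewrite gerBl sqr_ge0.
by rewrite pospow_pos// powR1.
Qed.

Lemma pospow_supp l u : 0 < l -> 1 <= u ^+ 2 -> pospow l (1 - u ^+ 2) = 0.
Proof. by move=> l0 u1; rewrite pospow_neg// subr_le0. Qed.

Lemma normr_supp g l u : 0 < l -> (forall v, v ^+ 2 <= 1 -> `|g v| <= 1) ->
  `|g u * pospow l (1 - u ^+ 2)| <= 2 / (1 + u ^+ 2).
Proof.
move=> l0 g1; have u0 : 0 < 1 + u ^+ 2 by rewrite ltr_pwDl ?sqr_ge0.
have [u1|/ltW u1] := leP 1 (u ^+ 2).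
  by rewrite pospow_supp// mulr0 normr0 divr_ge0// ltW.
rewrite normrM (ger0_norm (pospow_ge0 _ _)).
apply: (@le_trans _ _ 1).
  by rewrite -[leRHS]mulr1 ler_pM ?pospow_ge0 ?g1// pospow_le1.
by rewrite ler_pdivlMr// mul1r; lra.
Qed.

Lemma normr_le1_sqr v : v ^+ 2 <= 1 -> `|v| <= 1.
Proof. by move=> v1; rewrite -(@expr_le1 _ 2)// -normrX ger0_norm ?sqr_ge0. Qed.

Lemma itg_supp g l : 0 < l -> measurable_fun setT g ->
  (forall v, v ^+ 2 <= 1 -> `|g v| <= 1) ->
  itg (fun u => g u * pospow l (1 - u ^+ 2)).
Proof.
move=> l0 mg g1; apply: (itg_oneDsqrP (C := 2)).
  apply: measurable_funM => //; apply: measurable_sBsqr.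
  exact: measurable_pospow.
by move=> u; exact: normr_supp.
Qed.

(** Poisson's integral: for [r > 0], [Icos l r] is a constant multiple of
    [r^-(l + 1/2) J_(l + 1/2) (r)] with [J] the Bessel function, and [Isin l] is minus the
    derivative of [Icos l]. The pair is closed under integration by parts. *)
Definition Icos l r := Vop r (pospow l) 1.
Definition Isin l r := intR (fun u => sin (r * u) * u * pospow l (1 - u ^+ 2)).

Lemma itg_Icos l r : 0 < l -> itg (fun u => cos (r * u) * pospow l (1 - u ^+ 2)).
Proof. by move=> l0; exact: itg_cosM_dominated (dominated_pospow l). Qed.

Let sinM_le1 r v : v ^+ 2 <= 1 -> `|sin (r * v) * v| <= 1.
Proof.
move=> v1; rewrite normrM -[leRHS]mulr1.
by rewrite ler_pM ?normr_sin_le1// normr_le1_sqr.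
Qed.

Lemma itg_Isin l r : 0 < l ->
  itg (fun u => sin (r * u) * u * pospow l (1 - u ^+ 2)).
Proof.
move=> l0; apply: itg_supp => //; last exact: sinM_le1.
by apply: measurable_funM => //; exact: measurable_sinM.
Qed.

Lemma intR_deriv_supp f df : (forall u, drv f u (df u)) ->
  qdecay (-2) f -> qdecay (-2) df ->
  (forall u, 1 <= u ^+ 2 -> f u = 0 /\ df u = 0) -> intR df = 0.
Proof.
move=> fdf fC dfC f0.
(* The starting point -2 lies to the left of the support [[-1, 1]]. *)
have [_ e] := ftc_half (fun u _ => fdf u) fC dfC.
have [f20 _] : f (-2) = 0 /\ df (-2) = 0 by apply: f0; lra.
rewrite f20 oppr0 in e; rewrite -{}e; apply: eq_Rintegral => u _.
rewrite /above; case: ltP => // u2.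
by have [] := f0 u; nra.
Qed.

Lemma qdecay_supp w g l : 0 < l -> (forall v, v ^+ 2 <= 1 -> `|g v| <= 1) ->
  qdecay w (fun u => g u * pospow l (1 - u ^+ 2)).
Proof. by move=> l0 g1; exists 2 => u _; exact: normr_supp. Qed.

Let qdecay_cos w l r : 0 < l -> qdecay w (fun u => cos (r * u) * pospow l (1 - u ^+ 2)).
Proof. by move=> l0; apply: qdecay_supp => // v _; exact: normr_cos_le1. Qed.

Let qdecay_sin w l r : 0 < l -> qdecay w (fun u => sin (r * u) * pospow l (1 - u ^+ 2)).
Proof. by move=> l0; apply: qdecay_supp => // v _; exact: normr_sin_le1. Qed.

Let qdecay_sinM w l r : 0 < l ->
  qdecay w (fun u => sin (r * u) * u * pospow l (1 - u ^+ 2)).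
Proof. by move=> l0; apply: qdecay_supp => // v v1; exact: sinM_le1. Qed.

Let qdecay_cosM w l r : 0 < l ->
  qdecay w (fun u => cos (r * u) * u * pospow l (1 - u ^+ 2)).
Proof.
move=> l0; apply: qdecay_supp => // v v1; rewrite normrM -[leRHS]mulr1.
by rewrite ler_pM ?normr_cos_le1// normr_le1_sqr.
Qed.

Let drv_1Bsqr u : drv (fun y => 1 - y ^+ 2) u (- (2 * u)).
Proof.
have := drvD (drv_cst 1 u) (drvZ (-1) (drv_sqr u)).
rewrite /drv; congr is_derive; last by rewrite add0r mulN1r.
by apply/funext => y; rewrite mulN1r.
Qed.

Let drv_pospow_sqr l u : 1 < l ->
  drv (fun y => pospow l (1 - y ^+ 2)) u (- (2 * l) * (u * pospow (l - 1) (1 - u ^+ 2))).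
Proof.
move=> l1; apply: drv_eq (drv_comp (drv_pospow _ l1) (drv_1Bsqr u)) _.
ring.
Qed.

Let drv_cM (f : R -> R) (df : R -> R) r u : (forall y, drv f y (df y)) ->
  drv (fun y => f (r * y)) u (df (r * u) * r).
Proof.
move=> fdf; apply: drv_eq (drv_comp (fdf _) (drvZ r (drv_id u))) _.
by rewrite mulr1.
Qed.

(** Integration by parts: the derivative of [sin (r u) (1 - u^2)_+^l] has integral zero. *)
Lemma Icos_rec l r : 1 < l -> r * Icos l r = 2 * l * Isin (l - 1) r.
Proof.
move=> l1; have l0 : 0 < l by lra.
have l10 : 0 < l - 1 by lra.
pose F u := sin (r * u) * pospow l (1 - u ^+ 2).
pose dF u := r * (cos (r * u) * pospow l (1 - u ^+ 2)) +
  (- (2 * l)) * (sin (r * u) * u * pospow (l - 1) (1 - u ^+ 2)).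
have dFE u : drv F u (dF u).
  have := drvM (drv_cM r u (@is_derive_sin R)) (drv_pospow_sqr u l1).
  by move/drv_eq; apply; rewrite /dF; ring.
have : intR dF = 0.
  apply: (intR_deriv_supp dFE).
  - exact: qdecay_sin.
  - by apply: qdecayD; apply: qdecayZ; [exact: qdecay_cos|exact: qdecay_sinM].
  - by move=> u u1; rewrite /F /dF !pospow_supp//; split; ring.
rewrite /dF intRD; last 2 first.
  exact/itgZ/itg_Icos.
  exact/itgZ/itg_Isin.
rewrite intRZ; last exact: itg_Icos.
rewrite intRZ; last exact: itg_Isin.
rewrite -/(Isin _ _) -/(Vop _ _ _) -/(Icos _ _) mulNr => /eqP.
by rewrite subr_eq0 => /eqP.
Qed.

(** The derivative of [u cos (r u) (1 - u^2)_+^l] has integral zero; the factor [u^2] it produces is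
    written as [1 - (1 - u^2)], which restores the order [l]. *)
Lemma Isin_rec l r : 1 < l ->
  r * Isin l r = (1 + 2 * l) * Icos l r - 2 * l * Icos (l - 1) r.
Proof.
move=> l1; have l0 : 0 < l by lra.
have l10 : 0 < l - 1 by lra.
pose F u := (-1) * (cos (r * u) * u * pospow l (1 - u ^+ 2)).
pose dF u := r * (sin (r * u) * u * pospow l (1 - u ^+ 2)) +
  ((- (1 + 2 * l)) * (cos (r * u) * pospow l (1 - u ^+ 2)) +
   (2 * l) * (cos (r * u) * pospow (l - 1) (1 - u ^+ 2))).
have dFE u : drv F u (dF u).
  have := drvZ (-1) (drvM (drvM (drv_cM r u (@is_derive_cos R)) (drv_id u))
    (drv_pospow_sqr u l1)).
  move/drv_eq; apply; rewrite /dF -[pospow l _](pospow_mul _ l1); ring.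
have : intR dF = 0.
  apply: (intR_deriv_supp dFE).
  - exact/qdecayZ/qdecay_cosM.
  - apply: qdecayD; first exact/qdecayZ/qdecay_sinM.
    by apply: qdecayD; apply: qdecayZ; exact: qdecay_cos.
  - by move=> u u1; rewrite /F /dF !pospow_supp//; split; ring.
have i1 := itg_Icos r l0; have i2 := itg_Icos r l10; have i3 := itg_Isin r l0.
have i1' := itgZ (- (1 + 2 * l)) i1; have i2' := itgZ (2 * l) i2.
rewrite /dF (intRD (itgZ r i3) (itgD i1' i2')) (intRZ r i3) (intRD i1' i2').
rewrite (intRZ _ i1) (intRZ _ i2).
rewrite -/(Isin _ _) -!/(Vop _ _ _) -!/(Icos _ _); lra.
Qed.

(* Shifting by half a period changes the sign of the trigonometric factor, so
   that the integral is controlled by the modulus of continuity of [g]. *)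
Lemma half_period_bound (trig : R -> R) g r B : 0 < r ->
  measurable_fun setT trig -> (forall x, `|trig x| <= 1) ->
  (forall x, trig (x + pi) = - trig x) -> itg g ->
  (forall u, `|g u - g (u + pi / r)| <= B / (1 + u ^+ 2)) ->
  `|intR (fun u => trig (r * u) * g u)| <= B * intR (fun u => (1 + u ^+ 2)^-1).
Proof.
move=> r0 mt t1 tpi g_ gB.
pose G u := trig (r * u) * g u.
have mtr : measurable_fun setT (fun u => trig (r * u)).
  by apply: (measurable_compR mt); exact: measurable_funM.
have G_ : itg G by apply: itg_bounded.
have n1 : (1 : R) != 0 by rewrite oner_eq0.
pose h := pi / r.
have := intR_affine h n1 G_; rewrite normr1 invr1 mul1r => e.
have e2 : 2 * intR G = intR (fun u => G u + G (1 * u + h)).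
  rewrite intRD//; last exact: itg_affine.
  by rewrite e mulr_natl mulr2n.
have B0 : 0 <= B.
  have := le_trans (normr_ge0 _) (gB 0).
  by rewrite expr0n addr0 divr1.
have : `|2 * intR G| <= intR (fun u => B * (1 + u ^+ 2)^-1).
  rewrite e2; apply: normr_intR_le.
  - by apply: itgD => //; exact: itg_affine.
  - exact: itgZ itg_oneDsqrV.
  move=> u; rewrite /G mul1r.
  have -> : r * (u + h) = r * u + pi by rewrite mulrDr /h mulrCA divff ?mulr1 ?gt_eqF.
  rewrite tpi mulNr -mulrBr normrM.
  by apply: le_trans (gB u); rewrite ler_piMl.
rewrite intRZ; last exact: itg_oneDsqrV.
rewrite normrM ger0_norm//; apply: le_trans.
by rewrite ler_peMl// ler1n.
Qed.

(** For [|u| > 5] both [u] and [u + h] lie outside [[-1, 1]], so the difference vanishes; for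
    [|u| <= 5] one has [1 + u^2 <= 26]. *)
Lemma shift_supp_bound g h K : 0 <= h <= 4 ->
  (forall u, 1 <= u ^+ 2 -> g u = 0) ->
  (forall u, `|u| <= 5 -> `|g u - g (u + h)| <= K) ->
  forall u, `|g u - g (u + h)| <= 26 * K / (1 + u ^+ 2).
Proof.
move=> /andP[h0 h4] g0 gK u.
have K0 : 0 <= K by rewrite (le_trans _ (gK 0 _)) ?normr0.
have [u5|u5] := leP `|u| 5.
  apply: le_trans (gK u u5) _; rewrite ler_pdivlMr ?oneDsqr_pos// mulrC ler_wpM2r//.
  have : u ^+ 2 <= 5 ^+ 2 by rewrite -[u ^+ 2]ger0_norm ?sqr_ge0// normrX ler_pXn2r ?nnegrE.
  lra.
rewrite (g0 u) ?(g0 (u + h)) ?subrr ?normr0 ?divr_ge0 ?mulr_ge0 ?(ltW (oneDsqr_pos _))//.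
  by move: u5; case: (ger0P u) => u0 u5; nra.
by move: u5; case: (ger0P u) => u0 u5; nra.
Qed.

Lemma decay_base l : 0 < l <= 1 -> exists2 C, 0 <= C & forall r, 1 <= r ->
  `|Icos l r| <= C * r `^ (- l) /\ `|Isin l r| <= C * r `^ (- l).
Proof.
move=> l01; have /andP[l0 l1] := l01.
pose I0 : R := intR (fun u => (1 + u ^+ 2)^-1).
have I00 : 0 <= I0.
  by apply: Rintegral_ge0 => u _; rewrite invr_ge0 ltW// oneDsqr_pos.
(* Here 26 comes from [shift_supp_bound]; 14 bounds [|2 u + h|] for [|u| <= 5] and [h <= 4]; the
   other 4 comes from [h = pi / r <= 4 / r]; and [9 = 5 + 4] comes from splitting the increment of
   [u (1 - u^2)_+^l] in the sine case. *)
exists (26 * (9 * (14 * 4) `^ l) * I0); first by rewrite !mulr_ge0// powR_ge0.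
move=> r r1; have r0 : 0 < r by lra.
pose h := pi / r.
have pi4 : pi <= 4 :> R by have := @pihalf_lt2 R; lra.
have h0 : 0 < h by rewrite divr_gt0 ?pi_gt0.
have h14 : 0 <= 14 * h by lra.
have h4 : h <= 4 by rewrite ler_pdivrMr//; nra.
have hr : h <= 4 / r by rewrite ler_wpM2r// invr_ge0 ltW.
have hl : (14 * h) `^ l <= (14 * 4) `^ l * r `^ (- l).
  have r10 : 0 <= r^-1 by rewrite invr_ge0 ltW.
  apply: (@le_trans _ _ ((14 * 4 * r^-1) `^ l)).
    rewrite ge0_ler_powR ?nnegrE ?(ltW l0) ?h14 ?mulr_ge0//.
    by rewrite -[leRHS]mulrA ler_pM2l.
  have c0 : 0 <= 14 * 4 :> R by rewrite mulr_ge0.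
  by rewrite (powRM _ c0 r10) -[r^-1]powR_inv1 ?(ltW r0)// -powRrM mulN1r.
have f14 u : `|u| <= 5 ->
    `|pospow l (1 - u ^+ 2) - pospow l (1 - (u + h) ^+ 2)| <= (14 * h) `^ l.
  move=> u5; apply: le_trans (pospow_holder _ _ l01) _.
  rewrite ge0_ler_powR ?nnegrE ?(ltW l0) ?h14//.
  rewrite (_ : _ - _ = h * (2 * u + h)); last by ring.
  rewrite normrM (gtr0_norm h0) mulrC ler_pM2r//.
  by move: u5; rewrite !ler_norml => /andP[? ?]; apply/andP; split; lra.
have hl14 : h <= 4 * (14 * h) `^ l.
  have h41 : 0 < h / 4 <= 1 by rewrite divr_gt0//= ler_pdivrMr ?mul1r.
  have -> : h = 4 * (h / 4) by rewrite mulrCA divff ?mulr1.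
  rewrite ler_pM2l//; apply: le_trans (ger1_powR h41 l1) _.
  by rewrite ge0_ler_powR ?nnegrE ?(ltW l0)//; lra.
have p0 : 0 <= (14 * h) `^ l by exact: powR_ge0.
split.
  have /le_trans : `|Icos l r| <= 26 * (1 * (14 * h) `^ l) * I0.
    apply: (half_period_bound r0 measurable_cos normr_cos_le1) => //.
    - exact: cosDpi.
    - exact: itg_pospow.
    apply: shift_supp_bound; first by rewrite (ltW h0).
    - by move=> u; exact: pospow_supp.
    - by move=> u u5; rewrite mul1r f14.
  apply; nra.
have -> : Isin l r = intR (fun u => sin (r * u) * (u * pospow l (1 - u ^+ 2))).
  by apply: eq_Rintegral => u _; rewrite mulrA.
have /le_trans : `|intR (fun u => sin (r * u) * (u * pospow l (1 - u ^+ 2)))| <=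
   26 * (9 * (14 * h) `^ l) * I0.
  apply: (half_period_bound r0 measurable_sin normr_sin_le1) => //.
  - exact: sinDpi.
  - by apply: itg_supp => //; exact: normr_le1_sqr.
  apply: shift_supp_bound; first by rewrite (ltW h0).
  - by move=> u u1; rewrite pospow_supp ?mulr0.
  - move=> u u5; rewrite -/h (_ : _ - _ = u * (pospow l (1 - u ^+ 2) -
      pospow l (1 - (u + h) ^+ 2)) - h * pospow l (1 - (u + h) ^+ 2)); last by ring.
    apply: le_trans (ler_normB _ _) _.
    have -> : 9 * (14 * h) `^ l = 5 * (14 * h) `^ l + 4 * (14 * h) `^ l by ring.
    apply: lerD; rewrite normrM; first by rewrite ler_pM// f14.
    apply: le_trans hl14; rewrite (gtr0_norm h0) (ger0_norm (pospow_ge0 _ _)).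
    by rewrite ler_piMr ?(ltW h0)// pospow_le1.
apply; nra.
Qed.

(** Each integration by parts lowers [l] by one and gains a factor [1 / r]. It stops at
    [0 < l <= 1], where the truncated power is only Hölder continuous and the half-period argument
    takes over. *)
Lemma decay l : 0 < l -> exists2 C, 0 <= C & forall r, 1 <= r ->
  `|Icos l r| <= C * r `^ (- l) /\ `|Isin l r| <= C * r `^ (- l).
Proof.
have [n ln] : exists n : nat, l <= n%:R.
  by exists (Num.truncn l).+1; exact: ltW (truncnS_gt _).
elim: n l ln => [|n IH] l ln l0; first by move: ln; lra.
have [l1|l1] := leP l 1; first by apply: decay_base; rewrite l0.
have l10 : 0 < l - 1 by lra.
have [|C C0 HC] := IH (l - 1) _ l10; first by rewrite lerBlDr natr1.
exists ((1 + 2 * l) * (2 * l * C) + 2 * l * C).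
  by rewrite addr_ge0// !mulr_ge0//; lra.
move=> r r1; have r0 : 0 < r by lra.
have [HC1 HC2] := HC r r1.
have rl : r `^ (- (l - 1)) = r * r `^ (- l).
  rewrite opprB addrC powRDp// powRr1 ?(ltW r0)// mulrC; by [].
have p0 : 0 <= r `^ (- l) by exact: powR_ge0.
have ri : r^-1 <= 1 by rewrite invf_le1.
have e1 : `|Icos l r| <= 2 * l * C * r `^ (- l).
  have -> : Icos l r = r^-1 * (2 * l * Isin (l - 1) r).
    by rewrite -Icos_rec// mulKf// gt_eqF.
  rewrite !normrM gtr0_norm ?invr_gt0// ler_pdivrMl// (ger0_norm (_ : 0 <= 2)) // (gtr0_norm l0).
  have -> : r * (2 * l * C * r `^ (- l)) = 2 * l * (C * (r * r `^ (- l))) by ring.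
  by rewrite -rl ler_wpM2l// mulr_ge0// ltW.
have D0 : 0 <= 2 * l * C by rewrite !mulr_ge0// ltW.
have l20 : 0 <= 1 + 2 * l by lra.
split.
  apply: le_trans e1 _; rewrite ler_wpM2r// lerDr mulr_ge0//.
have -> : Isin l r = r^-1 * ((1 + 2 * l) * Icos l r - 2 * l * Icos (l - 1) r).
  by rewrite -Isin_rec// mulKf// gt_eqF.
have e2 : `|Icos (l - 1) r| <= C * (r * r `^ (- l)) by rewrite -rl.
rewrite normrM gtr0_norm ?invr_gt0// ler_pdivrMl//.
apply: le_trans (ler_normB _ _) _; rewrite !normrM (ger0_norm l20) (ger0_norm (_ : 0 <= 2))//.
rewrite (gtr0_norm l0) (_ : r * _ = (1 + 2 * l) * (2 * l * C * r `^ (- l) * r) +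
  2 * l * (C * (r * r `^ (- l)))); last by ring.
apply: lerD; apply: ler_wpM2l => //; last by lra.
by apply: le_trans e1 _; rewrite ler_peMr// mulr_ge0.
Qed.

(** Below [r = 1] the trivial bound [cpow l] suffices, since there [r^-N >= 1]. One constant serves
    all [N], which lets the error estimate choose an exponent slightly above that of the main
    term. *)
Lemma Icos_decay l : 0 < l -> exists2 C, 0 <= C & forall N r, 0 <= N <= l ->
  0 < r -> `|Icos l r| <= C * r `^ (- N).
Proof.
move=> l0; have [C C0 HC] := decay l0.
exists (C + cpow l); first by rewrite addr_ge0// cpow_ge0.
move=> N r /andP[N0 Nl] r0; have [r1|/ltW r1] := leP 1 r.
  have [+ _] := HC r r1; move=> /le_trans; apply.
  apply: (@le_trans _ _ (C * r `^ (- N))).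
    by rewrite ler_wpM2l// ler_powR// lerN2.
  by rewrite ler_wpM2r ?powR_ge0// lerDl cpow_ge0.
have /le_trans : `|Icos l r| <= cpow l.
  rewrite /cpow /Icos /Vop; apply: normr_intR_le.
  - exact: itg_Icos.
  - exact: itg_Icos.
  move=> u; rewrite mul0r cos0 mul1r normrM (ger0_norm (pospow_ge0 _ _)).
  by rewrite ler_piMl ?pospow_ge0// normr_cos_le1.
apply; apply: (@le_trans _ _ (cpow l * r `^ (- N))).
  rewrite ler_peMr ?cpow_ge0// -(powRr0 r).
  by rewrite ger_powR// ?r0// oppr_le0.
by rewrite ler_wpM2r ?powR_ge0// lerDr.
Qed.

End decay.

Section extensionality.
Context {R : realType}.
Local Notation mu := (@lebesgue_measure R).
Local Notation intR f := (Rintegral mu setT f).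
Implicit Types (f g : R -> R).

Lemma eq_intR f g : f =1 g -> intR f = intR g.
Proof. by move=> fg; apply: eq_Rintegral => x _; exact: fg. Qed.

Lemma eq_itg f g : f =1 g -> itg f -> itg g.
Proof. by move=> /funext ->. Qed.

End extensionality.

(** * Taylor formula at infinity *)

Section taylor.
Context {R : realType}.
Local Notation mu := (@lebesgue_measure R).
Local Notation intR f := (Rintegral mu setT f).
Implicit Types (a b c e h l p q r s u v w x y z : R) (f g df : R -> R).
Implicit Types (G : nat -> R -> R).

Definition taylor_coef (n : nat) : R := (-1) ^+ n / n`!%:R.

Let taylor_sum G w n v := \sum_(j < n) taylor_coef j * ((v - w) ^+ j * G j v).

Lemma drvX (n : nat) w v : drv (fun y => (y - w) ^+ n.+1) v (n.+1%:R * (v - w) ^+ n).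
Proof.
have := is_deriveX n.+1 (drvD (drv_id v) (drv_cst (- w) v)).
rewrite /drv; congr is_derive; last by rewrite addr0 /GRing.scale/= mulr1.
by apply/funext => y /=; elim: n => [|n IH]//; rewrite exprS [RHS]exprS -IH.
Qed.

Lemma taylor_coefS n : taylor_coef n.+1 * n.+1%:R = - taylor_coef n.
Proof.
rewrite /taylor_coef exprS factS natrM.
by field; rewrite pnatr_eq0 -lt0n fact_gt0 nat1r pnatr_eq0.
Qed.

(** [taylor_sum] is the Taylor polynomial expanded at [v] and evaluated at [w]. Differentiation in
    the expansion point telescopes, leaving only the last term. *)
Let drv_taylor_sum G w n v : (forall j, (j <= n)%N -> drv (G j) v (G j.+1 v)) ->
  drv (taylor_sum G w n.+1) v (taylor_coef n * ((v - w) ^+ n * G n.+1 v)).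
Proof.
elim: n => [|n IH] dG.
  rewrite /taylor_sum; have := drvZ (taylor_coef 0) (dG 0 isT).
  rewrite /drv expr0 mul1r; congr is_derive.
  by apply/funext => y; rewrite big_ord1 expr0 mul1r.
have dS := IH (fun j jn => dG j (leqW jn)).
have dN := drvZ (taylor_coef n.+1) (drvM (drvX n w v) (dG n.+1 (leqnn _))).
have := drvD dS dN; rewrite /drv; congr is_derive.
  by apply/funext => y; rewrite [RHS]/taylor_sum big_ord_recr.
have -> : taylor_coef n = - (taylor_coef n.+1 * n.+1%:R).
  by rewrite taylor_coefS opprK.
ring.
Qed.

(** The telescoped derivative is integrated from [w] to infinity: at [v = w] the polynomial reduces
    to [G 0 w], and the decay of [v^j G j v] removes the contribution at infinity. *)
Lemma taylor_integral G w n : 0 <= w ->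
  (forall j v, (j <= n)%N -> w <= v -> drv (G j) v (G j.+1 v)) ->
  (forall j, (j <= n)%N -> qdecay w (fun v => v ^+ j * G j v)) ->
  qdecay w (fun v => v ^+ n * G n.+1 v) -> (0 < n)%N ->
  itg (fun v => taylor_coef n * above w (G n.+1) v * pospow n%:R (v - w)) /\
  G 0 w = - intR (fun v => taylor_coef n * above w (G n.+1) v * pospow n%:R (v - w)).
Proof.
move=> w0 dG qG qGn n0.
have n0R : 0 < n%:R :> R by rewrite ltr0n.
have qpow j g : qdecay w (fun v => v ^+ j * g v) ->
    qdecay w (fun v => (v - w) ^+ j * g v).
  move=> [C HC]; exists C => v wv.
  apply: le_trans (HC v wv); rewrite !normrM ler_wpM2r// !normrX.
  by rewrite lerXn2r ?nnegrE// ger0_norm ?subr_ge0// ger0_norm ?gerBl//; lra.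
have qS : qdecay w (taylor_sum G w n.+1).
  have : forall i, (i <= n.+1)%N -> qdecay w (taylor_sum G w i).
    elim=> [_|i IH ilt].
      exists 0 => v _; rewrite /taylor_sum big_ord0 normr0.
      by rewrite mul0r.
    apply: (@eq_qdecay _ _ (fun v => taylor_sum G w i v +
        taylor_coef i * ((v - w) ^+ i * G i v))).
      by move=> v; rewrite [RHS]/taylor_sum big_ord_recr.
    apply: qdecayD; first exact/IH/ltnW.
    exact/qdecayZ/qpow/qG.
  exact.
have qdS : qdecay w (fun v => taylor_coef n * ((v - w) ^+ n * G n.+1 v)).
  exact/qdecayZ/qpow.
have [i1 e1] := ftc_half (fun v wv => drv_taylor_sum w (fun j jn => dG j v jn wv)) qS qdS.
have E v : above w (fun v => taylor_coef n * ((v - w) ^+ n * G n.+1 v)) v =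
  taylor_coef n * above w (G n.+1) v * pospow n%:R (v - w).
  rewrite /above; case: ltP => wv; last by rewrite mulr0 mul0r.
  rewrite pospow_pos ?subr_ge0 ?(ltW wv)// powR_mulrn ?subr_ge0 ?(ltW wv)//.
  by rewrite -mulrA; congr (_ * _); rewrite mulrC.
split; first exact: eq_itg E i1.
rewrite -(eq_intR E) e1 opprK /taylor_sum big_ord_recl big1.
  by rewrite expr0 mul1r /taylor_coef expr0 fact0 divr1 mul1r addr0.
by move=> j _; rewrite subrr expr0n/= mul0r mulr0.
Qed.

End taylor.

(** * Moving the Fourier integral from the symbol to the truncated powers *)

Section transfer.
Context {R : realType}.
Local Notation mu := (@lebesgue_measure R).
Local Notation intR f := (Rintegral mu setT f).
Implicit Types (a b c e l p q r s u v w x y z : R) (f g h psi trig : R -> R).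

(** For [psi = pospow m%:R] this is, up to the factor [m!], the Weyl integral of order [m + 1] of
    [h]. *)
Definition hat h psi w := intR (fun v => h v * psi (v - w)).

Lemma itg_hat h psi l w : 0 < l -> 0 <= w -> measurable_fun setT h ->
  dominated l psi -> itg (fun v => h v * pospow l v) ->
  itg (fun v => h v * psi (v - w)).
Proof.
move=> l0 w0 mh [mpsi [C psiC]] hl; apply: (itg_le _ _ (itgZ `|C| (itg_norm hl))).
  apply: measurable_funM => //; apply: (measurable_compR mpsi).
  exact: measurable_funB.
move=> v; rewrite !normrM mulrCA ler_wpM2l// (ger0_norm (pospow_ge0 _ _)).
apply: le_trans (psiC _) _; apply: (@le_trans _ _ (`|C| * pospow l (v - w))).
  by rewrite ler_wpM2r ?pospow_ge0// ler_norm.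
by rewrite ler_wpM2l// ler_pospow// gerBl.
Qed.

(** The shift [w -> w + u^2] on the symbol becomes [v -> v - u^2] on the kernel. A general bounded
    [trig] covers cosine and sine together. *)
Lemma hat_fubini h psi l w trig : 0 < l -> 0 <= w -> measurable_fun setT h ->
  dominated l psi -> itg (fun v => h v * pospow l v) ->
  itg (fun v => h v * pospow (l + 2^-1) v) ->
  measurable_fun setT trig -> (forall u, `|trig u| <= 1) ->
  itg (fun u => trig u * hat h psi (w + u ^+ 2)) /\
  intR (fun u => trig u * hat h psi (w + u ^+ 2)) =
  intR (fun v => h v * intR (fun u => trig u * psi (v - w - u ^+ 2))).
Proof.
move=> l0 w0 mh dpsi hl hl2 mt t1.
have l20 : 0 < l + 2^-1 by rewrite addr_gt0.
have [mpsi [C psiC]] := dpsi.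
have tpsi_ v : itg (fun u => trig u * psi (v - w - u ^+ 2)).
  by apply: itg_bounded => //; exact: itg_dominated dpsi.
pose f v u := h v * (trig u * psi (v - w - u ^+ 2)).
have f_ v : itg (f v) by exact: itgZ.
have mf : measurable_fun setT (fun p : R * R => f p.1 p.2).
  apply: measurable_funM; first exact: (measurable_compR mh measurable_fst).
  apply: measurable_funM; first exact: (measurable_compR mt measurable_snd).
  apply: (measurable_compR mpsi); apply: measurable_funB; first exact: measurable_funB.
  exact: measurable_funX.
have g_ := itgZ (`|C| * cpow l) (itg_norm hl2).
have fg v : intR (fun u => `|f v u|) <= `|C| * cpow l * `|h v * pospow (l + 2^-1) v|.
  apply: (@le_trans _ _ (`|h v| * (`|C| * (cpow l * pospow (l + 2^-1) (v - w))))).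
    rewrite -intR_pospow// -intRZ; last exact: itg_pospow.
    rewrite -intRZ; last exact/itgZ/itg_pospow.
    apply: le_intR; first exact: itg_norm.
      exact/itgZ/itgZ/itg_pospow.
    move=> u; rewrite /f normrM ler_wpM2l// normrM.
    apply: (@le_trans _ _ `|psi (v - w - u ^+ 2)|); first by rewrite ler_piMl.
    by apply: le_trans (psiC _) _; rewrite ler_wpM2r ?pospow_ge0// ler_norm.
  rewrite normrM (ger0_norm (pospow_ge0 _ v)) mulrCA -!mulrA ler_wpM2l//.
  rewrite mulrCA ler_wpM2l ?cpow_ge0// ler_wpM2l//.
  by rewrite ler_pospow// gerBl.
have [_ i2 e] := fubiniR mf f_ g_ fg.
have inner u : intR (f^~ u) = trig u * hat h psi (w + u ^+ 2).
  rewrite /hat -intRZ; last by apply: (itg_hat l0 _ mh dpsi hl); rewrite addr_ge0// sqr_ge0.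
  by apply: eq_Rintegral => v _; rewrite /f mulrCA opprD addrA.
split; first exact: eq_itg inner i2.
rewrite -(eq_intR inner) -e.
by apply: eq_Rintegral => v _; rewrite intRZ.
Qed.

Definition Uop c f w := intR (fun u => cos (c * u) * f (w + u ^+ 2)).

Fixpoint Uiter (xs : seq R) f : R -> R :=
  if xs is x :: xs' then Uop x (Uiter xs' f) else f.

Lemma eq_Uop c f g w : (forall z, w <= z -> f z = g z) -> Uop c f w = Uop c g w.
Proof.
by move=> fg; apply: eq_Rintegral => u _; rewrite fg// lerDl sqr_ge0.
Qed.

Lemma eq_Uiter xs f g w : (forall z, w <= z -> f z = g z) ->
  forall z, w <= z -> Uiter xs f z = Uiter xs g z.
Proof.
move=> fg; elim: xs => //= x xs IH z wz.
by apply: eq_Uop => y zy; apply: IH; exact: le_trans wz zy.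
Qed.

(** All intermediate half-integer steps are required because Fubini is applied once per coordinate,
    and each application raises the exponent by 1/2. *)
Definition weighted h l (n : nat) := measurable_fun setT h /\
  forall j, (j <= n)%N -> itg (fun v => h v * pospow (l + j%:R / 2) v).

Lemma Uiter_hat h psi l xs : 0 < l -> dominated l psi ->
  weighted h l (size xs) ->
  forall w, 0 <= w -> Uiter xs (hat h psi) w = hat h (Viter xs psi) w.
Proof.
move=> l0 dpsi; elim: xs => //= x xs IH [mh hl] w w0.
have ln0 : 0 < l + (size xs)%:R / 2 by rewrite ltr_wpDr// divr_ge0.
have h1 := hl (size xs) (leqnSn _).
have h2 := hl (size xs).+1 (leqnn _).
rewrite -[(size xs).+1%:R]natr1 mulrDl mul1r addrA in h2.
rewrite (@eq_Uop _ _ (hat h (Viter xs psi))); last first.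
  move=> z wz; apply: IH; last exact: le_trans w0 wz.
  by split => // j jn; apply: hl; exact: leqW.
rewrite /Uop; have [_ ->//] := hat_fubini ln0 w0 mh (dominated_Viter xs l0 dpsi) h1 h2
  (measurable_cosM x) (fun u => normr_cos_le1 (x * u)).
Qed.

Lemma dotR_cons n (x0 y0 : R) (x y : n.-tuple R) :
  dotR [tuple of x0 :: x] [tuple of y0 :: y] = x0 * y0 + dotR x y.
Proof.
rewrite /dotR big_ord_recl !tnth0; congr (_ + _).
by apply: eq_bigr => i _; rewrite !tnthS.
Qed.

(** The phase [a] collects the contribution of the other coordinates. In the addition formula the
    sine term is odd in [u] and drops out. *)
Lemma cos_hat h psi l a x w : 0 < l -> 0 <= w -> dominated l psi ->
  measurable_fun setT h ->
  itg (fun v => h v * pospow l v) -> itg (fun v => h v * pospow (l + 2^-1) v) ->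
  itg (fun u => cos (a + x * u) * hat h psi (w + u ^+ 2)) /\
  intR (fun u => cos (a + x * u) * hat h psi (w + u ^+ 2)) =
  cos a * hat h (Vop x psi) w.
Proof.
move=> l0 w0 dpsi mh h1 h2.
have [i1 e1] := hat_fubini l0 w0 mh dpsi h1 h2 (measurable_cosM x)
  (fun u => normr_cos_le1 (x * u)).
have [i2 _] := hat_fubini l0 w0 mh dpsi h1 h2 (measurable_sinM x)
  (fun u => normr_sin_le1 (x * u)).
have E u : cos a * (cos (x * u) * hat h psi (w + u ^+ 2)) +
    (- sin a) * (sin (x * u) * hat h psi (w + u ^+ 2)) =
    cos (a + x * u) * hat h psi (w + u ^+ 2).
  by rewrite cosD; ring.
have i1' := itgZ (cos a) i1; have i2' := itgZ (- sin a) i2.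
split; first exact: eq_itg E (itgD i1' i2').
rewrite -(eq_intR E) (intRD i1' i2') (intRZ _ i1) (intRZ _ i2) (intR_odd i2).
  by rewrite mulr0 addr0 e1.
by move=> u; rewrite mulrN sinN sqrrN mulNr.
Qed.

(** The induction carries the phase [a] and the partial sum of squares [w]. At the end [a = 0] gives
    the real part and [a = pi / 2] the imaginary part. The dimension is positive because the
    innermost integral is what discards the point where the argument of [f] is 0. *)
Lemma integral_Rd_hat h psi l n (x : n.+1.-tuple R) f : 0 < l ->
  dominated l psi -> weighted h l n.+1 -> measurable_fun setT f ->
  (forall w, 0 < w -> f w = hat h psi w) ->
  forall a w, 0 <= w ->
  integral_Rd (fun xi : n.+1.-tuple R => cos (a + dotR x xi) * f (w + dotR xi xi)) =
  cos a * hat h (Viter x psi) w.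
Proof.
move=> l0 dpsi hl mf fh; elim: n x hl => [|n IH] x [mh hI] a w w0;
    case/tupleP: x => x0 x.
  have h1 := hI 0%N isT; have h2 := hI 1%N isT.
  rewrite mul0r addr0 in h1; rewrite mul1r in h2.
  have [i e] := cos_hat a x0 l0 w0 dpsi mh h1 h2.
  rewrite (tuple0 x) /= -e.
  rewrite (_ : (fun u => _) = fun u => cos (a + x0 * u) * f (w + u ^+ 2)).
    apply: ae_intR; last 2 first.
    - exact: itg_measurable i.
    - move=> u u0; rewrite fh// ltr_wpDl// exprn_even_gt0//.
    apply: measurable_funM.
      apply: (measurable_compR measurable_cos).
      by apply: measurable_funD => //; exact: measurable_funM.
    apply: (measurable_compR mf).
    by apply: measurable_funD => //; exact: measurable_funX.
  apply/funext => u; rewrite !dotR_cons.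
  by rewrite /dotR !big_ord0 !addr0 expr2.
have ln0 : 0 < l + n.+1%:R / 2 by rewrite ltr_wpDr// divr_ge0.
have h1 := hI n.+1 (leqnSn _).
have h2 := hI n.+2 (leqnn _).
rewrite -[n.+2%:R]natr1 mulrDl mul1r addrA in h2.
have dx := dominated_Viter x l0 dpsi; rewrite size_tuple in dx.
have [_ e] := cos_hat a x0 ln0 w0 dx mh h1 h2.
rewrite [RHS]/= -[RHS]e.
transitivity (intR (fun u => integral_Rd (fun xi : n.+1.-tuple R =>
  cos (a + dotR [tuple of x0 :: x] [tuple of u :: xi]) *
  f (w + dotR [tuple of u :: xi] [tuple of u :: xi])))); first by [].
apply: eq_intR => u.
rewrite -(IH x _ (a + x0 * u) (w + u ^+ 2)); last 2 first.
- by split => // j jn; apply: hI; exact: leqW.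
- by rewrite addr_ge0// sqr_ge0.
congr (integral_Rd _); apply/funext => xi.
by rewrite !dotR_cons -expr2 !addrA.
Qed.

End transfer.

(** * Power weights and the Gamma integral *)

Section limit_integral.
Context {R : realType}.
Local Notation mu := (@lebesgue_measure R).
Local Notation intR f := (Rintegral mu setT f).
Implicit Types (a b c e l p q r s u v w x y z : R) (f g df : R -> R).

Lemma itg_above_limit f C : (forall u, 0 < u -> 0 <= f u) ->
  (forall w, 0 < w -> itg (above w f) /\ intR (above w f) <= C) ->
  itg (above 0 f).
Proof.
move=> f0 fC.
pose g (n : nat) u := (above n.+1%:R^-1 f u)%:E.
have g_ n : itg (above n.+1%:R^-1 f) by have [] := fC n.+1%:R^-1; rewrite ?invr_gt0.
have d0 (n : nat) : 0 < n.+1%:R^-1 :> R by rewrite invr_gt0.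
have g0 n u : (0 <= g n u)%E.
  by rewrite lee_fin /above; case: ifP => // nu; rewrite f0// (lt_trans (d0 n)).
have gnd u : nondecreasing_seq (g^~ u).
  move=> m n mn; rewrite lee_fin /above.
  have nm : n.+1%:R^-1 <= m.+1%:R^-1 :> R by rewrite lef_pV2 ?posrE// ler_nat.
  case: ifPn => [mu_|_]; first by rewrite (le_lt_trans nm mu_).
  by case: ifP => // nu; rewrite f0// (lt_trans (d0 n)).
have glim u : g n u @[n --> \oo] --> (above 0 f u)%:E.
  rewrite /above; case: ifPn => [u0|]; last first.
    rewrite -leNgt => u0; rewrite (_ : g^~ u = cst 0%E); first exact: cvg_cst.
    apply/funext => n; rewrite /g /above ltNge (le_trans u0)// ltW//.
  have [N uN] : exists N : nat, N.+1%:R^-1 < u.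
    exists (Num.truncn u^-1); rewrite invf_plt ?posrE// truncnS_gt//.
  apply: cvg_near_cst; exists N => // n /= Nn.
  rewrite /g /above (le_lt_trans _ uN)// lef_pV2 ?posrE// ler_nat//.
have mlim : measurable_fun setT (fun u => (above 0 f u)%:E).
  apply: (emeasurable_fun_cvg g) => [n|u _]; last exact: glim.
  exact: (measurable_int _ (g_ n)).
apply/integrableP; split => //.
apply: (@le_lt_trans _ _ C%:E); last exact: ltry.
have -> : (\int[mu]_u `|(EFin \o above 0 f) u| = \int[mu]_u limn (g^~ u))%E.
  apply: eq_integral => u _; rewrite (cvg_lim _ (glim u))// /= ger0_norm//.
  by rewrite /above; case: ifP => // /f0.
have H := cvg_monotone_convergence measurableT (fun n => measurable_int _ (g_ n))
  (fun n u _ => g0 n u) (fun u _ => gnd u) (mu := mu).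
rewrite -(cvg_lim _ H)//; apply: lime_le; first by apply/cvg_ex; eexists; exact: H.
apply: nearW => n; rewrite -(EFin_intR (g_ n)) lee_fin.
by have [_] := fC n.+1%:R^-1 (d0 n).
Qed.

Lemma powR_cvgy_inv e : 0 < e -> (1 + q `^ e)^-1 @[q --> +oo] --> (0 : R).
Proof.
move=> e0; apply/cvgrPdist_lt => eps eps0; near=> q.
have q0 : 0 < q by near: q; exact: nbhs_pinfty_gt.
have p0 : 0 < 1 + q `^ e by rewrite ltr_pwDl// powR_ge0.
rewrite sub0r normrN gtr0_norm ?invr_gt0// invf_plt ?posrE//.
rewrite ltr_pwDl//.
have -> : eps^-1 = ((eps^-1) `^ e^-1) `^ e.
  by rewrite -powRrM mulVf ?gt_eqF// powRr1// invr_ge0 ltW.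
by rewrite ge0_ler_powR ?nnegrE ?powR_ge0 ?(ltW e0) ?(ltW q0).
Unshelve. all: by end_near. Qed.

Lemma one_powR e : 1 `^ e = 1 :> R.
Proof. by rewrite powR1. Qed.

(** This weight has the explicit primitive [- 1 / (e (1 + q^e))], and behaves like [q^(e - 1)] at 0
    and [q^(- e - 1)] at infinity, so it dominates at both ends. *)
Lemma itg_weight e : 0 < e -> itg (above 0 (fun q => q `^ (e - 1) / (1 + q `^ e) ^+ 2)).
Proof.
move=> e0; set f := fun q => _.
have p0 q : 0 < 1 + q `^ e by rewrite ltr_pwDl// powR_ge0.
have f0 q : 0 <= f q by rewrite /f divr_ge0 ?powR_ge0// exprn_ge0// ltW.
pose F q := - e^-1 * (1 + q `^ e)^-1.
have dF q : 0 < q -> drv F q (f q).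
  move=> q0; have dp := drvD (drv_cst 1 q) (is_derive1_powR e q0).
  have dv := @is_deriveV R (fun y => 1 + y `^ e) q _ 1 (lt0r_neq0 (p0 q)) dp.
  have := drvZ (- e^-1) dv.
  move/drv_eq; apply; rewrite /f add0r /GRing.scale/=.
  by field; rewrite !gt_eqF.
have cf q : 0 < q -> {for q, continuous f}.
  move=> q0; apply: cvgM.
    exact: (drv_continuous (is_derive1_powR (e - 1) q0)).
  apply: cvgV; first by rewrite expf_neq0// gt_eqF.
  apply: (@continuous_comp _ _ _ (fun q => 1 + q `^ e) (fun x => x ^+ 2)).
    exact: (drv_continuous (drvD (drv_cst 1 q) (is_derive1_powR e q0))).
  exact: exprn_continuous.
apply: (@itg_above_limit _ e^-1) => // w w0.
have E : above w f = (f \_ `]w, +oo[%classic).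
  by apply/funext => u; rewrite patchE /above mem_setE in_itv/= andbT.
have mD : measurable (`]w, +oo[%classic : set R) by [].
have mDc : measurable (`[w, +oo[%classic : set R) by [].
have I1 : (\int[mu]_(x in `[w, +oo[) (f x)%:E = 0%:E - (F w)%:E)%E.
  apply: (@ge0_continuous_FTC2y R f F w 0).
  - by move=> x _.
  - apply/continuous_within_itvcyP; split.
      by move=> x; rewrite in_itv/= andbT => wx; apply: cf; exact: lt_trans wx.
    by apply: cvg_at_right_filter; exact: cf.
  - rewrite -[X in _ --> X](mulr0 (- e^-1)); apply: cvgM; first exact: cvg_cst.
    exact: powR_cvgy_inv.
  - by move=> x wx; have [] := dF x (lt_trans w0 wx).
  - by apply: cvg_at_right_filter; exact: (drv_continuous (dF w w0)).
  - move=> x; rewrite in_itv/= andbT => wx.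
    rewrite derive1E; exact: (@derive_val _ _ _ _ _ _ _ (dF x (lt_trans w0 wx))).
have iDc : mu.-integrable `[w, +oo[%classic (EFin \o f).
  apply/integrableP; split.
    apply/measurable_EFinP; apply: subspace_continuous_measurable_fun => //.
    apply/continuous_within_itvcyP; split.
      by move=> x; rewrite in_itv/= andbT => wx; apply: cf; exact: lt_trans wx.
    by apply: cvg_at_right_filter; exact: cf.
  rewrite (_ : (\int[mu]_(x in _) _)%E = (\int[mu]_(x in `[w, +oo[) (f x)%:E)%E).
    by rewrite I1 -EFinB ltry.
  by apply: eq_integral => x _ /=; rewrite ger0_norm.
have iD : mu.-integrable `]w, +oo[%classic (EFin \o f).
  apply: integrableS iDc => //.
  by apply: subset_itvr; rewrite bnd_simp.
have iE : itg (above w f).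
  by rewrite E /itg -restrict_EFin; apply/integrable_restrict => //; rewrite setTI.
split => //.
have -> : intR (above w f) = - F w.
  apply: EFin_inj; rewrite (EFin_intR iE) EFinN -sub0e -I1 -integral_itv_obnd_cbnd//.
    rewrite [RHS]integral_mkcond; apply: eq_integral => u _.
    by rewrite patchE /above mem_setE in_itv/= andbT; case: ifP.
  exact: (measurable_int _ iD).
rewrite /F mulNr opprK -[leRHS]mulr1 ler_pM2l ?invr_gt0//.
by rewrite invf_le1// lerDl powR_ge0.
Qed.

Lemma itg_between f a b C : 0 < a -> 0 < b -> measurable_fun setT (above 0 f) ->
  (forall q, 0 < q -> `|f q| <= C * q `^ (a - 1)) ->
  (forall q, 0 < q -> `|f q| <= C * q `^ (- b - 1)) -> itg (above 0 f).
Proof.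
move=> a0 b0 mf fa fb; pose e := Num.min a b.
have e0 : 0 < e by rewrite /e lt_min a0.
have ea : e <= a by rewrite /e ge_min lexx.
have eb : e <= b by rewrite /e ge_min lexx orbT.
have C0 : 0 <= C.
  have := le_trans (normr_ge0 _) (fa 1 ltr01).
  by rewrite powR1 mulr1.
(* The factor 4: [(1 + q^e)^2] is at most 4 for [q <= 1] and at most [4 q^(2 e)] for [q >= 1]. *)
apply: (itg_le mf _ (itgZ (C * 4) (itg_weight e0))) => q.
rewrite /above; case: ifP => [q0|_]; last by rewrite normr0 mulr0.
have p0 : 0 < 1 + q `^ e by rewrite ltr_pwDl// powR_ge0.
rewrite -mulrA; have [q1|/ltW q1] := leP q 1.
  apply: le_trans (fa q q0) _; rewrite ler_wpM2l// mulrA ler_pdivlMr ?exprn_gt0//.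
  rewrite mulrC; apply: ler_pM => //; rewrite ?exprn_ge0 ?powR_ge0 ?(ltW p0)//.
    have : q `^ e <= 1 by rewrite -(one_powR e) ge0_ler_powR ?nnegrE ?(ltW e0) ?(ltW q0).
    by have := powR_ge0 q e; nra.
  by rewrite ger_powR ?q0//; lra.
apply: le_trans (fb q q0) _; rewrite ler_wpM2l// mulrA ler_pdivlMr ?exprn_gt0//.
have q1e : 1 <= q `^ e by rewrite -(one_powR e) ge0_ler_powR ?nnegrE ?(ltW e0) ?(ltW q0).
have -> : q `^ (e - 1) = q `^ (- e - 1) * (q `^ e) ^+ 2.
  by rewrite -powR_mulrn ?powR_ge0// -powRrM -powRDp//; congr powR; lra.
rewrite [leRHS]mulrCA; apply: ler_pM; rewrite ?exprn_ge0 ?powR_ge0 ?(ltW p0)//.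
  by rewrite ler_powR//; lra.
nra.
Qed.

Lemma measurable_above_powR s : measurable_fun setT (above 0 (fun q => q `^ s)).
Proof. by apply: measurable_above => u u0; exact: (drv_continuous (is_derive1_powR s u0)). Qed.

Lemma expRN_powR b : 0 <= b ->
  exists2 C, 0 <= C & forall q, 0 < q -> expR (- q) <= C * q `^ (- b).
Proof.
move=> b0; pose n := Num.truncn b.
exists (n.+1`!%:R + 1); first by rewrite addr_ge0.
move=> q q0; have p0 := powR_ge0 q (- b); have [q1|/ltW q1] := leP q 1.
  apply: (@le_trans _ _ 1); first by rewrite expR_le1 oppr_le0 ltW.
  have : 1 <= q `^ (- b) by rewrite -(powRr0 q) ger_powR ?q0// oppr_le0.
  by move=> /le_trans; apply; rewrite ler_peMl// lerDr.
apply: (@le_trans _ _ (n.+1`!%:R * q `^ (- b))); last first.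
  by rewrite ler_wpM2r// lerDl.
have f0 : 0 < n.+1`!%:R :> R by rewrite ltr0n fact_gt0.
rewrite expRN -ler_pdivrMl// -invfM powRN lef_pV2 ?posrE ?powR_gt0//; last first.
  by rewrite mulr_gt0// expR_gt0.
apply: (@le_trans _ _ (q `^ n.+1%:R)).
  by rewrite ler_powR// ltW// truncnS_gt.
rewrite powR_mulrn ?(ltW q0)// mulrC -ler_pdivrMr//.
by apply: le_trans (expR_ge1Dxn n (ltW q0)); rewrite lerDr.
Qed.

Lemma ftc_zero f df : (forall u, 0 < u -> drv f u (df u)) ->
  (forall w, 0 < w -> qdecay w f) -> (forall w, 0 < w -> qdecay w df) ->
  itg (above 0 df) -> f n.+1%:R^-1 @[n --> \oo] --> 0 ->
  intR (above 0 df) = 0.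
Proof.
move=> fdf qf qdf df_ f0.
have d0 (n : nat) : 0 < n.+1%:R^-1 :> R by rewrite invr_gt0.
have F n := ftc_half (fun u nu => fdf u (lt_le_trans (d0 n) nu)) (qf _ (d0 n)) (qdf _ (d0 n)).
have [||||_ lim] := @dominated_cvgR R (fun n => above n.+1%:R^-1 df) (above 0 df)
    (fun u => `|above 0 df u|).
- by move=> n; have [i _] := F n; exact: itg_measurable i.
- exact: itg_norm.
- move=> n u; rewrite /above; case: ifP => [nu|_]; last by rewrite normr0.
  by rewrite (lt_trans (d0 n) nu).
- move=> u; rewrite /above; case: ifPn => [u0|]; last first.
    rewrite -leNgt => u0; apply: cvg_near_cst; apply: nearW => n.
    by rewrite ltNge (le_trans u0)// ltW.
  have [N uN] : exists N : nat, N.+1%:R^-1 < u.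
    by exists (Num.truncn u^-1); rewrite invf_plt ?posrE// truncnS_gt.
  apply: cvg_near_cst; exists N => // n /= Nn.
  by rewrite (le_lt_trans _ uN)// lef_pV2 ?posrE// ler_nat.
have lim0 : intR (above n.+1%:R^-1 df) @[n --> \oo] --> 0.
  rewrite (_ : (fun n : nat => _) = (fun n : nat => - f n.+1%:R^-1)).
    by rewrite -[X in _ --> X]oppr0; exact: cvgN.
  by apply/funext => n; exact: (F n).2.
exact: cvg_unique lim lim0.
Qed.

Definition gammaf s t := t `^ (s - 1) * expR (- t).

Lemma drv_expRN t : drv (fun y => expR (- y)) t (- expR (- t)).
Proof.
have := drv_comp (is_derive_expR (-1 * t)) (drvZ (-1) (drv_id t)).
rewrite /drv mulr1 mulN1r mulrN1; congr is_derive.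
by apply/funext => y; rewrite mulN1r.
Qed.

Lemma drv_gammaf s t : 0 < t ->
  drv (gammaf (s + 1)) t (s * gammaf s t - gammaf (s + 1) t).
Proof.
move=> t0; have := drvM (is_derive1_powR s t0) (drv_expRN t).
rewrite /gammaf addrK; move/drv_eq; apply; ring.
Qed.

Lemma gammaf_ge0 s t : 0 <= gammaf s t.
Proof. by rewrite mulr_ge0 ?powR_ge0 ?expR_ge0. Qed.

Lemma gammaf_bound s b : 0 <= s + b ->
  exists2 C, 0 <= C & forall t, 0 < t -> `|gammaf s t| <= C * t `^ (- b - 1).
Proof.
move=> sb; have [C C0 HC] := expRN_powR sb; exists C => // t t0.
rewrite ger0_norm ?gammaf_ge0// /gammaf.
apply: le_trans (ler_wpM2l (powR_ge0 _ _) (HC t t0)) _.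
rewrite mulrCA ler_wpM2l// -powRDp// le_eqVlt; apply/orP; left; apply/eqP.
by congr powR; lra.
Qed.

Lemma itg_gammaf s : 0 < s -> itg (above 0 (gammaf s)).
Proof.
move=> s0; have [C C0 HC] := @gammaf_bound s 1 (addr_ge0 (ltW s0) ler01).
apply: (@itg_between _ s 1 (C + 1)) => //.
- apply: measurable_above => u u0; apply: cvgM.
    exact: (drv_continuous (is_derive1_powR (s - 1) u0)).
  exact: (drv_continuous (drv_expRN u)).
- move=> q q0; rewrite ger0_norm ?gammaf_ge0// /gammaf.
  apply: (@le_trans _ _ (1 * q `^ (s - 1))).
    by rewrite mul1r ler_piMr ?powR_ge0// expR_le1 oppr_le0 ltW.
  by rewrite ler_wpM2r ?powR_ge0// lerDr.
- move=> q q0; apply: le_trans (HC q q0) _.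
  by rewrite ler_wpM2r ?powR_ge0// lerDl.
Qed.

Lemma qdecay_powR f b C w : 2 <= b -> 0 < w -> 0 <= C ->
  (forall t, 0 < t -> `|f t| <= C * t `^ (- b)) -> qdecay w f.
Proof.
move=> b2 w0 C0 HC; exists (C * (w `^ (- b) * (1 + w ^+ 2) + w `^ (2 - b) * (1 + w ^- 2))) => t wt.
have t0 : 0 < t by exact: lt_le_trans w0 wt.
apply: le_trans (HC t t0) _; rewrite -mulrA ler_wpM2l// ler_pdivlMr ?oneDsqr_pos//.
apply: (@le_trans _ _ (w `^ (2 - b) * (1 + w ^- 2))); last first.
  by rewrite lerDr mulr_ge0 ?powR_ge0// addr_ge0// sqr_ge0.
have -> : t `^ (- b) = t `^ (2 - b) * t ^- 2.
  by rewrite -powR_invn ?(ltW t0)// -powRDp//; congr powR; lra.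
rewrite -mulrA; apply: ler_pM; rewrite ?powR_ge0//.
- by rewrite mulr_ge0 ?invr_ge0 ?exprn_ge0 ?(ltW t0)// ltW// oneDsqr_pos.
- rewrite -[2 - b]opprB !powRN lef_pV2 ?posrE ?powR_gt0//.
  by rewrite ge0_ler_powR ?nnegrE ?subr_ge0 ?(ltW w0) ?(ltW t0).
rewrite mulrDr mulr1 mulVf ?expf_neq0 ?gt_eqF// addrC lerD2l.
by rewrite lef_pV2 ?posrE ?exprn_gt0// lerXn2r ?nnegrE ?(ltW w0) ?(ltW t0).
Qed.

Lemma qdecay_gammaf s w : 0 < s -> 0 < w -> qdecay w (gammaf s).
Proof.
move=> s0 w0; have [C C0 HC] := @gammaf_bound s 1 (addr_ge0 (ltW s0) ler01).
apply: (qdecay_powR (b := 2) _ w0 C0) => // t t0.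
by apply: le_trans (HC t t0) _; rewrite (_ : -1 - 1 = -2)//; lra.
Qed.

Lemma Gamma_posE s : Gamma_pos s = intR (above 0 (gammaf s)).
Proof.
rewrite /Gamma_pos Rintegral_mkcond; apply: eq_intR => t.
by rewrite patchE /above mem_setE in_itv/= andbT.
Qed.

Lemma Gamma_posS s : 0 < s -> Gamma_pos (s + 1) = s * Gamma_pos s.
Proof.
move=> s0; have s10 : 0 < s + 1 by lra.
have i1 := itgZ s (itg_gammaf s0); have i2 := itgZ (-1) (itg_gammaf s10).
have E t : s * above 0 (gammaf s) t + (-1) * above 0 (gammaf (s + 1)) t =
    above 0 (fun t => s * gammaf s t - gammaf (s + 1) t) t.
  by rewrite /above; case: ifP => _; ring.
have := @ftc_zero (gammaf (s + 1)) (fun t => s * gammaf s t - gammaf (s + 1) t)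
  (fun t t0 => drv_gammaf s t0).
rewrite -(eq_intR E) intRD// !intRZ; last 2 first.
  exact: itg_gammaf.
  exact: itg_gammaf.
rewrite -!Gamma_posE => H; apply/eqP; rewrite eq_sym -subr_eq0 -mulN1r H//.
- by move=> w w0; exact: qdecay_gammaf.
- move=> w w0; apply: (@eq_qdecay _ _ (fun t => s * gammaf s t + (-1) * gammaf (s + 1) t)).
    by move=> t; rewrite mulN1r.
  by apply: qdecayD; apply: qdecayZ; exact: qdecay_gammaf.
- exact: eq_itg E (itgD i1 i2).
apply: (@squeeze_cvgr _ _ _ _ (cst 0) (fun n : nat => (n.+1%:R^-1) `^ s)).
- apply: nearW => n; rewrite gammaf_ge0/= /gammaf addrK.
  by rewrite ler_piMr ?powR_ge0// expR_le1 oppr_le0.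
- exact: cvg_cst.
have := cvg_comp _ _ (@cvg_harmonic R) (cvg_pospow0 s0).
rewrite (pospow_neg s0 (lexx 0)); apply: cvg_trans; apply: near_eq_cvg.
by apply: nearW => n; rewrite /= pospow_pos.
Qed.

Lemma Gamma_pos_gt0 s : 0 < s -> 0 < Gamma_pos s.
Proof.
move=> s0; rewrite Gamma_posE.
have [b_ Ib] := @itg_box R; set box := fun s => _ in b_ Ib.
have n1 : (1 : R) != 0 by rewrite oner_eq0.
(* A lower bound of the Gamma integrand on [(1, 2]], whichever way [t^(s - 1)] is monotone. *)
pose c := Num.min 1 (2 `^ (s - 1)) * expR (- 2).
have c0 : 0 < c by rewrite mulr_gt0 ?expR_gt0// lt_min ltr01 powR_gt0.
apply: (@lt_le_trans _ _ (intR (fun t => c * box (1 * t + (-1))))).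
  rewrite intRZ; last exact: itg_affine.
  by rewrite intR_affine// normr1 invr1 mul1r Ib mulr1.
apply: le_intR; first exact/itgZ/itg_affine.
  exact: itg_gammaf.
move=> t; rewrite /box mul1r; case: ifP => [/andP[t1 t2]|_]; last first.
  by rewrite mulr0 /above; case: ifP => // _; exact: gammaf_ge0.
have t0 : 0 < t by lra.
rewrite /above t0 mulr1 /c /gammaf; apply: ler_pM.
- by rewrite le_min ler01 powR_ge0.
- exact: expR_ge0.
- rewrite ge_min; have [s1|/ltW s1] := leP 1 s.
    apply/orP; left; apply: (@le_trans _ _ (1 `^ (s - 1))); first by rewrite one_powR.
    by rewrite ge0_ler_powR ?nnegrE ?subr_ge0 ?(ltW t0)//; lra.
  apply/orP; right; rewrite -[s - 1]opprB !powRN lef_pV2 ?posrE ?powR_gt0//.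
  by rewrite ge0_ler_powR ?nnegrE ?subr_ge0 ?(ltW t0)//; lra.
- by rewrite ler_expR lerN2; lra.
Qed.

Lemma above_scale f c : 0 < c -> itg (above 0 f) ->
  itg (above 0 (fun t => f (c * t))) /\
  intR (above 0 (fun t => f (c * t))) = c^-1 * intR (above 0 f).
Proof.
move=> c0 f_; have E t : above 0 f (c * t + 0) = above 0 (fun t => f (c * t)) t.
  by rewrite /above addr0 pmulr_rgt0.
have cn := lt0r_neq0 c0; split; first exact: eq_itg E (itg_affine 0 cn f_).
by rewrite -(eq_intR E) (intR_affine 0 cn f_) gtr0_norm.
Qed.

Lemma Gamma_pos_scale s c : 0 < s -> 0 < c ->
  itg (above 0 (fun t => t `^ (s - 1) * expR (- (c * t)))) /\
  intR (above 0 (fun t => t `^ (s - 1) * expR (- (c * t)))) =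
  c `^ (- s) * Gamma_pos s.
Proof.
move=> s0 c0; have [i e] := above_scale c0 (itg_gammaf s0).
have E t : c `^ (1 - s) * above 0 (fun t => gammaf s (c * t)) t =
    above 0 (fun t => t `^ (s - 1) * expR (- (c * t))) t.
  rewrite /above; case: ltP => t0; last by rewrite mulr0.
  rewrite /gammaf powRM ?(ltW t0) ?(ltW c0)// !mulrA -powRDp//.
  by rewrite addrC subrKA subrr powRr0 mul1r.
split; first exact: eq_itg E (itgZ _ i).
rewrite -(eq_intR E) (intRZ _ i) e -Gamma_posE mulrA; congr (_ * _).
rewrite -[c^-1]powR_inv1 ?(ltW c0)// -powRDp//; congr powR; lra.
Qed.

End limit_integral.

(** * The Gaussian and the Mellin constant *)

Section gaussian.
Context {R : realType}.
Local Notation mu := (@lebesgue_measure R).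
Local Notation intR f := (Rintegral mu setT f).
Implicit Types (a b c e l p q r s u v w x y z : R) (g h psi trig : R -> R).

Lemma aboveT w g u : w < u -> above w g u = g u.
Proof. by rewrite /above => ->. Qed.

Lemma aboveF w g u : u <= w -> above w g u = 0.
Proof. by rewrite /above ltNge => ->. Qed.

Lemma intR0 : intR (fun=> 0) = 0.
Proof. by rewrite Rintegral_cst// mul0r. Qed.

Lemma drv_intR (f f' : R -> R -> R) (G : R -> R) c : (forall x, itg (f x)) ->
  (forall x y, drv (f^~ y) x (f' x y)) -> itg G ->
  (forall x y, `|f' x y| <= G y) ->
  drv (fun x => intR (f x)) c (intR (f' c)).
Proof.
move=> f_ ff' G_ fG.
have dE x y : partial1of2 f x y = f' x y.
  by rewrite partial1of2E; exact: (@derive_val _ _ _ _ _ _ _ (ff' x y)).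
have G0 y : 0 <= G y by exact: le_trans (normr_ge0 _) (fG 0 y).
have H : h^-1 *: (intR (f (h + c)) - intR (f c)) @[h --> 0^'] --> intR (f' c).
  have -> : intR (f' c) = intR (partial1of2 f c).
    by apply: eq_intR => y; rewrite dE.
  apply: (@cvg_differentiation_under_integral R _ _ mu f setT measurableT c (c - 1) (c + 1)
     _ _ _ G) => //.
  - by rewrite /= in_itv/=; apply/andP; split; lra.
  - by move=> x _; exact: f_.
  - by move=> x y _ _; have [] := ff' x y.
  - by move=> x y _ _; rewrite dE.
have H' : h^-1 *: (((fun x => intR (f x)) \o shift c) (h *: (1 : R^o)) - intR (f c))
   @[h --> 0^'] --> intR (f' c).
  apply: cvg_trans H; apply: near_eq_cvg; apply: nearW => t /=.
  by rewrite /GRing.scale/= mulr1.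
apply: DeriveDef; first by apply/cvg_ex; exists (intR (f' c)); exact: H'.
by apply/cvg_lim => //; exact: H'.
Qed.

Lemma pow_expRN (n : nat) v : 0 <= v -> v ^+ n * expR (- v) <= n`!%:R.
Proof.
move=> v0; have f0 : 0 < n`!%:R :> R by rewrite ltr0n fact_gt0.
rewrite expRN ler_pdivrMr ?expR_gt0// mulrC -ler_pdivrMr//.
case: n f0 => [|n] f0; last by apply: le_trans (expR_ge1Dxn n v0); rewrite lerDr.
by rewrite expr0 fact0 divr1 -expR0 ler_expR.
Qed.

Lemma gauss_bound u : expR (- u ^+ 2) <= 4 / (1 + u ^+ 2) ^+ 2.
Proof.
have u0 : 0 <= u ^+ 2 by exact: sqr_ge0.
have p := oneDsqr_pos u; rewrite expRN ler_pdivlMr ?exprn_gt0//.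
rewrite mulrC ler_pdivrMr ?expR_gt0//.
(* Squaring [1 + y / 2 <= expR (y / 2)] gives [(1 + y)^2 <= 4 expR y] for [y = u^2]. *)
have h1 := expR_ge1Dx (u ^+ 2 / 2).
have -> : expR (u ^+ 2) = expR (u ^+ 2 / 2) ^+ 2 by rewrite -expRM_natl mulrC divfK.
by move: h1 u0; set E := expR _; set y := u ^+ 2; nra.
Qed.

Let gb (t : R -> R) u : `|t u| <= 1 + u ^+ 2 ->
  `|t u * expR (- u ^+ 2)| <= 4 / (1 + u ^+ 2).
Proof.
move=> tu; rewrite normrM (ger0_norm (expR_ge0 _)).
have p := oneDsqr_pos u.
apply: (@le_trans _ _ ((1 + u ^+ 2) * (4 / (1 + u ^+ 2) ^+ 2))).
  by apply: ler_pM => //; rewrite ?expR_ge0//; exact: gauss_bound.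
by rewrite le_eqVlt; apply/orP; left; apply/eqP; field; rewrite gt_eqF.
Qed.

Lemma measurable_gauss : measurable_fun setT (fun u : R => expR (- u ^+ 2)).
Proof. exact: measurable_gauss_fun. Qed.

Lemma itg_gauss (t : R -> R) : measurable_fun setT t ->
  (forall u, `|t u| <= 1 + u ^+ 2) -> itg (fun u => t u * expR (- u ^+ 2)).
Proof.
move=> mt t1; apply: (itg_oneDsqrP (C := 4)).
  by apply: measurable_funM => //; exact: measurable_gauss.
by move=> u; exact: gb.
Qed.

Lemma qdecay_gauss w (t : R -> R) : (forall u, `|t u| <= 1 + u ^+ 2) ->
  qdecay w (fun u => t u * expR (- u ^+ 2)).
Proof. by move=> t1; exists 4 => u _; exact: gb. Qed.

Let cos_b c u : `|cos (c * u)| <= 1 + u ^+ 2.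
Proof. by rewrite (le_trans (normr_cos_le1 _))// lerDl sqr_ge0. Qed.

Let sin_b c u : `|sin (c * u)| <= 1 + u ^+ 2.
Proof. by rewrite (le_trans (normr_sin_le1 _))// lerDl sqr_ge0. Qed.

Let norm_b u : `|u| <= 1 + u ^+ 2.
Proof.
rewrite -[u ^+ 2]ger0_norm ?sqr_ge0// normrX.
by have := sqr_ge0 (`|u| - 1); have := normr_ge0 u; nra.
Qed.

Let usin_b c u : `|sin (c * u) * u| <= 1 + u ^+ 2.
Proof.
rewrite normrM; apply: le_trans (norm_b u).
by rewrite ler_piMl// normr_sin_le1.
Qed.

Let Fg c := intR (fun u => cos (c * u) * expR (- u ^+ 2)).
Let Sg c := intR (fun u => sin (c * u) * u * expR (- u ^+ 2)).

Let itg_Fg c : itg (fun u => cos (c * u) * expR (- u ^+ 2)).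
Proof. by apply: itg_gauss; [exact: measurable_cosM|exact: cos_b]. Qed.

Let itg_Sg c : itg (fun u => sin (c * u) * u * expR (- u ^+ 2)).
Proof.
apply: itg_gauss; last exact: usin_b.
by apply: measurable_funM => //; exact: measurable_sinM.
Qed.

Let drv_cM (f : R -> R) (df : R -> R) r u : (forall y, drv f y (df y)) ->
  drv (fun y => f (r * y)) u (df (r * u) * r).
Proof.
move=> fdf; apply: drv_eq (drv_comp (fdf _) (drvZ r (drv_id u))) _.
by rewrite mulr1.
Qed.

Let drv_gauss u : drv (fun y => expR (- y ^+ 2)) u (- (2 * u) * expR (- u ^+ 2)).
Proof.
have := @drv_comp R (fun y => expR (- y)) (fun y => y ^+ 2) u _ _ (drv_expRN _) (drv_sqr u).
by move/drv_eq; apply; ring.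
Qed.

Let drv_Fg c : drv Fg c (- Sg c).
Proof.
have := @drv_intR (fun c u => cos (c * u) * expR (- u ^+ 2))
  (fun c u => (-1) * (sin (c * u) * u * expR (- u ^+ 2)))
  (fun u => `|u * expR (- u ^+ 2)|) c itg_Fg.
rewrite intRZ// mulN1r; apply.
- move=> x y; have dcos := @drv_comp R cos (fun x => x * y) x _ _ (is_derive_cos _)
    (drvM (drv_id x) (drv_cst y x)).
  have := drvM dcos (drv_cst (expR (- y ^+ 2)) x).
  by move/drv_eq; apply; ring.
- by apply/itg_norm/itg_gauss => //; exact: norm_b.
- move=> x y; rewrite mulN1r normrN -mulrA normrM ler_piMl//.
  exact: normr_sin_le1.
Qed.

(** Integration by parts for [sin (c u) expR (- u^2)]. Its derivative is even and the function
    vanishes at 0, so the half-line theorem at 0 settles both halves. *)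
Let Sg_rec c : 2 * Sg c = c * Fg c.
Proof.
pose F u := sin (c * u) * expR (- u ^+ 2).
pose dF u := c * (cos (c * u) * expR (- u ^+ 2)) +
  (-2) * (sin (c * u) * u * expR (- u ^+ 2)).
have dFE u : drv F u (dF u).
  have := drvM (drv_cM c u (@is_derive_sin R)) (drv_gauss u).
  by move/drv_eq; apply; rewrite /dF; ring.
have qF : qdecay 0 F by apply: qdecay_gauss; exact: sin_b.
have qdF : qdecay 0 dF.
  by apply: qdecayD; apply: qdecayZ; apply: qdecay_gauss; [exact: cos_b|exact: usin_b].
have dF_ : itg dF by apply: itgD; apply: itgZ.
have [i0 e0] := ftc_half (fun u _ => dFE u) qF qdF.
have n1 : (-1 : R) != 0 by rewrite oppr_eq0 oner_eq0.
have iN := itg_affine 0 n1 i0.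
have dFN u : dF (- u) = dF u by rewrite /dF !mulrN cosN sinN sqrrN; ring.
have : intR dF = 0.
  transitivity (intR (fun u => above 0 dF u + above 0 dF (-1 * u + 0))).
    apply: ae_intR; [exact: itg_measurable|exact: itg_measurable (itgD i0 iN)|].
    move=> u u0; rewrite /above addr0 mulN1r oppr_gt0 dFN.
    by case: ltgtP u0 => // _ _; rewrite ?addr0 ?add0r.
  rewrite (intRD i0 iN) (intR_affine 0 n1 i0) e0 /F mulr0 sin0 mul0r oppr0.
  by rewrite mulr0 addr0.
rewrite /dF (intRD (itgZ _ (itg_Fg c)) (itgZ _ (itg_Sg c))) (intRZ _ (itg_Fg c)).
rewrite (intRZ _ (itg_Sg c)) -/(Fg c) -/(Sg c); lra.
Qed.

Lemma intR_gauss : intR (fun u => expR (- u ^+ 2)) = Num.sqrt pi.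
Proof.
have i : itg (fun u : R => expR (- u ^+ 2)) by exact: integrableT_gauss.
apply: EFin_inj; rewrite (EFin_intR i).
exact: integralT_gauss.
Qed.

(** The transform solves [Fg' = - c Fg / 2], so [Fg c * expR (c^2 / 4)] is constant; its value at 0
    is the Gauss integral. *)
Lemma gauss_fourier c :
  intR (fun u => cos (c * u) * expR (- u ^+ 2)) = Num.sqrt pi * expR (- (c ^+ 2 / 4)).
Proof.
rewrite -/(Fg c).
pose Phi x := Fg x * expR (x ^+ 2 / 4).
have dPhi x : drv Phi x 0.
  have dsq := drvM (drv_sqr x) (drv_cst (4^-1) x).
  have := drvM (drv_Fg x) (@drv_comp R expR (fun y => y ^+ 2 / 4) x _ _ (is_derive_expR _) dsq).
  move/drv_eq; apply; have -> : Sg x = x * Fg x / 2 by rewrite -Sg_rec mulrC mulKf.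
  by field.
have Phi0 x : 0 < x -> Phi x = Phi 0.
  move=> x0; have [z _] := @mvt R Phi (fun=> 0) 0 x x0 (fun z _ _ => dPhi z).
  by rewrite mul0r => /eqP; rewrite subr_eq0 => /eqP.
have FgN x : Fg (- x) = Fg x by apply: eq_intR => u; rewrite mulNr cosN.
have Fg0 : Phi 0 = Num.sqrt pi.
  rewrite /Phi expr0n mul0r expR0 mulr1 -intR_gauss.
  by apply: eq_intR => u; rewrite mul0r cos0 mul1r.
have PhiE : Phi c = Num.sqrt pi.
  rewrite -Fg0; have [c0|c0|->//] := ltgtP c 0; last exact: Phi0.
  rewrite -(Phi0 (- c)) ?oppr_gt0//.
  by rewrite /Phi FgN sqrrN.
by rewrite -PhiE /Phi -mulrA -expRD subrr expR0 mulr1.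
Qed.

Lemma Uiter_gauss xs w : Uiter xs (fun w => expR (- w)) w =
  Num.sqrt pi ^+ size xs * expR (- ((\sum_(y <- xs) y ^+ 2) / 4)) * expR (- w).
Proof.
elim: xs w => [|x xs IH] w /=.
  by rewrite big_nil mul0r oppr0 expR0 expr0 !mul1r.
rewrite /Uop; set A := _ * _ in IH.
transitivity (intR (fun u => A * expR (- w) * (cos (x * u) * expR (- u ^+ 2)))).
  by apply: eq_intR => u; rewrite IH opprD expRD; ring.
rewrite (intRZ _ (itg_Fg x)) gauss_fourier /A big_cons mulrDl opprD expRD.
by rewrite (exprS (Num.sqrt pi)); ring.
Qed.

(** The density that the Taylor formula attaches to [expR (- w)]: the sign of the derivative of
    order [m + 1] cancels those of the formula. *)
Definition exph (m : nat) := above 0 (fun v => m`!%:R^-1 * expR (- v)).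

Lemma hat_exph (m : nat) w : (0 < m)%N -> 0 <= w ->
  hat (exph m) (pospow m%:R) w = expR (- w).
Proof.
move=> m0 w0; have m0R : 0 < m%:R :> R by rewrite ltr0n.
pose G (j : nat) v := (-1) ^+ j * expR (- v).
have dG (j : nat) v : drv (G j) v (G j.+1 v).
  have := drvZ ((-1) ^+ j) (drv_expRN v); move/drv_eq; apply.
  by rewrite /G exprS; ring.
have qG (i j : nat) : qdecay w (fun v => v ^+ i * G j v).
  exists (i`!%:R + i.+2`!%:R) => v wv; have v0 := le_trans w0 wv.
  rewrite mulrCA normrM normrX normrN1 expr1n mul1r normrM normrX (ger0_norm v0).
  rewrite (ger0_norm (expR_ge0 _)) ler_pdivlMr ?oneDsqr_pos// mulrDr mulr1.
  apply: lerD; first exact: pow_expRN.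
  by rewrite mulrAC -exprD addn2 pow_expRN.
have [i e] := taylor_integral w0 (fun j v _ _ => dG j v) (fun j _ => qG j j) (qG m m.+1) m0.
have -> : expR (- w) = G 0%N w by rewrite /G expr0 mul1r.
rewrite e -[RHS]mulN1r -(intRZ _ i) /hat.
apply: eq_intR => v; rewrite /exph /above; case: (ltP w v) => wv; last first.
  by rewrite !(mulr0, mul0r) pospow_neg ?subr_le0// mulr0.
rewrite (le_lt_trans w0 wv) /G /taylor_coef exprS.
have : (-1) ^+ m * (-1) ^+ m = 1 :> R by rewrite -exprMn mulrNN mulr1 expr1n.
set e1 := (-1) ^+ m; set i1 := m`!%:R^-1; set P := pospow _ _; set E := expR _ => ee.
have -> : -1 * (e1 * i1 * (-1 * e1 * E) * P) = (e1 * e1) * (i1 * E * P) by ring.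
by rewrite ee mul1r.
Qed.

Lemma weighted_exph (m n : nat) : (0 < m)%N -> weighted (exph m) m%:R n.
Proof.
move=> m0; split.
  apply: measurable_above => u u0.
  exact: (drv_continuous (drvZ m`!%:R^-1 (drv_expRN u))).
move=> j _; have s0 : 0 < m%:R + j%:R / 2 + 1 :> R.
  by rewrite ltr_wpDl// addr_ge0// divr_ge0.
apply: eq_itg (itgZ (m`!%:R^-1) (itg_gammaf s0)) => v.
rewrite /exph /above; case: ltP => v0; last by rewrite mulr0 mul0r.
by rewrite /gammaf addrK pospow_pos ?(ltW v0)// -mulrA [expR _ * _]mulrC.
Qed.

Lemma measurable_Icos_sqrt l : measurable_fun setT (fun q => Icos l (Num.sqrt q)).
Proof.
have m1 : measurable_fun setT (Icos l).
  apply: (measurable_intR (f := fun r u => cos (r * u) * pospow l (1 - u ^+ 2))).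
  apply: measurable_funM.
    apply: (measurable_compR measurable_cos).
    by apply: measurable_funM; [exact: measurable_fst|exact: measurable_snd].
  apply: (measurable_compR (measurable_pospow l)); apply: measurable_funB => //.
  by apply: measurable_funX; exact: measurable_snd.
apply: (measurable_compR m1); apply: continuous_measurable_fun.
exact: sqrt_continuous.
Qed.

(** With [q = r^2] this is twice the integral of [r^(2 a - 1) Icos l r]; since [Icos l r = O(r^-l)],
    it converges for [0 < 2 a < l]. *)
Definition mellin a l := intR (above 0 (fun q => q `^ (a - 1) * Icos l (Num.sqrt q))).

Lemma itg_mellin a l : 0 < a -> 2 * a < l ->
  itg (above 0 (fun q => q `^ (a - 1) * Icos l (Num.sqrt q))).
Proof.
move=> a0 al; have l0 : 0 < l by lra.
have [C C0 HC] := Icos_decay l0.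
apply: (@itg_between _ _ a (l / 2 - a) C) => //; first by lra.
- apply: (eq_measurable_fun (fun q => above 0 (fun q => q `^ (a - 1)) q * Icos l (Num.sqrt q))).
    by move=> q _; rewrite aboveM.
  apply: measurable_funM; first exact: measurable_above_powR.
  exact: measurable_Icos_sqrt.
- move=> q q0; rewrite normrM (ger0_norm (powR_ge0 _ _)) mulrC ler_wpM2r ?powR_ge0//.
  have := HC 0 (Num.sqrt q); rewrite oppr0 powRr0 mulr1; apply; last by rewrite sqrtr_gt0.
  by rewrite lexx ltW.
move=> q q0; rewrite normrM (ger0_norm (powR_ge0 _ _)).
have sq0 : 0 < Num.sqrt q by rewrite sqrtr_gt0.
have := HC l (Num.sqrt q); rewrite lexx (ltW l0) => /(_ isT sq0) Hq.
apply: le_trans (ler_wpM2l (powR_ge0 _ _) Hq) _.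
rewrite mulrCA ler_wpM2l// -powR_half ?(ltW q0)// -powRrM -powRDp//.
by rewrite le_eqVlt; apply/orP; left; apply/eqP; congr powR; lra.
Qed.

Lemma powR_scale g a c : 0 < c -> itg (above 0 (fun q => q `^ (a - 1) * g q)) ->
  itg (above 0 (fun q => q `^ (a - 1) * g (c * q))) /\
  intR (above 0 (fun q => q `^ (a - 1) * g (c * q))) =
  c `^ (- a) * intR (above 0 (fun q => q `^ (a - 1) * g q)).
Proof.
move=> c0 g_; have [i e] := above_scale c0 g_.
have E q : c `^ (1 - a) * above 0 (fun q => (c * q) `^ (a - 1) * g (c * q)) q =
    above 0 (fun q => q `^ (a - 1) * g (c * q)) q.
  rewrite /above; case: ltP => q0; last by rewrite mulr0.
  rewrite powRM ?(ltW q0) ?(ltW c0)// !mulrA -powRDp//.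
  by rewrite addrC subrKA subrr powRr0 mul1r.
split; first exact: eq_itg E (itgZ _ i).
rewrite -(eq_intR E) (intRZ _ i) e mulrA; congr (_ * _).
rewrite -[c^-1]powR_inv1 ?(ltW c0)// -powRDp//; congr powR; lra.
Qed.

Lemma mellin_scale a l c : 0 < a -> 2 * a < l -> 0 < c ->
  itg (above 0 (fun q => q `^ (a - 1) * Icos l (Num.sqrt (c * q)))) /\
  intR (above 0 (fun q => q `^ (a - 1) * Icos l (Num.sqrt (c * q)))) =
  c `^ (- a) * mellin a l.
Proof.
by move=> a0 al c0; exact: (powR_scale (g := fun q => Icos l (Num.sqrt q)) c0 (itg_mellin a0 al)).
Qed.

Lemma Icos_le_cpow l r : 0 < l -> `|Icos l r| <= cpow l.
Proof.
move=> l0; rewrite /cpow /Icos /Vop; apply: normr_intR_le.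
- exact: itg_Icos.
- exact: itg_Icos.
move=> u; rewrite mul0r cos0 mul1r normrM (ger0_norm (pospow_ge0 _ _)).
by rewrite ler_piMl ?pospow_ge0// normr_cos_le1.
Qed.

Lemma itg_laplace s l q : 0 < s -> 0 < l ->
  itg (above 0 (fun v => gammaf s v * Icos l (Num.sqrt (q * v)))).
Proof.
move=> s0 l0; have E v : above 0 (gammaf s) v * Icos l (Num.sqrt (q * v)) =
    above 0 (fun v => gammaf s v * Icos l (Num.sqrt (q * v))) v by rewrite aboveM.
apply: (eq_itg E); apply: (itg_le _ _ (itgZ (cpow l) (itg_norm (itg_gammaf s0)))).
  apply: measurable_funM; first exact: (itg_measurable (itg_gammaf s0)).
  apply: (measurable_compR (measurable_Icos_sqrt l)).
  exact: measurable_funM.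
by move=> v; rewrite normrM mulrC ler_wpM2r// Icos_le_cpow.
Qed.

Lemma sum_sqr_nseq0 q (n : nat) : \sum_(y <- q :: nseq n 0) y ^+ 2 = q ^+ 2.
Proof. by rewrite big_cons big_nseq iter_addr_0 expr0n mul0rn addr0. Qed.

(* The Fourier integral of [expR (- |xi|^2)], computed through the Taylor representation. *)
Lemma laplace_Icos (m n : nat) q : (0 < m)%N -> 0 < q ->
  cpows m%:R n / m`!%:R * intR (above 0 (fun v =>
    gammaf (m%:R + n%:R / 2 + 2^-1 + 1) v * Icos (m%:R + n%:R / 2) (Num.sqrt (q * v)))) =
  Num.sqrt pi ^+ n.+1 * expR (- (q / 4)).
Proof.
move=> m0 q0; have m0R : 0 < m%:R :> R by rewrite ltr0n.
set l := m%:R + n%:R / 2; have l0 : 0 < l by rewrite ltr_wpDr// divr_ge0.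
(* Only the norm of the frequency matters, so all coordinates but one are set to 0. *)
pose xs := Num.sqrt q :: nseq n 0.
have sxs : size xs = n.+1 by rewrite /= size_nseq.
have := @Uiter_gauss xs 0.
rewrite oppr0 expR0 mulr1 sxs sum_sqr_nseq0 sqr_sqrtr ?(ltW q0)// => <-.
rewrite -(@eq_Uiter _ xs _ _ 0 (fun w (H : 0 <= w) => hat_exph m0 H) 0 (lexx 0)).
rewrite (Uiter_hat m0R (dominated_pospow _) (weighted_exph _ m0))//.
have l20 : 0 < l + 2^-1 + 1 by lra.
rewrite /hat -intRZ; last exact: itg_laplace.
apply: eq_intR => v; rewrite subr0 /xs Viter_rot// size_nseq -/l sum_sqr_nseq0.
rewrite sqrtr_sqr (ger0_norm (sqrtr_ge0 _)).
rewrite /exph /above; case: ltP => v0; last by rewrite mulr0 mul0r.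
rewrite Vop_scale// -/(Icos _ _) /gammaf addrK -sqrtrM ?(ltW q0)//.
ring.
Qed.

(** Integrate [laplace_Icos] against [q^(a - 1)]. On the left, Fubini and scaling in [q] give
    [v^(- a)] times the Mellin transform, and the [v]-integral becomes a Gamma integral at [s - a].
    On the right stands a Gamma integral with scale [1 / 4], hence [4^a]. *)
Lemma mellin_const (m n : nat) a : (0 < m)%N -> 0 < a -> 2 * a < m%:R + n%:R / 2 ->
  cpows m%:R n / m`!%:R * mellin a (m%:R + n%:R / 2) *
    Gamma_pos (m%:R + n%:R / 2 + 2^-1 + 1 - a) =
  Num.sqrt pi ^+ n.+1 * (4 `^ a * Gamma_pos a).
Proof.
move=> m0 a0 al; have m0R : 0 < m%:R :> R by rewrite ltr0n.
have p4 : 4 `^ a = (4^-1) `^ (- a) :> R.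
  by rewrite -[4^-1]powR_inv1 ?ler0n// -powRrM mulrNN mul1r.
set l := m%:R + n%:R / 2 in al *; have l0 : 0 < l by lra.
set s := l + 2^-1 + 1; have s0 : 0 < s - a by rewrite /s; lra.
have s1 : 0 < s by rewrite /s; lra.
pose J q := Icos l (Num.sqrt q).
pose f v q := above 0 (gammaf s) v * (above 0 (fun q => q `^ (a - 1)) q * J (v * q)).
pose N0 := intR (above 0 (fun q => q `^ (a - 1) * `|J q|)).
have fE v q : f v q = above 0 (gammaf s) v *
    above 0 (fun q => q `^ (a - 1) * J (v * q)) q by rewrite /f aboveM.
have gE v : 0 < v -> gammaf s v * v `^ (- a) = gammaf (s - a) v.
  by move=> v0; rewrite /gammaf mulrAC -powRDp//; congr (_ `^ _ * _); lra.
have f0 v : v <= 0 -> f v = fun=> 0.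
  by move=> v0; apply/funext => q; rewrite /f /above ltNge v0 mul0r.
have outer q : intR (f^~ q) = above 0 (fun q => q `^ (a - 1) *
    intR (above 0 (fun v => gammaf s v * Icos l (Num.sqrt (q * v))))) q.
  rewrite [RHS]/above; case: ltP => q0; last first.
    rewrite -[RHS]intR0; apply: eq_intR => v.
    by rewrite /f /above (ltNge 0 q) q0 /= mul0r mulr0.
  rewrite -(intRZ _ (itg_laplace _ s1 l0)).
  apply: eq_intR => v; rewrite /f /above q0.
  by case: ifP => _; rewrite ?mul0r ?mulr0// mulrCA /J (mulrC v).
have f_ v : itg (f v).
  have [v0|v0] := leP v 0.
    apply: eq_itg (itgZ 0 (itg_oneDsqrV)) => q.
    by rewrite mul0r f0.
  have [i _] := mellin_scale a0 al v0.
  by apply: eq_itg (itgZ (above 0 (gammaf s) v) i) => q; rewrite fE.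
have inner v : intR (f v) = mellin a l * above 0 (gammaf (s - a)) v.
  have [v0|v0] := leP v 0.
    by rewrite f0// Rintegral_cst// mul0r /above ltNge v0 mulr0.
  have [i e] := mellin_scale a0 al v0.
  rewrite (eq_intR (fE v)) (intRZ _ i) e /above v0 -(gE v v0).
  by rewrite mulrA mulrC.
have nJ_ : itg (above 0 (fun q => q `^ (a - 1) * `|J q|)).
  apply: eq_itg (itg_norm (itg_mellin a0 al)) => q; rewrite /above.
  by case: ifP => _; rewrite ?normr0// normrM (ger0_norm (powR_ge0 _ _)).
have [_ i2 e] : [/\ itg (fun v => intR (f v)), itg (fun q => intR (f^~ q)) &
      intR (fun v => intR (f v)) = intR (fun q => intR (f^~ q))].
  apply: (@fubiniR _ f (fun v => N0 * above 0 (gammaf (s - a)) v)) => //.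
  - apply: measurable_funM.
      apply: (measurable_compR (itg_measurable (itg_gammaf s1))).
      exact: measurable_fst.
    apply: measurable_funM.
      exact: (measurable_compR (measurable_above_powR (a - 1)) measurable_snd).
    apply: (measurable_compR (measurable_Icos_sqrt l)).
    by apply: measurable_funM; [exact: measurable_fst|exact: measurable_snd].
  - exact/itgZ/itg_gammaf.
  - move=> v; have [v0|v0] := leP v 0.
      rewrite f0// (_ : (fun q => _) = fun=> 0); last by apply/funext => q; rewrite normr0.
      by rewrite Rintegral_cst// mul0r /above ltNge v0 mulr0.
    have [i e] := powR_scale v0 nJ_.
    rewrite le_eqVlt; apply/orP; left; apply/eqP.
    transitivity (intR (fun q => gammaf s v *
        above 0 (fun q => q `^ (a - 1) * `|J (v * q)|) q)).
      apply: eq_intR => q; rewrite fE /above v0 normrM (ger0_norm (gammaf_ge0 _ _)).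
      by case: ifP => _; rewrite ?normr0// normrM (ger0_norm (powR_ge0 _ _)).
    by rewrite (intRZ _ i) e /above v0 -(gE v v0) -/N0 mulrA mulrC.
have LHSE : intR (fun v => intR (f v)) = mellin a l * Gamma_pos (s - a).
  by rewrite (eq_intR inner) (intRZ _ (itg_gammaf s0)) Gamma_posE.
rewrite -mulrA -LHSE e.
have q4 : 0 < 4^-1 :> R by rewrite invr_gt0.
have [ig eg] := Gamma_pos_scale a0 q4.
rewrite p4 -eg -(intRZ _ ig) -(intRZ _ i2).
apply: eq_intR => q; rewrite outer; have [q0|q0] := leP q 0.
  by rewrite !(aboveF _ q0) !mulr0.
by rewrite !(aboveT _ q0) mulrCA (laplace_Icos n m0 q0) (mulrC 4^-1) mulrCA.
Qed.

End gaussian.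

(** * Symbol estimates *)

Section symbols.
Context {R : realType}.
Implicit Types (a b c e l p q r s t u v w x y z : R) (f g om : R -> R) (k j n : nat).

(* [sym k om f]: on the positive half-line [f] is [k] times differentiable and
   its [j]-th derivative is [O(om v / v ^ j)], for [j <= k]. *)
Fixpoint sym k om f : Prop :=
  (exists C, forall v, 0 < v -> `|f v| <= C * om v) /\
  if k is k'.+1 then exists2 g, (forall v, 0 < v -> drv f v (g v)) &
    sym k' (fun v => om v / v) g
  else True.

Lemma symS k om f : sym k.+1 om f -> sym k om f.
Proof.
by elim: k om f => [|k IH] om f [fC [g fg gk]]; split => //; exists g => //; exact: IH.
Qed.

Lemma sym_weight k om om' f : (forall v, 0 < v -> om v = om' v) ->
  sym k om f -> sym k om' f.
Proof.
elim: k om om' f => [|k IH] om om' f omE [[C fC] fk]; split => //.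
- by exists C => v v0; rewrite -omE// fC.
- by exists C => v v0; rewrite -omE// fC.
case: fk => g fg gk; exists g => //; apply: IH gk => v v0.
by rewrite omE.
Qed.

Lemma sym_weaken k om om' f D : 0 <= D ->
  (forall v, 0 < v -> 0 <= om v <= D * om' v) -> sym k om f -> sym k om' f.
Proof.
move=> D0; elim: k om om' f => [|k IH] om om' f omD [[C fC] fk].
  split => //; exists (`|C| * D) => v v0.
  have /andP[om1 om2] := omD v v0.
  apply: le_trans (fC v v0) _; apply: (@le_trans _ _ (`|C| * om v)).
    by rewrite ler_wpM2r// ler_norm.
  by rewrite -mulrA ler_wpM2l.
split.
  exists (`|C| * D) => v v0.
  have /andP[om1 om2] := omD v v0.
  apply: le_trans (fC v v0) _; apply: (@le_trans _ _ (`|C| * om v)).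
    by rewrite ler_wpM2r// ler_norm.
  by rewrite -mulrA ler_wpM2l.
case: fk => g fg gk; exists g => //; apply: IH gk => v v0.
have /andP[om1 om2] := omD v v0.
by rewrite divr_ge0 ?(ltW v0)//= mulrA ler_wpM2r// invr_ge0 ltW.
Qed.

Let nbhs_pos v : 0 < v -> \forall y \near v, 0 < y.
Proof. exact: lt_nbhsr. Qed.

Lemma symD k om f g : sym k om f -> sym k om g -> sym k om (fun v => f v + g v).
Proof.
elim: k om f g => [|k IH] om f g [[C fC] fk] [[D gD] gk].
  split => //; exists (C + D) => v v0; rewrite mulrDl.
  exact: le_trans (ler_normD _ _) (lerD (fC v v0) (gD v v0)).
split.
  exists (C + D) => v v0; rewrite mulrDl.
  exact: le_trans (ler_normD _ _) (lerD (fC v v0) (gD v v0)).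
case: fk => f' ff' fk; case: gk => g' gg' gk.
exists (fun v => f' v + g' v); last exact: IH.
by move=> v v0; apply: drvD; [exact: ff'|exact: gg'].
Qed.

Lemma symM k om om' f g : sym k om f -> sym k om' g ->
  sym k (fun v => om v * om' v) (fun v => f v * g v).
Proof.
elim: k om om' f g => [|k IH] om om' f g fk gk.
  case: fk => [[C fC] _]; case: gk => [[D gD] _]; split => //.
  exists (C * D) => v v0; rewrite normrM mulrACA.
  by apply: ler_pM => //; [exact: fC|exact: gD].
have fk0 := symS fk; have gk0 := symS gk.
case: fk => [[C fC] [f' ff' fk]]; case: gk => [[D gD] [g' gg' gk]]; split.
  exists (C * D) => v v0; rewrite normrM mulrACA.
  by apply: ler_pM => //; [exact: fC|exact: gD].
exists (fun v => f' v * g v + f v * g' v).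
  by move=> v v0; apply: drvM; [exact: ff'|exact: gg'].
apply: symD.
  by apply: sym_weight (IH _ _ _ _ fk gk0) => v v0; rewrite mulrAC.
by apply: sym_weight (IH _ _ _ _ fk0 gk) => v v0; rewrite mulrA.
Qed.

Lemma sym_powR k c s : sym k (fun v => v `^ s) (fun v => c * v `^ s).
Proof.
elim: k c s => [|k IH] c s.
  by split => //; exists `|c| => v v0; rewrite normrM (ger0_norm (powR_ge0 _ _)).
split; first by exists `|c| => v v0; rewrite normrM (ger0_norm (powR_ge0 _ _)).
exists (fun v => (c * s) * v `^ (s - 1)).
  move=> v v0; apply: drv_eq (drvZ c (is_derive1_powR s v0)) _.
  by rewrite mulrA.
apply: sym_weight (IH (c * s) (s - 1)) => v v0.
by rewrite powRDp// powR_inv1// ltW.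
Qed.

Lemma symZ k om c f : sym k om f -> sym k om (fun v => c * f v).
Proof.
elim: k om f => [|k IH] om f [[C fC] fk].
  by split => //; exists (`|c| * C) => v v0; rewrite normrM -mulrA ler_wpM2l// fC.
split; first by exists (`|c| * C) => v v0; rewrite normrM -mulrA ler_wpM2l// fC.
case: fk => g fg gk; exists (fun v => c * g v); last exact: IH.
by move=> v v0; apply: drvZ; exact: fg.
Qed.

(** The chain rule factor [1 / (2 sqrt v)] combines with the loss [1 / sqrt v] of the weight into
    the loss [1 / v]. *)
Lemma sym_sqrt k om f : sym k om f ->
  sym k (fun v => om (Num.sqrt v)) (fun v => f (Num.sqrt v)).
Proof.
elim: k om f => [|k IH] om f [[C fC] fk].
  by split => //; exists C => v v0; rewrite fC// sqrtr_gt0.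
split; first by exists C => v v0; rewrite fC// sqrtr_gt0.
case: fk => g fg gk.
exists (fun v => g (Num.sqrt v) * (2^-1 * v `^ (- 2^-1))).
  move=> v v0; have sv0 : 0 < Num.sqrt v by rewrite sqrtr_gt0.
  apply: drv_eq (@drv_comp R f Num.sqrt v _ _ (fg _ sv0) (is_derive1_sqrt v0)) _.
  by rewrite powRN powR_half ?(ltW v0)// invfM.
apply: sym_weight (symM (IH _ _ gk) (sym_powR k 2^-1 (- 2^-1))) => v v0.
rewrite powRN powR_half ?(ltW v0)// -mulrA -invfM -expr2.
by rewrite sqr_sqrtr// ltW.
Qed.

Lemma powR_le1D a v : 0 < a <= 1 -> 0 < v -> v `^ a <= 1 + v.
Proof.
move=> /andP[a0 a1] v0; have [v1|/ltW v1] := leP v 1.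
  apply: (@le_trans _ _ 1); last by lra.
  by rewrite -(one_powR a) ge0_ler_powR ?nnegrE ?(ltW a0) ?(ltW v0).
apply: (@le_trans _ _ (v `^ 1)); first by rewrite ler_powR.
by rewrite powRr1 ?(ltW v0)//; lra.
Qed.

(** Each derivative brings down a factor of size [v^a / v]. The growth [v^a <= 1 + v] is absorbed by
    one more power of [1 + v], so the induction needs the decay for all [n]; this is the use of
    [alpha < 2]. *)
Lemma sym_exp k t a E : 0 < a <= 1 ->
  (forall n, exists C, forall v, 0 < v -> expR (- t * E v) <= C * (1 + v) ^- n) ->
  sym k (fun v => v `^ a) E ->
  forall n, sym k (fun v => (1 + v) ^- n) (fun v => expR (- t * E v)).
Proof.
move=> /andP[a0 a1] eC; elim: k => [|k IH] Ek n.
  by split => //; have [C HC] := eC n; exists C => v v0; rewrite ger0_norm ?expR_ge0 ?HC.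
split; first by have [C HC] := eC n; exists C => v v0; rewrite ger0_norm ?expR_ge0 ?HC.
have eS := IH (symS Ek) n.+1.
case: Ek => _ [E' EE' E'k].
exists (fun v => (- t) * (E' v * expR (- t * E v))).
  move=> v v0.
  apply: drv_eq (@drv_comp R expR (fun v => - t * E v) v _ _ (is_derive_expR _)
    (drvZ (- t) (EE' v v0))) _.
  by rewrite mulrC mulrA.
apply: symZ; apply: sym_weaken (symM E'k eS) => [|v v0]; first exact: ler01.
have v1 : 0 < 1 + v by rewrite addr_gt0.
rewrite mul1r !mulr_ge0 ?powR_ge0 ?invr_ge0 ?exprn_ge0 ?(ltW v0) ?(ltW v1)//=.
have -> : v `^ a / v / (1 + v) ^+ n.+1 = (v `^ a / (1 + v)) * ((1 + v) ^- n / v).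
  by rewrite exprS; field; rewrite ?expf_neq0 ?gt_eqF.
rewrite ler_piMl ?divr_ge0 ?invr_ge0 ?exprn_ge0 ?(ltW v1) ?(ltW v0)//.
rewrite ler_pdivrMr// mul1r.
by apply: powR_le1D => //; rewrite a0.
Qed.

Definition fam k (G : nat -> R -> R) :=
  forall j v, (j < k)%N -> 0 < v -> drv (G j) v (G j.+1 v).

Lemma sym_fam k om f : sym k om f -> exists G : nat -> R -> R,
  [/\ G 0%N = f, fam k G & forall j, (j <= k)%N ->
    exists C, forall v, 0 < v -> `|G j v| <= C * (om v / v ^+ j)].
Proof.
elim: k om f => [|k IH] om f [[C fC] fk].
  exists (fun=> f); split => // j; rewrite leqn0 => /eqP ->.
  by exists C => v v0; rewrite expr0 divr1 fC.
case: fk => g fg /IH[G [G0 dG bG]].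
exists (fun j => if j is j'.+1 then G j' else f); split => //.
  by case=> [|j] v jk v0; [rewrite G0; exact: fg|exact: dG].
case=> [|j] jk; first by exists C => v v0; rewrite expr0 divr1 fC.
have [D HD] := bG j jk; exists D => v v0; apply: le_trans (HD v v0) _.
by rewrite exprS invfM [om v * (_ * _)]mulrA.
Qed.

(** [sym_fam] yields derivatives existentially; uniqueness lets families obtained separately be
    compared, given equality at order 0. *)
Lemma fam_unique k G G' : fam k G -> fam k G' ->
  (forall v, 0 < v -> G 0%N v = G' 0%N v) ->
  forall j v, (j <= k)%N -> 0 < v -> G j v = G' j v.
Proof.
move=> dG dG' G0; elim=> [|j IH] v jk v0; first exact: G0.
apply: (drv_unique (dG j v jk v0)); apply: drv_near (dG' j v jk v0).
near=> y; rewrite IH ?(ltnW jk)//; near: y; exact: nbhs_pos.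
Unshelve. all: by end_near. Qed.

Lemma famD k G G' : fam k G -> fam k G' -> fam k (fun j v => G j v + G' j v).
Proof. by move=> dG dG' j v jk v0; apply: drvD; [exact: dG|exact: dG']. Qed.

Definition powfam s j v := (\prod_(i < j) (s - i%:R)) * v `^ (s - j%:R).

Lemma fam_powfam k s : fam k (powfam s).
Proof.
move=> j v jk v0; apply: drv_eq (drvZ _ (is_derive1_powR (s - j%:R) v0)) _.
by rewrite /powfam big_ord_recr /= mulrA -addrA -opprD natr1.
Qed.

End symbols.

(** * Consequences of the hypotheses on [eta] *)

Section eta.
Context {R : realType}.
Variables (eta : R -> R) (k : nat) (alpha A : R).
Hypothesis eta_cont : {within `[0%R, +oo[, continuous eta}.
Hypothesis eta_der : forall m : nat, (m < k)%N -> forall r : R, 0 < r ->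
  derivable (derive1n m eta) r 1.
Hypothesis eta_inf : forall M : R, exists r0 : R, forall r : R, r0 < r -> M < eta r / ln r.
Hypothesis alpha0 : 0 < alpha.
Hypothesis eta_bound : forall m : nat, (m <= k)%N -> forall r : R, 0 < r ->
  `| r `^ (m%:R - alpha) * derive1n m eta r | <= A.
Implicit Types (r t v : R).

Lemma eta_sym : sym k (fun r => r `^ alpha) eta.
Proof.
have B j r : (j <= k)%N -> 0 < r -> `|derive1n j eta r| <= A * (r `^ alpha / r ^+ j).
  move=> jk r0; have := eta_bound jk r0.
  rewrite normrM (ger0_norm (powR_ge0 _ _)) (powRDp _ _ r0) powRN powR_mulrn ?(ltW r0)//.
  by rewrite mulrC -ler_pdivlMr ?divr_gt0 ?exprn_gt0 ?powR_gt0// invf_div.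
have H n j : (n + j = k)%N -> sym n (fun r => r `^ alpha / r ^+ j) (derive1n j eta).
  elim: n j => [|n IH] j njk.
    by split => //; exists A => r; apply: B; rewrite -njk leq_addl.
  split; first by exists A => r; apply: B; rewrite -njk leq_addl.
  exists (derive1n j.+1 eta).
    move=> r r0; apply: DeriveDef; first by apply: eta_der => //; rewrite -njk addSn ltnS leq_addl.
    by rewrite derive1nS derive1E.
  apply: sym_weight (IH j.+1 _) => [r r0|]; last by rewrite addnS.
  by rewrite exprS invfM mulrAC -mulrA.
have := H k 0%N (addn0 k); apply: sym_weight => r r0.
by rewrite expr0 divr1.
Qed.

Lemma eta_le r : 0 < r -> `|eta r| <= A * r `^ alpha.
Proof.
move=> r0; have := eta_bound (leq0n k) r0.
rewrite derive1n0 sub0r normrM (ger0_norm (powR_ge0 _ _)) powRN.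
by rewrite mulrC ler_pdivrMr ?powR_gt0.
Qed.

(** The bound of order 0, [|eta r| <= A r^alpha], forces this by continuity at 0; the factor
    [expR (- t * eta 0)] is thus 1. *)
Lemma eta0 : eta 0 = 0.
Proof.
have /continuous_within_itvcyP[_ c0] := eta_cont.
have lim0 : eta r @[r --> 0^'+] --> 0.
  apply: norm_cvg0.
  apply: (@squeeze_cvgr _ _ _ _ (cst 0) (fun r => A * r `^ alpha)).
  - near=> r; rewrite normr_ge0/= eta_le//; near: r; exact: nbhs_right_gt.
  - exact: cvg_cst.
  - have : A * r `^ alpha @[r --> 0^'+] --> A * 0.
      by apply: cvgM; [exact: cvg_cst|exact: powR_cvg0].
    by rewrite mulr0.
exact: cvg_unique c0 lim0.
Unshelve. all: by end_near. Qed.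

Lemma eta_bound_ge0 : 0 <= A.
Proof. by have := eta_bound (leq0n k) ltr01; apply: le_trans. Qed.

Lemma eta_exp_decay t n : 0 < t -> exists C, forall v, 0 < v ->
  expR (- t * eta (Num.sqrt v)) <= C * (1 + v) ^- n.
Proof.
(* This slope gives [expR (- t * eta r) <= r^(- 2 n) = v^(- n)] for large [r]. Taking [r1 >= 1]
   makes [ln r] positive beyond it and [1 + v <= 2 v], whence [2^n]; the other summand bounds the
   range [r <= r1]. *)
move=> t0; have [r0 Hr0] := eta_inf (2 * n%:R / t).
pose r1 := Num.max r0 1.
have r11 : 1 <= r1 by rewrite le_max lexx orbT.
have r1_gt0 : 0 < r1 by lra.
exists (2 ^+ n + expR (t * (A * r1 `^ alpha)) * (1 + r1 ^+ 2) ^+ n) => v v0.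
set r := Num.sqrt v; have r_gt0 : 0 < r by rewrite sqrtr_gt0.
have vE : v = r ^+ 2 by rewrite sqr_sqrtr// ltW.
have v1 : 0 < 1 + v by rewrite addr_gt0.
rewrite ler_pdivlMr ?exprn_gt0//.
have [rr|rr] := leP r r1.
  apply: (@le_trans _ _ (expR (t * (A * r1 `^ alpha)) * (1 + r1 ^+ 2) ^+ n)); last first.
    by rewrite lerDr exprn_ge0.
  apply: ler_pM; rewrite ?expR_ge0 ?exprn_ge0 ?(ltW v1)//.
    rewrite ler_expR mulNr -mulrN ler_pM2l//.
    apply: le_trans (ler_norm _) _; rewrite normrN.
    apply: le_trans (eta_le r_gt0) _; rewrite ler_wpM2l ?eta_bound_ge0//.
    by rewrite ge0_ler_powR ?nnegrE ?(ltW alpha0) ?(ltW r_gt0) ?(ltW r1_gt0).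
  rewrite lerXn2r ?nnegrE ?addr_ge0 ?sqr_ge0 ?(ltW v0)//.
  by rewrite lerD2l vE lerXn2r ?nnegrE ?(ltW r_gt0) ?(ltW r1_gt0).
apply: (@le_trans _ _ (2 ^+ n)); last first.
  by rewrite lerDl mulr_ge0 ?expR_ge0 ?exprn_ge0 ?addr_ge0 ?sqr_ge0.
have rr0 : r0 < r by rewrite (le_lt_trans _ rr)// le_max lexx.
have r_gt1 : 1 < r by rewrite (le_lt_trans _ rr).
have lnr : 0 < ln r by rewrite ln_gt0.
have := Hr0 r rr0; rewrite ltr_pdivlMr// => etar.
have : expR (- t * eta r) <= (v ^+ n)^-1.
  rewrite vE -exprM -[X in (X ^+ _)^-1]lnK ?posrE// -expRM_natl -expRN ler_expR.
  rewrite mulNr natrM lerN2.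
  have : 2 * n%:R / t * ln r * t <= eta r * t by rewrite ler_pM2r// ltW.
  have -> : 2 * n%:R / t * ln r * t = 2 * n%:R * ln r by field; rewrite gt_eqF.
  by rewrite (mulrC t).
move=> /(ler_wpM2r (exprn_ge0 n (ltW v1))) /le_trans; apply.
rewrite mulrC ler_pdivrMr ?exprn_gt0// -exprMn lerXn2r ?nnegrE ?mulr_ge0 ?(ltW v0) ?(ltW v1)//.
by rewrite vE; nra.
Qed.

End eta.

(** * Asymptotics *)

Section gamma_recurrence.
Context {R : realType}.
Implicit Types (s : R) (j k n : nat).

Lemma Gamma_pos_prod s n j : 0 < s + n%:R -> (forall i, s + i%:R != 0) ->
  Gamma_pos (s + (n + j)%:R) / \prod_(i < n + j) (s + i%:R) =
  Gamma_pos (s + n%:R) / \prod_(i < n) (s + i%:R).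
Proof.
move=> sn s0; elim: j => [|j IH]; first by rewrite addn0.
have sj : 0 < s + (n + j)%:R by rewrite natrD addrA ltr_wpDr.
rewrite -IH addnS big_ord_recr /= -[(n + j).+1%:R]natr1 addrA (Gamma_posS sj).
by rewrite [_ * Gamma_pos _]mulrC -mulf_div divff ?mulr1.
Qed.

(** The definition of [Gamma] fixes the number of factors, whereas the kernel constant comes with
    [m + 1] of them; the functional equation makes the quotient independent of that number. *)
Lemma Gamma_prod s k : 0 < s + k%:R -> (forall i, s + i%:R != 0) ->
  Gamma s = Gamma_pos (s + k%:R) / \prod_(i < k) (s + i%:R).
Proof.
move=> sk s0; rewrite /Gamma; set n := (Num.truncn (- s)).+1.
have sn : 0 < s + n%:R.
  have := truncnS_gt (- s); rewrite -/n; lra.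
have [nk|/ltnW kn] := leqP n k.
  by rewrite -(subnKC nk) (Gamma_pos_prod _ sn s0).
by rewrite -(subnKC kn) (Gamma_pos_prod _ sk s0).
Qed.

Lemma Gamma_gt0E s : 0 < s -> Gamma s = Gamma_pos s.
Proof.
move=> s0; have si i : s + i%:R != 0 by rewrite gt_eqF// ltr_wpDr.
by rewrite (@Gamma_prod s 0) ?addr0// big_ord0 divr1.
Qed.

End gamma_recurrence.

(** * Taylor representation of the symbol, and the error term *)

Section representation.
Context {R : realType}.
Local Notation mu := (@lebesgue_measure R).
Local Notation intR f := (Rintegral mu setT f).
Implicit Types (a b c e l p q r s t u v w x y z : R) (f g om : R -> R) (k j m n N : nat)
  (G : nat -> R -> R).

Lemma measurable_above_limit f : (forall w, 0 < w -> measurable_fun setT (above w f)) ->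
  measurable_fun setT (above 0 f).
Proof.
move=> mf; have d0 n : 0 < n.+1%:R^-1 :> R by rewrite invr_gt0.
apply: (measurable_fun_cvg (h := fun n => above n.+1%:R^-1 f)) => [n|u _].
  exact: mf.
rewrite /above; case: ifPn => [u0|]; last first.
  rewrite -leNgt => u0; apply: cvg_near_cst; apply: nearW => n.
  by rewrite ltNge (le_trans u0)// ltW.
have [N uN] : exists N, N.+1%:R^-1 < u.
  by exists (Num.truncn u^-1); rewrite invf_plt ?posrE// truncnS_gt.
apply: cvg_near_cst; exists N => // n /= Nn.
by rewrite (le_lt_trans _ uN)// lef_pV2 ?posrE// ler_nat.
Qed.

Lemma weight_le s q N v : 0 < v -> 0 <= q <= N%:R ->
  v `^ s / (1 + v) ^+ N <= v `^ (s - q).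
Proof.
move=> v0 /andP[q0 qN]; have v1 : 0 < 1 + v by rewrite addr_gt0.
rewrite (powRDp _ _ v0) ler_wpM2l ?powR_ge0// powRN lef_pV2 ?posrE ?powR_gt0 ?exprn_gt0//.
rewrite -powR_mulrn ?(ltW v1)//; apply: (@le_trans _ _ ((1 + v) `^ q)).
  by rewrite ge0_ler_powR ?nnegrE ?(ltW v0) ?(ltW v1)//; lra.
by rewrite ler_powR//; lra.
Qed.

Lemma le_absC c x y : x <= c * y -> 0 <= y -> x <= `|c| * y.
Proof. by move=> xc y0; apply: le_trans xc _; rewrite ler_wpM2r// ler_norm. Qed.

(** Near 0 the density times [v^(m + j / 2)] is [O(v^(b + j / 2 - 1))], integrable because [b > 0];
    the lower bound on [N] covers infinity for every [j] up to the dimension. The derivative bounds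
    are singular at 0, hence [w > 0]. *)
Lemma kernel_repr G m n N b : (0 < m)%N -> 0 < b -> b + n.+1%:R / 2 + 2 <= N%:R ->
  fam m.+1 G ->
  (forall j, (j <= m.+1)%N -> exists C, forall v, 0 < v ->
    `|G j v| <= C * (v `^ b / (1 + v) ^+ N / v ^+ j)) ->
  let h v := - taylor_coef m * above 0 (G m.+1) v in
  weighted h m%:R n.+1 /\ forall w, 0 < w -> G 0%N w = hat h (pospow m%:R) w.
Proof.
move=> m0 b0 bN dG bG h; have m0R : 0 < m%:R :> R by rewrite ltr0n.
have n0 : 0 <= n.+1%:R / 2 :> R by rewrite divr_ge0.
have N2 : 2 <= N%:R - b by lra.
have NN : 0 <= (N%:R : R) <= N%:R by rewrite lexx ler0n.
have w0 v : 0 < v -> 0 <= v `^ b / (1 + v) ^+ N.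
  by move=> v0; rewrite divr_ge0 ?powR_ge0 ?exprn_ge0 ?addr_ge0 ?(ltW v0).
have qG w j : (j <= m)%N -> 0 < w -> qdecay w (fun v => v ^+ j * G j v).
  move=> jm w_gt0; have [C HC] := bG j (leqW jm).
  apply: (qdecay_powR N2 w_gt0 (normr_ge0 C)) => v v0.
  rewrite opprB normrM (gtr0_norm (exprn_gt0 _ v0)).
  apply: (@le_trans _ _ (`|C| * (v `^ b / (1 + v) ^+ N))); last first.
    by rewrite ler_wpM2l// weight_le.
  rewrite mulrC -ler_pdivlMr ?exprn_gt0// -mulrA; apply: le_absC (HC v v0) _.
  by rewrite divr_ge0 ?w0 ?exprn_ge0 ?(ltW v0).
have N3 : 2 <= N%:R - (b - 1) by lra.
have qGm w : 0 < w -> qdecay w (fun v => v ^+ m * G m.+1 v).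
  move=> w_gt0; have [C HC] := bG m.+1 (leqnn _).
  apply: (qdecay_powR N3 w_gt0 (normr_ge0 C)) => v v0.
  rewrite opprB normrM (gtr0_norm (exprn_gt0 _ v0)).
  apply: (@le_trans _ _ (`|C| * (v `^ (b - 1) / (1 + v) ^+ N))); last first.
    by rewrite ler_wpM2l// weight_le.
  rewrite mulrC -ler_pdivlMr ?exprn_gt0// -mulrA.
  have -> : v `^ (b - 1) / (1 + v) ^+ N / v ^+ m = v `^ b / (1 + v) ^+ N / v ^+ m.+1.
    rewrite (powRDp _ _ v0) powR_inv1 ?(ltW v0)// exprS; field.
    by rewrite !expf_neq0 ?gt_eqF// ?addr_gt0.
  by apply: le_absC (HC v v0) _; rewrite divr_ge0 ?w0 ?exprn_ge0 ?(ltW v0).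
(* The top derivative need not be continuous; its measurability comes from [ftc_half], where it is a
   limit of difference quotients. *)
have mG : measurable_fun setT (above 0 (G m.+1)).
  apply: measurable_above_limit => w w_gt0.
  have dGm v : w <= v -> drv (G m) v (G m.+1 v).
    by move=> wv; apply: dG => //; exact: lt_le_trans w_gt0 wv.
  have w1 : 0 < w ^+ m by rewrite exprn_gt0.
  have q_ g : qdecay w (fun v => v ^+ m * g v) -> qdecay w g.
    move=> [C HC]; exists (C / w ^+ m) => v wv.
    rewrite mulrAC ler_pdivlMr// mulrC; apply: le_trans (HC v wv).
    rewrite normrM ler_wpM2r// ger0_norm ?exprn_ge0 ?(le_trans (ltW w_gt0))//.
    by rewrite lerXn2r ?nnegrE ?(le_trans (ltW w_gt0)).
  have [i _] := ftc_half dGm (q_ _ (qG w m (leqnn m) w_gt0)) (q_ _ (qGm w w_gt0)).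
  exact: itg_measurable i.
have mh : measurable_fun setT h by apply: measurable_funM.
split; last first.
  move=> w w_gt0.
  have [i ->] := taylor_integral (ltW w_gt0)
    (fun j v (jm : (j <= m)%N) wv => dG j v jm (lt_le_trans w_gt0 wv))
    (fun j jm => qG w j jm w_gt0) (qGm w w_gt0) m0.
  rewrite -mulN1r -(intRZ _ i); apply: eq_intR => v.
  rewrite /h; have [vw|wv] := leP v w.
    by rewrite (aboveF _ vw) pospow_neg ?subr_le0// !mulr0 ?mul0r ?mulr0.
  by rewrite (aboveT _ wv) (aboveT _ (lt_trans w_gt0 wv)); ring.
split=> // j jn.
have jn2 : j%:R / 2 <= n.+1%:R / 2 :> R by rewrite ler_pM2r// ler_nat.
have j0 : 0 <= j%:R / 2 :> R by rewrite divr_ge0.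
have E v : - taylor_coef m * above 0 (fun v => G m.+1 v * pospow (m%:R + j%:R / 2) v) v =
    h v * pospow (m%:R + j%:R / 2) v by rewrite aboveM mulrA.
apply: (eq_itg E); apply: itgZ.
have [C HC] := bG m.+1 (leqnn _).
have B v : 0 < v -> `|G m.+1 v * pospow (m%:R + j%:R / 2) v| <=
    `|C| * (v `^ (b + j%:R / 2 - 1) / (1 + v) ^+ N).
  move=> v0; rewrite normrM (ger0_norm (pospow_ge0 _ _)) pospow_pos ?(ltW v0)//.
  rewrite (powRDp m%:R (j%:R / 2) v0) powR_mulrn ?(ltW v0)//.
  have -> : v `^ (b + j%:R / 2 - 1) / (1 + v) ^+ N =
      v `^ b / (1 + v) ^+ N / v ^+ m.+1 * (v ^+ m * v `^ (j%:R / 2)).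
    rewrite !(powRDp _ _ v0) powR_inv1 ?(ltW v0)// exprS; field.
    by rewrite !expf_neq0 ?gt_eqF// ?addr_gt0.
  rewrite [leRHS]mulrA ler_wpM2r ?mulr_ge0 ?powR_ge0 ?exprn_ge0 ?(ltW v0)//.
  by apply: le_absC (HC v v0) _; rewrite divr_ge0 ?w0 ?exprn_ge0 ?(ltW v0).
apply: (@itg_between _ _ (b + j%:R / 2) (N%:R - b - j%:R / 2) `|C|).
- lra.
- lra.
- apply: (eq_measurable_fun (fun v => above 0 (G m.+1) v * pospow (m%:R + j%:R / 2) v)).
    by move=> v _; rewrite aboveM.
  by apply: measurable_funM => //; exact: measurable_pospow.
- move=> v v0; apply: le_trans (B v v0) _; rewrite ler_wpM2l//.
  rewrite -[X in _ <= _ `^ X]subr0; apply: weight_le => //.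
  by rewrite lexx ler0n.
- move=> v v0; apply: le_trans (B v v0) _; rewrite ler_wpM2l//.
  have -> : - (N%:R - b - j%:R / 2) - 1 = (b + j%:R / 2 - 1) - N%:R :> R by ring.
  exact: weight_le.
Qed.

(** Apply the decay of [Icos] with exponent [2 (a + d)]: it extracts [r^(- a - d)] and leaves
    [f v * v^(- a - d)], which is [O(v^(e - d - 1))] at 0 and [O(v^(- d - 1))] at infinity. So [d]
    must stay below [e] and satisfy [2 (a + d) <= l]. *)
Lemma error_bound f a l e C : 0 < a -> 2 * a < l -> 0 < e ->
  measurable_fun setT (above 0 f) ->
  (forall v, 0 < v -> `|f v| <= C * v `^ (a - 1)) ->
  (forall v, 0 < v -> `|f v| <= C * v `^ (a + e - 1)) ->
  exists d D, 0 < d /\ forall r, 0 < r ->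
    itg (above 0 (fun v => f v * Icos l (Num.sqrt (r * v)))) /\
    `|intR (above 0 (fun v => f v * Icos l (Num.sqrt (r * v))))| <= D * r `^ (- a - d).
Proof.
move=> a0 al e0 mf fC fD; have l0 : 0 < l by lra.
pose d := Num.min (e / 2) (l / 2 - a).
have d0 : 0 < d by rewrite /d lt_min divr_gt0//=; lra.
have de : d <= e / 2 by rewrite /d ge_min lexx.
have dl : d <= l / 2 - a by rewrite /d ge_min lexx orbT.
have [B B0 HB] := Icos_decay l0.
pose g v := f v * v `^ (- a - d).
have g_ : itg (above 0 g).
  apply: (@itg_between _ _ (e - d) d `|C|) => //; first by lra.
  - apply: (eq_measurable_fun (fun v => above 0 f v * above 0 (fun v => v `^ (- a - d)) v)).
      by move=> v _; rewrite /above/g; case: ifP => _ //; rewrite mul0r.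
    by apply: measurable_funM => //; exact: measurable_above_powR.
  - move=> v v0; rewrite /g normrM (ger0_norm (powR_ge0 _ _)).
    have -> : v `^ (e - d - 1) = v `^ (a + e - 1) * v `^ (- a - d).
      by rewrite -(powRDp _ _ v0); congr (_ `^ _); ring.
    rewrite mulrA ler_wpM2r ?powR_ge0//; apply: le_absC (fD v v0) (powR_ge0 _ _).
  - move=> v v0; rewrite /g normrM (ger0_norm (powR_ge0 _ _)).
    have -> : v `^ (- d - 1) = v `^ (a - 1) * v `^ (- a - d).
      by rewrite -(powRDp _ _ v0); congr (_ `^ _); ring.
    rewrite mulrA ler_wpM2r ?powR_ge0//; apply: le_absC (fC v v0) (powR_ge0 _ _).
exists d, (B * intR (fun v => `|above 0 g v|)); split => // r r0.
have bnd v : `|above 0 (fun v => f v * Icos l (Num.sqrt (r * v))) v| <=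
    (B * r `^ (- a - d)) * `|above 0 g v|.
  rewrite /above; case: ltP => v0; last by rewrite !normr0 mulr0.
  rewrite /g !normrM (ger0_norm (powR_ge0 v _)) mulrCA ler_wpM2l//.
  have rv : 0 < r * v by rewrite mulr_gt0.
  have sv : 0 < Num.sqrt (r * v) by rewrite sqrtr_gt0.
  have Nl : 0 <= 2 * (a + d) <= l by apply/andP; split; lra.
  apply: le_trans (HB _ _ Nl sv) _.
  rewrite -powR_half ?(ltW rv)// -powRrM -mulrA -powRM ?(ltW r0) ?(ltW v0)//.
  have -> : 2^-1 * - (2 * (a + d)) = - a - d by field.
  by [].
have i : itg (above 0 (fun v => f v * Icos l (Num.sqrt (r * v)))).
  apply: (itg_le _ bnd (itgZ _ (itg_norm g_))).
  apply: (eq_measurable_fun (fun v => above 0 f v * Icos l (Num.sqrt (r * v)))).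
    by move=> v _; rewrite aboveM.
  apply: measurable_funM => //; apply: (measurable_compR (measurable_Icos_sqrt l)).
  exact: measurable_funM.
split => //; apply: le_trans (normr_intR_le i (itgZ _ (itg_norm g_)) bnd) _.
by rewrite (intRZ _ (itg_norm g_)) mulrAC.
Qed.

Lemma normr_expR_sub1 x : `|expR x - 1| <= `|x| * (1 + expR x).
Proof.
have h1 := expR_ge1Dx x; have h2 := expR_ge1Dx (- x); have e0 := expR_gt0 x.
have h3 : expR x * expR (- x) = 1 by rewrite -expRD subrr expR0.
have h4 : expR x * (1 - x) <= 1 by rewrite -[leRHS]h3 ler_pM2l.
have h5 : x <= `|x| by exact: ler_norm.
have h6 : - x <= `|x| by rewrite -normrN ler_norm.
by rewrite ler_norml; apply/andP; split; nra.
Qed.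

(** Subtracting 1 gains [v^a] at 0, while at infinity only boundedness remains. For the derivatives
    one power of decay suffices, by [v^a / (1 + v) <= min 1 (v^a)]. *)
Lemma sym_exp_sub1 k t a E : 0 < a <= 1 -> 0 <= t ->
  (forall n, exists C, forall v, 0 < v -> expR (- t * E v) <= C * (1 + v) ^- n) ->
  sym k (fun v => v `^ a) E ->
  sym k (fun v => Num.min 1 (v `^ a)) (fun v => expR (- t * E v) - 1).
Proof.
move=> a01 t0 eC Ek.
have val : exists C, forall v, 0 < v -> `|expR (- t * E v) - 1| <= C * Num.min 1 (v `^ a).
  have [C HC] := eC 0%N.
  have [D HD] : exists D, forall v, 0 < v -> `|E v| <= D * v `^ a.
    by case: k Ek => [|k] [].
  exists ((1 + C) * (1 + t * `|D|)) => v v0.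
  have e0 := expR_gt0 (- t * E v).
  have eC1 : expR (- t * E v) <= C by have := HC v v0; rewrite expr0 invr1 mulr1.
  have D0 : 0 <= t * `|D| by rewrite mulr_ge0.
  have C0 : 0 < C by exact: lt_le_trans e0 eC1.
  have va := powR_gt0 a v0.
  rewrite minEle; case: ifP => _.
    rewrite mulr1 ler_norml; apply/andP; split; nra.
  apply: le_trans (normr_expR_sub1 _) _.
  have h : `|- t * E v| <= t * `|D| * v `^ a.
    rewrite normrM normrN (ger0_norm t0) -mulrA ler_wpM2l//.
    exact: le_absC (HD v v0) (ltW va).
  apply: (@le_trans _ _ (t * `|D| * v `^ a * (1 + C))).
    by apply: ler_pM => //; lra.
  by move: (t * `|D|) D0 (v `^ a) va => T T0 V V0; nra.
case: k Ek => [|k] Ek; split => //.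
have eS := sym_exp a01 eC (symS Ek) 1%N.
case: Ek => _ [E' EE' E'k].
exists (fun v => (- t) * (E' v * expR (- t * E v))).
  move=> v v0.
  apply: drv_eq (drvD (@drv_comp R expR (fun v => - t * E v) v _ _ (is_derive_expR _)
    (drvZ (- t) (EE' v v0))) (drv_cst (-1) v)) _.
  by rewrite addr0 mulrC mulrA.
apply: symZ; apply: sym_weaken (symM E'k eS) => [|v v0]; first exact: ler01.
have v1 : 0 < 1 + v by rewrite addr_gt0.
have va := powR_gt0 a v0.
rewrite mul1r !mulr_ge0 ?powR_ge0 ?invr_ge0 ?exprn_ge0 ?(ltW v0) ?(ltW v1)//=.
rewrite expr1 mulrAC ler_wpM2r ?invr_ge0 ?(ltW v0)// ler_pdivrMr//.
rewrite minEle; case: ifP => _; first by rewrite mul1r powR_le1D.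
by rewrite ler_peMr ?(ltW va)// lerDl ltW.
Qed.

End representation.

(** * Main term, remainder and conclusion *)

Section asymptotics.
Context {R : realType}.
Local Notation mu := (@lebesgue_measure R).
Local Notation intR f := (Rintegral mu setT f).
Implicit Types (a b c e l p q r s t u v w y z : R) (f g om : R -> R) (k j m n N : nat)
  (G F : nat -> R -> R).

Lemma enorm_sqrE n (x : n.-tuple R) : enorm x ^+ 2 = \sum_(y <- x) y ^+ 2.
Proof.
rewrite /enorm /dotR big_tuple sqr_sqrtr.
  by apply: eq_bigr => i _; rewrite expr2.
by apply: sumr_ge0 => i _; rewrite -expr2 sqr_ge0.
Qed.

Lemma Viter_kernel m n (x : n.+1.-tuple R) v : (0 < m)%N -> 0 < v ->
  Viter x (pospow m%:R) v = cpows m%:R n *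
    (v `^ (m%:R + n%:R / 2 + 2^-1) * Icos (m%:R + n%:R / 2) (Num.sqrt (enorm x ^+ 2 * v))).
Proof.
move=> m0 v0; have m0R : 0 < m%:R :> R by rewrite ltr0n.
have l0 : 0 < m%:R + n%:R / 2 :> R by rewrite ltr_wpDr// divr_ge0.
rewrite enorm_sqrE; case/tupleP: x => x0 x.
rewrite [tval _]/= Viter_rot// size_tuple Vop_scale// -sqrtrM ?sumsq_ge0//.
Qed.

(** Shifting [Gamma (- b)] by [m + 1] steps gives the Gamma value at [m + 1 - b], which is exactly
    the one left over in [mellin_const]; the product in the denominator is that of the derivative of
    [v^b] up to the sign [(-1)^(m + 1)], which [- taylor_coef m] compensates. *)
Lemma main_const m n b : (0 < m)%N -> 0 < b -> (forall i : nat, b != i%:R) ->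
  let a := n.+1%:R / 2 + b in 2 * a < m%:R + n%:R / 2 ->
  - taylor_coef m * cpows m%:R n *
    ((\prod_(i < m.+1) (b - i%:R)) * mellin a (m%:R + n%:R / 2)) =
  Num.sqrt pi ^+ n.+1 * (4 `^ a * Gamma a) / Gamma (- b).
Proof.
move=> m0 b0 bi a al.
have a0 : 0 < a by rewrite /a ltr_wpDl// divr_ge0.
have n0 : 0 <= n%:R :> R by [].
have nS : n.+1%:R = n%:R + 1 :> R by rewrite natr1.
have mS : m.+1%:R = m%:R + 1 :> R by rewrite natr1.
have bm : 0 < - b + m.+1%:R by rewrite mS; move: al; rewrite /a nS; lra.
have bi' i : - b + i%:R != 0 by rewrite addrC subr_eq0 eq_sym.
rewrite (Gamma_gt0E a0) (Gamma_prod bm bi') -(mellin_const m0 a0 al).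
have -> : m%:R + n%:R / 2 + 2^-1 + 1 - a = - b + m.+1%:R.
  by rewrite /a nS mS; field.
have g0 := lt0r_neq0 (Gamma_pos_gt0 bm).
have -> : \prod_(i < m.+1) (- b + i%:R) = (-1) ^+ m.+1 * \prod_(i < m.+1) (b - i%:R).
  elim: (m.+1) => [|i IH]; first by rewrite !big_ord0 mulr1.
  by rewrite !big_ord_recr/= IH exprS; ring.
have p0 : \prod_(i < m.+1) (b - i%:R) != 0.
  by apply/prodf_neq0 => i _; rewrite subr_eq0.
have f0 : m`!%:R != 0 :> R by rewrite pnatr_eq0 -lt0n fact_gt0.
have s0 : (-1) ^+ m.+1 != 0 :> R by rewrite signr_eq0.
rewrite /taylor_coef; move: g0 p0 f0 s0.
set Ga := Gamma_pos _; set P := \prod_(i < _) _; set c := cpows _ _; set M := mellin _ _.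
rewrite exprS => g0 p0 f0 s0; field.
move: s0; rewrite mulf_eq0 negb_or => /andP[_ s0].
by rewrite ?g0 ?p0 ?f0 ?s0.
Qed.

Lemma Gamma_neq0 s : (forall i : nat, s + i%:R != 0) -> Gamma s != 0.
Proof.
move=> s0; pose n := (Num.truncn (- s)).+1.
have sn : 0 < s + n%:R by have := truncnS_gt (- s); rewrite -/n; lra.
rewrite (Gamma_prod sn s0) mulf_neq0 ?(lt0r_neq0 (Gamma_pos_gt0 sn))// invr_eq0.
by apply/prodf_neq0 => i _; exact: s0.
Qed.

(** [G] holds the derivatives of the whole symbol and [F] those of its difference from [v^b]. Only
    [G] is represented through [hat]; [F] enters through its top derivative alone, which
    [fam_unique] identifies. *)
Lemma kernel_asymp G F (H : R -> R) m n N b e : (0 < m)%N -> 0 < b -> 0 < e ->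
  (forall i : nat, b != i%:R) ->
  let a := n.+1%:R / 2 + b in 2 * a < m%:R + n%:R / 2 ->
  b + n.+1%:R / 2 + 2 <= N%:R -> fam m.+1 G ->
  (forall j, (j <= m.+1)%N -> exists C, forall v, 0 < v ->
    `|G j v| <= C * (v `^ b / (1 + v) ^+ N / v ^+ j)) ->
  H =1 above 0 (G 0%N) ->
  fam m.+1 F ->
  (exists C, forall v, 0 < v ->
    `|F m.+1 v| <= C * (v `^ b * Num.min 1 (v `^ e) / v ^+ m.+1)) ->
  (forall v, 0 < v -> G 0%N v = F 0%N v + v `^ b) ->
  exists d D, 0 < d /\ forall x : n.+1.-tuple R, 0 < enorm x ->
    `|integral_Rd (fun xi => cos (dotR x xi) * H (dotR xi xi)) -
      Num.sqrt pi ^+ n.+1 * (4 `^ a * Gamma a) / Gamma (- b) * enorm x `^ (- (2 * a))|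
      <= D * enorm x `^ (- (2 * a) - d) /\
    integral_Rd (fun xi => - sin (dotR x xi) * H (dotR xi xi)) = 0.
Proof.
move=> m0 b0 e0 bi a al bN dG bG HG dF [C HC] GF.
have m0R : 0 < m%:R :> R by rewrite ltr0n.
have a0 : 0 < a by rewrite /a ltr_wpDl// divr_ge0.
have nS : n.+1%:R = n%:R + 1 :> R by rewrite natr1.
have mS : m.+1%:R = m%:R + 1 :> R by rewrite natr1.
have GFk v : 0 < v -> G m.+1 v = F m.+1 v + powfam b m.+1 v.
  move=> v0; apply: (fam_unique dG (famD dF (@fam_powfam _ m.+1 b)) _ (leqnn _) v0) => u u0.
  by rewrite GF// /powfam big_ord0 mul1r subr0.
have [wh Gh] := kernel_repr m0 b0 bN dG bG.
set h := fun v => _ in wh Gh.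
have mG : measurable_fun setT (above 0 (G m.+1)).
  have t0 : - taylor_coef m != 0 :> R.
    by rewrite /taylor_coef oppr_eq0 mulf_neq0 ?signr_eq0// invr_eq0 pnatr_eq0 -lt0n fact_gt0.
  apply: (eq_measurable_fun (fun v => (- taylor_coef m)^-1 * h v)).
    by move=> v _; rewrite /h mulKf.
  by apply: measurable_funM => //; case: wh.
set l := m%:R + n%:R / 2 in al *.
pose f v := F m.+1 v * v `^ (l + 2^-1).
have pE v s : 0 < v -> v `^ (b + s) / v ^+ m.+1 * v `^ (l + 2^-1) = v `^ (a + s - 1).
  move=> v0; rewrite -powR_mulrn ?(ltW v0)// -powRN -!(powRDp _ _ v0).
  by congr (_ `^ _); rewrite /a /l nS mS; field.
have fB v : 0 < v -> `|f v| <= `|C| * (v `^ b * Num.min 1 (v `^ e) / v ^+ m.+1 * v `^ (l + 2^-1)).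
  move=> v0; rewrite /f normrM (ger0_norm (powR_ge0 _ _)) [leRHS]mulrA.
  rewrite ler_wpM2r ?powR_ge0//; apply: le_absC (HC v v0) _.
  by rewrite !mulr_ge0 ?powR_ge0 ?invr_ge0 ?exprn_ge0 ?(ltW v0)// le_min ler01 powR_ge0.
have mf : measurable_fun setT (above 0 f).
  apply: (eq_measurable_fun (fun v => (above 0 (G m.+1) v - (\prod_(i < m.+1) (b - i%:R)) *
      above 0 (fun v => v `^ (b - m.+1%:R)) v) * above 0 (fun v => v `^ (l + 2^-1)) v)).
    move=> v _; rewrite /above; case: ltP => v0; last by rewrite mulr0.
    by rewrite (GFk v v0) /powfam addrK.
  apply: measurable_funM; last exact: measurable_above_powR.
  apply: measurable_funB => //; apply: measurable_funM => //.
  exact: measurable_above_powR.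
have [||d [D [d0 HD]]] := @error_bound R f a l e `|C| a0 al e0 mf.
- move=> v v0; apply: le_trans (fB v v0) _; rewrite ler_wpM2l//.
  rewrite -[X in _ <= _ `^ (X - 1)]addr0 -(pE v 0 v0) addr0.
  rewrite !ler_wpM2r ?powR_ge0 ?invr_ge0 ?exprn_ge0 ?(ltW v0)//.
  by rewrite ler_piMr ?powR_ge0// ge_min lexx.
- move=> v v0; apply: le_trans (fB v v0) _; rewrite ler_wpM2l//.
  rewrite -(pE v e v0) (powRDp _ _ v0).
  rewrite !ler_wpM2r ?powR_ge0 ?invr_ge0 ?exprn_ge0 ?(ltW v0)//.
  by rewrite ler_wpM2l ?powR_ge0// ge_min lexx orbT.
pose kap := - taylor_coef m * cpows m%:R n : R.
have mH : measurable_fun setT H.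
  apply: (eq_measurable_fun (above 0 (G 0%N))); first by move=> v _; rewrite HG.
  apply: measurable_above => u u0; exact: (drv_continuous (dG 0%N u (ltn0Sn m) u0)).
have Hh w : 0 < w -> H w = hat h (pospow m%:R) w.
  by move=> w0; rewrite HG (aboveT _ w0) Gh.
(* The exponent doubles because [error_bound] is stated in [r = |x|^2]. *)
exists (2 * d), (`|kap| * D); split; first by rewrite mulr_gt0.
move=> x x0; have r0 : 0 < enorm x ^+ 2 by rewrite exprn_gt0.
have T s w := @integral_Rd_hat R h (pospow m%:R) m%:R n x H m0R (dominated_pospow _) wh mH Hh s w.
have powE s : (enorm x ^+ 2) `^ s = enorm x `^ (2 * s).
  by rewrite -powR_mulrn ?(ltW x0)// -powRrM.
have [i1 B1] := HD _ r0; have [i2 E2] := mellin_scale a0 al r0.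
split; last first.
  (* The phase [pi / 2] turns the cosine into [- sin], and the result is a multiple of
     [cos (pi / 2) = 0]. *)
  transitivity (cos (pi / 2) * hat h (Viter x (pospow m%:R)) 0).
    rewrite -T//; congr integral_Rd; apply/funext => xi.
    by rewrite add0r addrC cosDpihalf.
  by rewrite cos_pihalf mul0r.
have -> : integral_Rd (fun xi => cos (dotR x xi) * H (dotR xi xi)) =
    hat h (Viter x (pospow m%:R)) 0.
  transitivity (cos 0 * hat h (Viter x (pospow m%:R)) 0); last by rewrite cos0 mul1r.
  by rewrite -T//; congr integral_Rd; apply/funext => xi; rewrite !add0r.
set I1 := fun v => _ in i1 B1; set I2 := fun v => _ in i2 E2.
pose ck := \prod_(i < m.+1) (b - i%:R).
have -> : hat h (Viter x (pospow m%:R)) 0 =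
    kap * (intR (above 0 I1) + ck * intR (above 0 I2)).
  rewrite -(intRZ _ i2) -(intRD i1 (itgZ ck i2)) -(intRZ _ (itgD i1 (itgZ ck i2))).
  apply: eq_intR => v; rewrite subr0 /h /above; case: ltP => v0; last first.
    by rewrite !(mulr0, mul0r, addr0).
  rewrite (Viter_kernel _ m0 v0) -/l (GFk v v0) /I1 /I2 /f /powfam -/ck /kap.
  have -> : v `^ (a - 1) = v `^ (b - m.+1%:R) * v `^ (l + 2^-1).
    by rewrite -(powRDp _ _ v0); congr (_ `^ _); rewrite /a /l nS mS; field.
  move: (Icos _ _) (taylor_coef m) (cpows _ _) ck => X1 X2 X3 X4.
  by ring.
rewrite E2 -(main_const m0 b0 bi al) -/l -/ck -/kap powE.
have -> : 2 * - a = - (2 * a) by ring.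
have -> : kap * (intR (above 0 I1) + ck * (enorm x `^ (- (2 * a)) * mellin a l)) -
    kap * (ck * mellin a l) * enorm x `^ (- (2 * a)) = kap * intR (above 0 I1).
  move: (intR _) (mellin _ _) => X Y; ring.
rewrite normrM -mulrA ler_wpM2l//; move: B1; rewrite powE.
by have -> : 2 * (- a - d) = - (2 * a) - 2 * d by ring.
Qed.

Lemma asymp_ratio (T : Type) (r K g : T -> R) (Q D s d : R) : Q != 0 -> 0 < d ->
  (forall x, g x = Q * r x `^ (- s)) ->
  (forall x, 0 < r x -> `|K x - Q * r x `^ (- s)| <= D * r x `^ (- s - d)) ->
  forall eps, 0 < eps -> exists M, 0 <= M /\ forall x, M < r x -> `|K x / g x - 1| < eps.
Proof.
move=> Q0 d0 gE KE eps eps0.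
pose B := `|D| / `|Q| / eps + 1.
have Qn : 0 < `|Q| by rewrite normr_gt0.
have B0 : 0 < B by rewrite /B ltr_wpDl// !mulr_ge0// invr_ge0 ltW.
exists (B `^ d^-1); split; first exact: powR_ge0.
move=> x xM; have r0 : 0 < r x by exact: le_lt_trans (powR_ge0 _ _) xM.
have rB : B < r x `^ d.
  have -> : B = (B `^ d^-1) `^ d by rewrite -powRrM mulVf ?gt_eqF// powRr1 ?(ltW B0).
  by rewrite gt0_ltr_powR ?nnegrE ?powR_ge0 ?(ltW r0).
have p0 : 0 < r x `^ (- s) by rewrite powR_gt0.
have -> : K x / g x - 1 = (K x - Q * r x `^ (- s)) / (Q * r x `^ (- s)).
  by rewrite gE; field; rewrite Q0 gt_eqF.
rewrite normrM normfV normrM (gtr0_norm p0) ltr_pdivrMr ?mulr_gt0//.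
apply: le_lt_trans (KE x r0) _; rewrite (powRDp _ _ r0) (powRN _ d) mulrCA [ltRHS]mulrC -mulrA.
rewrite mulrC -mulrA ltr_pM2l//.
have q0 : 0 < r x `^ d by rewrite powR_gt0.
rewrite ltr_pdivrMr//; apply: le_lt_trans (ler_norm D) _.
have : `|D| / `|Q| / eps < r x `^ d by apply: lt_trans rB; rewrite /B ltrDl.
by rewrite ltr_pdivrMr// ltr_pdivrMr//; nra.
Qed.

End asymptotics.

Theorem theorem4p1 (R : realType) (d : nat) (beta : R) (eta : R -> R)
    (k : nat) (alpha A : R) :
  (2 <= d)%N ->
  0 <= beta ->
  {within `[0%R, +oo[, continuous eta} ->
  (forall m : nat, (m < k)%N -> forall r : R, 0 < r ->
     derivable (derive1n m eta) r 1) ->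
  ((d%:R + 3) / 2 + beta < k%:R) ->
  (forall M : R, exists r0 : R, forall r : R, r0 < r -> M < eta r / ln r) ->
  0 < alpha -> alpha < 2 ->
  (forall m : nat, (m <= k)%N -> forall r : R, 0 < r ->
     `| r `^ (m%:R - alpha) * derive1n m eta r | <= A) ->
  (forall n : nat, beta != (2 * n)%:R) ->
  forall t : R, 0 < t ->
  let g := fun x : d.-tuple R =>
    (2 `^ beta * Gamma ((d%:R + beta) / 2)) /
      (pi `^ (d%:R / 2) * Gamma (- beta / 2)) *
    (expR (- t * eta 0) / enorm x `^ (d%:R + beta)) in
  forall eps : R, 0 < eps -> exists M : R, forall x : d.-tuple R, M < enorm x ->
    `| Kre beta eta t x / g x - 1 | < eps /\ `| Kim beta eta t x / g x | < eps.
Proof.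
case: d => [//|n] d2 beta_ge0 eta_cont eta_der.
case: k eta_der => [|m] eta_der kd eta_inf alpha0 alpha2 eta_bound betaN t t0 g eps eps0.
  by exfalso; move: kd; have := ler0n R n.+1; lra.
have nS : n.+1%:R = n%:R + 1 :> R by rewrite natr1.
have mS : m.+1%:R = m%:R + 1 :> R by rewrite natr1.
have n0 : 0 <= n%:R :> R by [].
have beta0 : 0 < beta by rewrite lt0r beta_ge0 andbT; exact: betaN 0%N.
have m0 : (0 < m)%N by rewrite -(ltr0n R); move: kd; rewrite nS mS; lra.
pose b := beta / 2; have b0 : 0 < b by rewrite divr_gt0.
have bi (i : nat) : b != i%:R.
  apply: contra (betaN i) => /eqP bE; apply/eqP.
  by rewrite natrM -bE /b; field.
pose a := n.+1%:R / 2 + b.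
(* Here [2 a = d + beta] and the right side is [k - 1 + (d - 1) / 2], so this is the hypothesis on
   [k]. *)
have al : 2 * a < m%:R + n%:R / 2 by move: kd; rewrite /a /b nS mS; lra.
pose e := alpha / 2; have e01 : 0 < e <= 1 by rewrite /e; apply/andP; split; lra.
have e0 : 0 < e by case/andP: e01.
pose E v := eta (Num.sqrt v).
have Ek : sym m.+1 (fun v => v `^ e) E.
  apply: sym_weight (sym_sqrt (eta_sym eta_der eta_bound)) => v v0.
  by rewrite -powR_half ?(ltW v0)// -powRrM mulrC.
have eC (N : nat) := eta_exp_decay eta_inf alpha0 eta_bound N t0.
pose N := (Num.truncn (b + n.+1%:R / 2 + 2)).+1.
have bN : b + n.+1%:R / 2 + 2 <= N%:R by apply/ltW/truncnS_gt.
have powb := sym_powR m.+1 1 b.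
have [G [G0 dG bG]] := sym_fam (symM powb (sym_exp e01 eC Ek N)).
have [F [F0 dF bF]] := sym_fam (symM powb (sym_exp_sub1 e01 (ltW t0) eC Ek)).
have GF v : 0 < v -> G 0%N v = F 0%N v + v `^ b by move=> _; rewrite G0 F0; ring.
pose H w := Num.sqrt w `^ beta * expR (- t * eta (Num.sqrt w)).
(* For [w <= 0] the square root is 0, and [0 ^ beta = 0] because [beta > 0]. *)
have HG : H =1 above 0 (G 0%N).
  move=> w; rewrite /H /above G0; case: ltP => w0.
    rewrite mul1r -{1}powR_half ?(ltW w0)// -powRrM mulrC.
    by rewrite (_ : 2^-1 * beta = b) 1?mulrC//.
  by rewrite ler0_sqrtr// powR0 ?mul0r// gt_eqF.
have [d0 [D [d0_gt0 HD]]] := kernel_asymp m0 b0 e0 bi al bN dG bG HG dF (bF _ (leqnn _)) GF.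
pose c := (2 * pi) `^ (- n.+1%:R) : R.
have c0 : 0 < c by rewrite powR_gt0// mulr_gt0// pi_gt0.
pose Q0 := Num.sqrt pi ^+ n.+1 * (4 `^ a * Gamma a) / Gamma (- b) : R.
pose Q := c * Q0.
have a0 : 0 < a by rewrite /a ltr_wpDl// divr_ge0.
have G2 : Gamma (- b) != 0.
  by apply: Gamma_neq0 => i; rewrite addrC subr_eq0 eq_sym.
have Q_neq0 : Q != 0.
  have G1 : Gamma a != 0 by rewrite (Gamma_gt0E a0) (lt0r_neq0 (Gamma_pos_gt0 a0)).
  have p1 : Num.sqrt pi ^+ n.+1 != 0 :> R by rewrite expf_neq0// sqrtr_eq0 -ltNge pi_gt0.
  have p2 : 4 `^ a != 0 :> R by rewrite gt_eqF// powR_gt0.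
  exact: mulf_neq0 (lt0r_neq0 c0)
    (mulf_neq0 (mulf_neq0 p1 (mulf_neq0 p2 G1)) (invr_neq0 G2)).
have QE : Q = 2 `^ beta * Gamma a / (pi `^ (n.+1%:R / 2) * Gamma (- b)).
  have pi0 := @pi_gt0 R.
  have p4 : 4 `^ a = 2 `^ n.+1%:R * 2 `^ beta :> R.
    have -> : 4 = 2 `^ 2%:R :> R by rewrite powR_mulrn// -natrX.
    by rewrite -powRrM -powRDp//; congr (_ `^ _); rewrite /a /b; field.
  have ps : Num.sqrt pi ^+ n.+1 = pi `^ (n.+1%:R / 2) :> R.
    by rewrite -powR_half ?(ltW pi0)// -powR_mulrn ?powR_ge0// -powRrM mulrC.
  have pp : pi `^ n.+1%:R = pi `^ (n.+1%:R / 2) * pi `^ (n.+1%:R / 2) :> R.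
    by rewrite -powRDp//; congr (_ `^ _); field.
  have h1 : 2 `^ n.+1%:R != 0 :> R by rewrite gt_eqF// powR_gt0.
  have h2 : pi `^ (n.+1%:R / 2) != 0 :> R by rewrite gt_eqF// powR_gt0.
  rewrite /Q /Q0 /c powRN powRM ?(ltW pi0)// p4 ps pp.
  move: (Gamma a) (2 `^ beta) => X1 X2.
  move: (2 `^ n.+1%:R) (pi `^ (n.+1%:R / 2)) (Gamma (- b)) h1 h2 G2 => X3 X4 X5 h1 h2 h3.
  by field; rewrite h1 h2 h3.
have gE x : g x = Q * enorm x `^ (- (2 * a)).
  rewrite /g QE (eta0 eta_cont alpha0 eta_bound) mulr0 expR0 div1r powRN.
  have -> : (n.+1%:R + beta) / 2 = a by rewrite /a /b; field.
  have -> : n.+1%:R + beta = 2 * a by rewrite /a /b; field.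
  by rewrite mulNr.
have KE (x : n.+1.-tuple R) : 0 < enorm x ->
    `|Kre beta eta t x - Q * enorm x `^ (- (2 * a))| <= (c * D) * enorm x `^ (- (2 * a) - d0).
  move=> x0; have [B _] := HD x x0.
  rewrite /Kre -/c /Q -[c * Q0 * _]mulrA -mulrBr normrM (gtr0_norm c0) -mulrA.
  by rewrite ler_wpM2l ?(ltW c0).
have [M [M0 HM]] := asymp_ratio Q_neq0 d0_gt0 gE KE eps0.
exists M => x xM; split; first exact: HM.
have [_ K0] := HD x (le_lt_trans M0 xM).
rewrite /Kim (_ : integral_Rd _ = 0); last exact: K0.
by rewrite mulr0 mul0r normr0.
Qed.
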